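(* Let $n\ge3$ and let $K$ be a convex body in $\mathbb{R}^n$ with the origin in its interior. Then for every $u\in S^{n-1}$, $$V_K(\{u\})+V_K(\{-u\})+2(n-1)\sqrt{V_K(\{u\})\,V_K(\{-u\})}\le V(K),$$ with equality if and only if $F(K,-u)$ is a translate of $F(K,u)$, $K=[F(K,u),F(K,-u)]$, and $h(K,u)=h(K,-u)$.
   Context: A convex body is a compact convex subset of $\mathbb{R}^n$ with non-empty interior; $V(K)$ is its volume. $h(K,x)=\max\{x\cdot y:y\in K\}$ is the support function, and $F(K,u)=\{x\in K: x\cdot u=h(K,u)\}$ is the face in direction $u\in S^{n-1}$. $[K,L]$ denotes the convex hull of $K\cup L$. For a convex body $K$ containing the origin in its interior, the cone-volume measure $V_K$ is the Borel measure on $S^{n-1}$ given by $V_K(\omega)=\frac1n\int_{\nu_K^{-1}(\omega)}x\cdot\nu_K(x)\,d\mathcal{H}^{n-1}(x)$, where $\nu_K$ is the Gauss map defined on the set of boundary points of $K$ having a unique outer unit normal and $\mathcal{H}^{n-1}$ is $(n-1)$-dimensional Hausdorff measure. In particular $V_K(\{u\})=\frac1n h(K,u)\,\mathcal{H}^{n-1}(F(K,u))$. *)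

(* Defs.v *)
From HB Require Import structures.
From mathcomp Require Import all_boot all_order all_algebra.
From mathcomp Require Import all_classical all_reals all_analysis.

Set Implicit Arguments.
Unset Strict Implicit.
Unset Printing Implicit Defensive.
Import Order.TTheory GRing.Theory Num.Theory numFieldNormedType.Exports.
Local Open Scope classical_set_scope.
Local Open Scope ring_scope.

Section euclidean.
Context {R : realType} {n : nat}.
Implicit Types (x y u : 'rV[R]_n) (A K : set 'rV[R]_n).

Definition dot x y : R := \sum_(i < n) x ord0 i * y ord0 i.

(* The library norm on ['rV[R]_n] is the sup norm. It induces the usual
   topology, which is all that [compact], [closure] and [interior] see. *)
Definition enorm x : R := Num.sqrt (dot x x).

Definition unit_sphere : set 'rV[R]_n := [set u | enorm u = 1].

Definition convex_hull A : set 'rV[R]_n :=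
  smallest (@convex_set R 'rV[R]_n) A.

Definition convex_body K :=
  [/\ compact K, @convex_set R 'rV[R]_n K & interior K !=set0].

Definition support_fun K x : R := sup [set dot x y | y in K].

Definition face K u : set 'rV[R]_n :=
  K `&` [set x | dot x u = support_fun K u].

End euclidean.

Section volume.
Context {R : realType} {n : nat}.

Definition box (a b : 'rV[R]_n) : set 'rV[R]_n :=
  [set x | forall i, a ord0 i <= x ord0 i <= b ord0 i].

(* n-dimensional Lebesgue (outer) measure, for [0 < n]. *)
Definition volume (A : set 'rV[R]_n) : \bar R :=
  ereal_inf [set (\sum_(k <oo) (\prod_(i < n) (c.2 k ord0 i - c.1 k ord0 i))%:E)%E
            | c in [set c : ('rV[R]_n)^nat * ('rV[R]_n)^nat |
                (forall k i, c.1 k ord0 i <= c.2 k ord0 i) /\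
                A `<=` \bigcup_k box (c.1 k) (c.2 k)]].

End volume.

Section cover_inf.
Context {R : realType} {T : pointedType}.
Local Open Scope ereal_scope.

Definition cover_inf (C : set (set T)) (g : set T -> \bar R) (A : set T) :=
  ereal_inf [set \sum_(k <oo) g (F k) | F in
    [set F : (set T)^nat | (forall k, C (F k)) /\ A `<=` \bigcup_k F k]].

Context {C : set (set T)} {g : set T -> \bar R}.
Hypothesis C0 : C set0.
Hypothesis g0 : g set0 = 0.
Hypothesis g_ge0 : forall A, 0 <= g A.

Let penalized (A : set (g_sigma_algebraType [set: set T])) : \bar R :=
  if `[< C A >] then g A else +oo.

Let penalized_ge0 A : 0 <= penalized A.
Proof. by rewrite /penalized; case: ifP => _; rewrite ?leey. Qed.

Let penalizedE A : C A -> penalized A = g A.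
Proof. by move=> CA; rewrite /penalized asboolT. Qed.

Let cover_infE A : cover_inf C g A = mu_ext penalized A.
Proof.
apply/eqP; rewrite eq_le; apply/andP; split.
  apply: le_ereal_inf_tmp => _ [F [_ AF] <-].
  have [CF|/existsNP[k nCF]] := pselect (forall k, C (F k)).
    by apply: ereal_inf_lbound; exists F => //; apply: eq_eseriesr => i _;
      rewrite penalizedE.
  rewrite (@eseries_pinfty _ _ _ k) ?leey// => [i _|].
    by rewrite gt_eqF// (lt_le_trans _ (penalized_ge0 _)).
  by rewrite /penalized asboolF.
apply: le_ereal_inf_tmp => _ [F [CF AF] <-].
apply: ereal_inf_lbound; exists F; first by split=> // i; exact: sub_gen_smallest.
by apply: eq_eseriesr => i _; rewrite penalizedE.
Qed.

Lemma cover_inf_ge0 A : 0 <= cover_inf C g A.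
Proof. by rewrite cover_infE; exact: mu_ext_ge0 penalized_ge0 _. Qed.

Lemma cover_inf0 : cover_inf C g set0 = 0.
Proof.
by rewrite cover_infE mu_ext0// penalizedE.
Qed.

Lemma le_cover_inf : {homo cover_inf C g : A B / A `<=` B >-> A <= B}.
Proof. by move=> A B AB; rewrite !cover_infE; exact: le_mu_ext. Qed.

Lemma cover_inf_sigma_subadditive : sigma_subadditive (cover_inf C g).
Proof.
move=> F; rewrite cover_infE; under eq_eseriesr do rewrite cover_infE.
exact: mu_ext_sigma_subadditive.
Qed.

End cover_inf.

Section hausdorff.
Context {R : realType}.
Local Open Scope ereal_scope.

(* [0%E] is included so that the empty set has diameter 0, not [-oo]. *)
Definition diam n (A : set 'rV[R]_n) : \bar R :=
  ereal_sup (0 |` [set (enorm (p.1 - p.2))%:E | p in A `*` A]).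

(* The empty set has weight 0 also when [d = 0]. *)
Definition diam_pow n (d : nat) (A : set 'rV[R]_n) : \bar R :=
  if A == set0 then 0 else diam A ^+ d.

Definition hausdorff_delta n (d : nat) (delta : R) (A : set 'rV[R]_n) :=
  cover_inf [set E | diam E <= delta%:E] (@diam_pow n d) A.

Definition hausdorff_raw n (d : nat) (A : set 'rV[R]_n) : \bar R :=
  ereal_sup [set hausdorff_delta d delta A | delta in [set r : R | (0 < r)%R]].

(* d-dimensional Hausdorff measure on R^n, normalized to agree with Lebesgue
   measure in R^d: the unit cube of R^d has measure 1. *)
Definition hausdorff n (d : nat) (A : set 'rV[R]_n) : \bar R :=
  ((fine (hausdorff_raw d (@box R d 0 (const_mx 1))))^-1)%:E *
    hausdorff_raw d A.

Lemma diam_ge0 n (A : set 'rV[R]_n) : 0 <= diam A.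
Proof. by apply: ereal_sup_ubound; left. Qed.

Lemma diam0 n : diam (@set0 'rV[R]_n) = 0.
Proof.
apply/eqP; rewrite eq_le diam_ge0 andbT.
by apply: ge_ereal_sup => _ [->//|[[x y] [] []]].
Qed.

Lemma diam_pow0 n d : diam_pow d (@set0 'rV[R]_n) = 0.
Proof. by rewrite /diam_pow eqxx. Qed.

Lemma diam_pow_ge0 n d (A : set 'rV[R]_n) : 0 <= diam_pow d A.
Proof. by rewrite /diam_pow; case: ifP => // _; exact/expe_ge0/diam_ge0. Qed.

Lemma hausdorff_raw_ge0 n d (A : set 'rV[R]_n) : 0 <= hausdorff_raw d A.
Proof.
apply: (@le_trans _ _ (hausdorff_delta d 1 A)).
  by apply: cover_inf_ge0; exact: diam_pow_ge0.
by apply: ereal_sup_ubound; exists 1%R => /=.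
Qed.

Section outer.
Variables n d : nat.

Let small0 (delta : R) : (0 < delta)%R ->
  [set E : set 'rV[R]_n | diam E <= delta%:E] set0.
Proof. by move=> d0; rewrite /= diam0 lee_fin ltW. Qed.

Lemma hausdorff_raw0 : hausdorff_raw d (@set0 'rV[R]_n) = 0.
Proof.
apply/eqP; rewrite eq_le hausdorff_raw_ge0 andbT.
apply: ge_ereal_sup => _ [r /= r0 <-].
by rewrite /hausdorff_delta cover_inf0//;
  [exact: small0|exact: diam_pow0|exact: diam_pow_ge0].
Qed.

Lemma le_hausdorff_raw :
  {homo @hausdorff_raw n d : A B / A `<=` B >-> A <= B}.
Proof.
move=> A B AB; apply: ge_ereal_sup => _ [r /= r0 <-].
apply: (@le_trans _ _ (hausdorff_delta d r B)).
  by apply: le_cover_inf AB; exact: diam_pow_ge0.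
by apply: ereal_sup_ubound; exists r.
Qed.

Lemma hausdorff_raw_sigma_subadditive :
  sigma_subadditive (@hausdorff_raw n d).
Proof.
move=> F; apply: ge_ereal_sup => _ [r /= r0 <-].
apply: (@le_trans _ _ (\sum_(k <oo) hausdorff_delta d r (F k))).
  by apply: cover_inf_sigma_subadditive; exact: diam_pow_ge0.
apply: lee_nneseries => k _ => [_|].
  by apply: cover_inf_ge0; exact: diam_pow_ge0.
by apply: ereal_sup_ubound; exists r.
Qed.

Let normalization_ge0 :
  (0 <= (fine (hausdorff_raw d (@box R d 0 (const_mx 1))))^-1)%R.
Proof. by rewrite invr_ge0 fine_ge0// hausdorff_raw_ge0. Qed.

Let hausdorff0 : @hausdorff n d set0 = 0.
Proof. by rewrite /hausdorff hausdorff_raw0 mule0. Qed.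

Let hausdorff_ge0 A : 0 <= @hausdorff n d A.
Proof. by rewrite mule_ge0// ?lee_fin// hausdorff_raw_ge0. Qed.

Let le_hausdorff : {homo @hausdorff n d : A B / A `<=` B >-> A <= B}.
Proof.
by move=> A B AB; rewrite lee_wpmul2l ?lee_fin//; exact: le_hausdorff_raw.
Qed.

Let hausdorff_sigma_subadditive : sigma_subadditive (@hausdorff n d).
Proof.
move=> F; rewrite /hausdorff nneseriesZl//; last first.
  by move=> k _; exact: hausdorff_raw_ge0.
by rewrite lee_wpmul2l ?lee_fin//; exact: hausdorff_raw_sigma_subadditive.
Qed.

HB.instance Definition _ := isOuterMeasure.Build R 'rV[R]_n (@hausdorff n d)
  hausdorff0 hausdorff_ge0 le_hausdorff hausdorff_sigma_subadditive.

End outer.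

(* Measure on the Caratheodory sigma-algebra, which contains the Borel sets. *)
Definition hausdorff_measure n d (A : set (caratheodory_type (@hausdorff n d))) :=
  hausdorff d A.

HB.instance Definition _ n d := isMeasure.Build _
  (caratheodory_type (@hausdorff n d)) R (@hausdorff_measure n d)
  (@caratheodory_measure0 _ _ (@hausdorff n d))
  (@caratheodory_measure_ge0 _ _ (@hausdorff n d))
  (@caratheodory_measure_sigma_additive _ _ (@hausdorff n d)).

End hausdorff.

Section cone_volume.
Context {R : realType} {n : nat}.
Implicit Types (K omega : set 'rV[R]_n) (x u : 'rV[R]_n).

Definition boundary K : set 'rV[R]_n := closure K `\` interior K.

Definition outer_unit_normal K x : set 'rV[R]_n :=
  [set u | unit_sphere u /\ forall y, K y -> dot y u <= dot x u].

Definition regular_boundary K : set 'rV[R]_n :=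
  [set x | boundary K x /\ exists! u, outer_unit_normal K x u].

(* Meaningful on [regular_boundary K] only. *)
Definition gauss_map K x : 'rV[R]_n := get (outer_unit_normal K x).

Definition gauss_preimage K omega : set 'rV[R]_n :=
  regular_boundary K `&` gauss_map K @^-1` omega.

Definition cone_volume K omega : \bar R :=
  ((n%:R^-1)%:E *
   \int[@hausdorff_measure R n n.-1]_(x in gauss_preimage K omega)
      (dot x (gauss_map K x))%:E)%E.

End cone_volume.

(* Main.v *)
Require Import Defs.
From HB Require Import structures.
From mathcomp Require Import all_boot all_order all_algebra.
From mathcomp Require Import all_classical all_reals all_analysis.
From mathcomp Require Import measurable_realfun zify lra ring.
Set Implicit Arguments.
Unset Strict Implicit.
Unset Printing Implicit Defensive.
Import Order.TTheory GRing.Theory Num.Theory numFieldNormedType.Exports.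
Local Open Scope classical_set_scope.
Local Open Scope ring_scope.

(** Let M = n - 1. A reflection takes [u] to the first coordinate vector. Put a = h(K, u) and
    b = h(K, -u), and let P and Q be the M-dimensional volumes of the slices of K at the
    heights a and -b, which are the faces F(K, u) and F(K, -u). All points over the relative
    interior of a face have a single normal, and the relative boundary is a null set, so the two
    cone volumes are a P / n and b Q / n ([cone_volume_face]).

    The inequality. By Brunn-Minkowski, the M-th root of the volume of the slice at height s is
    a concave function of s. Let alpha and beta be its values at a and -b. Integrating the power
    of the affine function with these end values gives
      n V(K) >= (a + b) (alpha^M + alpha^(M-1) beta + ... + beta^M)
    ([frustum_lower]). Pairing the terms of index i and M - i, and using that a + b is at least
    twice the geometric mean of a and b, one finds that the right-hand side is at least n times
    the left-hand side of the theorem. As M is at least 2, the sum has inner terms and equality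
    forces a = b and P = Q ([frustum_inequality]).

    Equality. Now V(K) = (a + b) P. No slice has a volume larger than P, since otherwise the
    frusta on its two sides would exceed V(K) ([tight_slice_le]). The slice in the middle
    contains the half-sum of the two faces, so there is equality in the Brunn-Minkowski
    inequality and the faces are translates of each other. Each slice contains the translate in
    between, has no larger volume, and so coincides with it ([tight_slices]): K is the hull of
    the faces. Conversely such a hull is contained in a prism, of volume at most (a + b) P
    ([tight_of_prism]), which under a = b and P = Q is the left-hand side of the theorem.

    The inequality of Brunn and Minkowski is proved for unions of boxes by the cutting argument
    of Hadwiger and Ohmann ([brunn_minkowski_boxes]), and extends to convex sets by exhaustion.
    For its equality case ([brunn_minkowski_eq]) let vol F = vol G = A and vol (F + G) <= 2^M A,
    fix a direction v, and let s(t) and r(t) be the levels below which F and G have volume t.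
    The inequality for the parts of F below s(rho + d) and of G below r(rho - d), and for the
    parts of both above a slightly lower quantile, compares the increments of s and r with
    errors of order d^2; summing up, s - r is a constant c(v) ([quantile_growth],
    [quantile_shift]). Comparing the centroids identifies c(v) as the product of v with a fixed
    vector t ([moment_shift]), so that F and G + t lie in the same half-spaces and coincide by
    separation.

    Volume is an outer measure defined by covers with boxes. The volumes of slices bound it from
    below for all sets ([integral_slices_le_volume]), and from above for closed sets, by passing
    to the complement in a box ([volume_le_of_slices]). The Hausdorff measure of a flat set is
    the volume of an isometric copy in the space of its own dimension
    ([hausdorff_isometry_volume]), by comparison of the two measures on cubes. *)

(** * Volume by slices *)
Section slice_integral.
Context {R : realType}.
Local Open Scope ereal_scope.
Notation mu := (@lebesgue_measure R).

(** A product of an interval [l k, r k] and a base of measure [w k] has measure the integral of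
    [w k] over the heights t in the interval; summed over k, this converts a lower bound on what
    lies above each height into a lower bound on the total. *)
Lemma slice_integral_le (l r w : nat -> R) (p : R -> \bar R) (s0 s1 : R) :
  (forall k, (l k <= r k)%R) -> (forall k, (0 <= w k)%R) ->
  measurable_fun `[s0, s1] p ->
  (forall t, (s0 <= t <= s1)%R -> 0 <= p t /\
     p t <= \sum_(k <oo) (if (l k <= t <= r k)%R then w k else 0%R)%:E) ->
  \int[mu]_(t in `[s0, s1]) p t <= \sum_(k <oo) (w k * (r k - l k))%:E.
Proof.
move=> lr w0 mp hp.
pose f k (t : R) : \bar R := (w k)%:E * (\1_(`[l k, r k]%classic : set R) t)%:E.
have fE k t : (if (l k <= t <= r k)%R then w k else 0%R)%:E = f k t.
  rewrite /f indicE mem_setE in_itv/=; case: ifP => _.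
    by rewrite mule1.
  by rewrite mule0.
have f0 k t : 0 <= f k t by rewrite -fE; case: ifP; rewrite ?lee_fin.
have mf k D : measurable D -> measurable_fun D (f k).
  move=> mD; apply: (measurable_funS measurableT) => //.
  apply: (@emeasurable_funM _ _ _ setT (cst (w k)%:E) (EFin \o \1_(`[l k, r k]%classic : set R))) => //.
  exact/measurable_EFinP/measurable_indic.
apply: (@le_trans _ _ (\int[mu]_(t in `[s0, s1]) \sum_(k <oo) f k t)).
  apply: ge0_le_integral => //.
  - by move=> t /=; rewrite in_itv/= => /hp[].
  - by apply: ge0_emeasurable_sum => // k *; exact: mf.
  - move=> t /=; rewrite in_itv/= => /hp[_ /le_trans]; apply.
    by rewrite le_eqVlt; apply/orP; left; apply/eqP/eq_eseriesr => k _; rewrite fE.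
rewrite integral_nneseries//; last by move=> k; exact: mf.
apply: lee_nneseries => k _; first by move=> _; apply: integral_ge0.
apply: (@le_trans _ _ (\int[mu]_t f k t)).
  by apply: ge0_subset_integral => //; exact: mf.
rewrite /f ge0_integralZl//; first last.
- by rewrite lee_fin.
- exact/measurable_EFinP/measurable_indic.
rewrite integral_indic//= setIT.
rewrite lebesgue_measure_itv/= lte_fin.
case: ltP => [_|]; first by rewrite -EFinB -EFinM.
by move=> rl; rewrite mule0 lee_fin mulr_ge0// subr_ge0.
Qed.

End slice_integral.

Section consr.
Context {R : realType} {n : nat}.
Implicit Types (t : R) (y : 'rV[R]_n).

Definition consr t y : 'rV[R]_n.+1 :=
  \row_i if unlift ord0 i is Some j then y ord0 j else t.

Definition tailr (x : 'rV[R]_n.+1) : 'rV[R]_n := \row_j x ord0 (lift ord0 j).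

Lemma consr0 t y : consr t y ord0 ord0 = t.
Proof. by rewrite mxE unlift_none. Qed.

Lemma consrS t y j : consr t y ord0 (lift ord0 j) = y ord0 j.
Proof. by rewrite mxE liftK. Qed.

Lemma tailrE (x : 'rV[R]_n.+1) j : tailr x ord0 j = x ord0 (lift ord0 j).
Proof. by rewrite mxE. Qed.

Lemma consrK t : cancel (consr t) tailr.
Proof. by move=> y; apply/rowP => j; rewrite tailrE consrS. Qed.

Lemma tailrK (x : 'rV[R]_n.+1) : consr (x ord0 ord0) (tailr x) = x.
Proof.
by apply/rowP => i; case: (unliftP ord0 i) => [j|] ->; rewrite ?consrS ?consr0 ?mxE.
Qed.

Lemma box_consr (a b : 'rV[R]_n.+1) t y : box a b (consr t y) <->
  a ord0 ord0 <= t <= b ord0 ord0 /\ box (tailr a) (tailr b) y.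
Proof.
split=> [h|[h0 hS] i].
  by split=> [|j]; [have := h ord0; rewrite consr0|have := h (lift ord0 j); rewrite consrS !tailrE].
case: (unliftP ord0 i) => [j|] ->; rewrite ?consrS ?consr0//.
by have := hS j; rewrite !tailrE.
Qed.

End consr.

Section box_cover.
Context {R : realType}.

Definition boxvol n (a b : 'rV[R]_n) : R := \prod_(i < n) (b ord0 i - a ord0 i).

Lemma boxvolS n (a b : 'rV[R]_n.+1) :
  boxvol a b = (b ord0 ord0 - a ord0 ord0) * boxvol (tailr a) (tailr b).
Proof.
rewrite /boxvol big_ord_recl; congr (_ * _).
by apply: eq_bigr => i _; rewrite !tailrE.
Qed.

Lemma boxvol_ge0 n (a b : 'rV[R]_n) :
  (forall i, a ord0 i <= b ord0 i) -> 0 <= boxvol a b.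
Proof. by move=> ab; apply: prodr_ge0 => i _; rewrite subr_ge0. Qed.

(** Induction on the dimension: the boxes of the cover that meet the height t have bases
    covering the base of the given box, and [slice_integral_le] integrates over t. The family
    [S] of retained boxes is there to discard those that miss a given height. *)
Lemma boxvol_cover n (S : nat -> bool) (c d : nat -> 'rV[R]_n) (a b : 'rV[R]_n) :
  (forall i, a ord0 i <= b ord0 i) ->
  (forall k i, c k ord0 i <= d k ord0 i) ->
  box a b `<=` \bigcup_(k in [set k | S k]) box (c k) (d k) ->
  ((boxvol a b)%:E <= \sum_(k <oo) (if S k then boxvol (c k) (d k) else 0)%:E)%E.
Proof.
elim: n S c d a b => [|n IH] S c d a b ab cd cov.
  have [k Sk _] := cov a (fun i : 'I_0 => match i with Ordinal _ h => ltac:(by []) end).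
  apply: (@le_trans _ _ (if S k then boxvol (c k) (d k) else 0)%:E).
    by rewrite Sk /boxvol !big_ord0.
  have h i : (0 <= (if S i then boxvol (c i) (d i) else 0)%:E)%E.
    by rewrite lee_fin; case: ifP => // _; exact: boxvol_ge0.
  rewrite (@nneseriesD1 _ _ k)//; first by rewrite leeDl// nneseries_ge0.
have bt0 : 0 <= boxvol (tailr a) (tailr b).
  by apply: boxvol_ge0 => i; rewrite !tailrE.
pose w k := if S k then boxvol (tailr (c k)) (tailr (d k)) else 0.
have w0 k : 0 <= w k.
  by rewrite /w; case: ifP => // _; apply: boxvol_ge0 => i; rewrite !tailrE.
have := @slice_integral_le R (fun k => c k ord0 ord0) (fun k => d k ord0 ord0)
  w (cst (boxvol (tailr a) (tailr b))%:E) (a ord0 ord0) (b ord0 ord0)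
  (fun k => cd k ord0) w0 (measurable_cst _).
rewrite integral_cst//= lebesgue_measure_itv/= lte_fin.
have -> : (\sum_(k <oo) (w k * (d k ord0 ord0 - c k ord0 ord0))%:E =
   \sum_(k <oo) (if S k then boxvol (c k) (d k) else 0)%:E)%E.
  apply: eq_eseriesr => k _; rewrite /w; case: ifP => _; last by rewrite mul0r.
  by rewrite boxvolS mulrC.
have -> : ((boxvol (tailr a) (tailr b))%:E *
    (if (a ord0 ord0 < b ord0 ord0)%R then ((b ord0 ord0)%:E - (a ord0 ord0)%:E) else 0) =
    (boxvol a b)%:E)%E.
  rewrite boxvolS; case: ltP => [_|]; first by rewrite -EFinB -EFinM mulrC.
  move=> ba; have -> : a ord0 ord0 = b ord0 ord0 by apply/eqP; rewrite eq_le ab ba.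
  by rewrite subrr mul0r mule0.
apply => t tab; split; first by rewrite lee_fin.
have := IH (fun k => S k && (c k ord0 ord0 <= t <= d k ord0 ord0))
  (fun k => tailr (c k)) (fun k => tailr (d k)) (tailr a) (tailr b).
move=> /(_ (fun i => ltac:(by rewrite !tailrE)) (fun k i => ltac:(by rewrite !tailrE))).
have -> : (\sum_(k <oo) (if (c k ord0 ord0 <= t <= d k ord0 ord0)%R then w k else 0)%:E =
  \sum_(k <oo) (if S k && (c k ord0 ord0 <= t <= d k ord0 ord0) then
    boxvol (tailr (c k)) (tailr (d k)) else 0)%:E)%E.
  apply: eq_eseriesr => k _; rewrite /w.
  by case: (S k); case: (_ <= _ <= _).
apply => y yab.
have [|k /= Sk /box_consr[h1 h2]] := cov (consr t y).
  by apply/box_consr.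
by exists k => //=; rewrite Sk.
Qed.

End box_cover.

Section volume_outer_measure.
Context {R : realType} {m : nat}.
Implicit Types (a b : 'rV[R]_m.+1) (A : set 'rV[R]_m.+1).

Lemma boxvolxx a : boxvol a a = 0.
Proof. by rewrite /boxvol big_ord_recl subrr mul0r. Qed.

Lemma volume_le A (c d : nat -> 'rV[R]_m.+1) :
  (forall k i, c k ord0 i <= d k ord0 i) ->
  A `<=` \bigcup_k box (c k) (d k) ->
  (volume A <= \sum_(k <oo) (boxvol (c k) (d k))%:E)%E.
Proof. by move=> cd Acd; apply: ereal_inf_lbound; exists (c, d). Qed.

Lemma le_volumeP A (x : \bar R) :
  (forall c d : nat -> 'rV[R]_m.+1, (forall k i, c k ord0 i <= d k ord0 i) ->
    A `<=` \bigcup_k box (c k) (d k) ->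
    (x <= \sum_(k <oo) (boxvol (c k) (d k))%:E)%E) -> (x <= volume A)%E.
Proof. by move=> h; apply: le_ereal_inf_tmp => _ [c [h1 h2] <-]; exact: h. Qed.

Lemma volume_ge0 A : (0 <= volume A)%E.
Proof.
apply: le_volumeP => c d cd _; apply: nneseries_ge0 => k _ _.
by rewrite lee_fin boxvol_ge0.
Qed.

Lemma volume_le_box a b : (forall i, a ord0 i <= b ord0 i) ->
  forall A, A `<=` box a b -> (volume A <= (boxvol a b)%:E)%E.
Proof.
move=> ab A Aab.
pose d k := if k is 0%N then b else a.
apply: (le_trans (@volume_le A (fun=> a) d _ _)).
- by move=> [|k] i /=.
- by move=> x /Aab abx; exists 0%N.
rewrite nneseries_recl//=; last first.
  by move=> k; rewrite lee_fin boxvol_ge0//; case: k.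
by rewrite eseries0 ?adde0// => -[//|k] _ _ /=; rewrite boxvolxx.
Qed.

Lemma volume_box a b : (forall i, a ord0 i <= b ord0 i) ->
  volume (box a b) = (boxvol a b)%:E.
Proof.
move=> ab; apply/eqP; rewrite eq_le; apply/andP; split; first exact: volume_le_box.
apply: le_volumeP => c d cd cov.
by apply: (@boxvol_cover _ _ xpredT) => // x /cov[k _ xk]; exists k.
Qed.

Let boxes := [set E : set 'rV[R]_m.+1 |
  E = set0 \/ exists a b, (forall i, a ord0 i <= b ord0 i) /\ E = box a b].

Lemma volume0 : volume (@set0 'rV[R]_m.+1) = 0%E.
Proof.
apply/eqP; rewrite eq_le volume_ge0 andbT.
by have := @volume_le_box 0 0 (fun=> lexx _) set0; rewrite boxvolxx; exact.
Qed.

Let volume_cover_inf A : volume A = cover_inf boxes volume A.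
Proof.
apply/eqP; rewrite eq_le; apply/andP; split.
  apply: le_ereal_inf_tmp => _ [F [CF AF] <-].
  have H k : exists cd : 'rV[R]_m.+1 * 'rV[R]_m.+1,
      (forall i, cd.1 ord0 i <= cd.2 ord0 i) /\
      F k `<=` box cd.1 cd.2 /\ volume (F k) = (boxvol cd.1 cd.2)%:E.
    case: (CF k) => [->|[a [b [ab ->]]]].
      exists (0, 0); split=> [i /=|]; first exact: lexx.
      by split=> [? []|]; rewrite boxvolxx volume0.
    by exists (a, b); split=> //; split=> //; rewrite volume_box.
  have [cd cdP] := boolp.choice H.
  apply: (le_trans (@volume_le A (fst \o cd) (snd \o cd) _ _)).
  - by move=> k i; case: (cdP k).
  - by move=> x /AF[k _ Fk]; exists k => //; case: (cdP k) => _ [+ _]; exact.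
  by rewrite le_eqVlt; apply/orP; left; apply/eqP/eq_eseriesr => k _; case: (cdP k) => _ [_ ->].
apply: le_volumeP => c d cd cov; apply: ereal_inf_lbound.
exists (fun k => box (c k) (d k)).
  by split=> // k; right; exists (c k), (d k).
by apply: eq_eseriesr => k _; rewrite volume_box.
Qed.

Let boxes0 : boxes set0. Proof. by left. Qed.

Let le_volume : {homo @volume R m.+1 : A B / A `<=` B >-> (A <= B)%E}.
Proof.
by move=> A B AB; rewrite !volume_cover_inf; apply: le_cover_inf AB; exact: volume_ge0.
Qed.

Let volume_sigma_subadditive : sigma_subadditive (@volume R m.+1).
Proof.
move=> F; rewrite volume_cover_inf; under eq_eseriesr do rewrite volume_cover_inf.
by apply: cover_inf_sigma_subadditive; exact: volume_ge0.
Qed.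

HB.instance Definition _ := isOuterMeasure.Build R 'rV[R]_m.+1
  (@volume R m.+1) volume0 volume_ge0 le_volume volume_sigma_subadditive.

End volume_outer_measure.

(** The half of Tonelli's theorem that holds for arbitrary sets: a cover of [A] restricts to
    covers of all its slices. The volume of a slice need not depend measurably on its height,
    hence the measurable minorant [p]. *)
Lemma integral_slices_le_volume {R : realType} {m : nat} (A : set 'rV[R]_m.+2)
    (p : R -> \bar R) (s0 s1 : R) :
  measurable_fun `[s0, s1] p ->
  (forall t, s0 <= t <= s1 -> (0 <= p t)%E /\
     (p t <= volume [set y | A (consr t y)])%E) ->
  (\int[lebesgue_measure]_(t in `[s0, s1]) p t <= volume A)%E.
Proof.
move=> mp hp; apply: le_volumeP => c d cd cov.
have cd' k i : tailr (c k) ord0 i <= tailr (d k) ord0 i by rewrite !tailrE.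
pose w k := boxvol (tailr (c k)) (tailr (d k)).
have -> : (\sum_(k <oo) (boxvol (c k) (d k))%:E =
    \sum_(k <oo) (w k * (d k ord0 ord0 - c k ord0 ord0))%:E)%E.
  by apply: eq_eseriesr => k _; rewrite boxvolS mulrC.
apply: slice_integral_le => // [k|t /hp[p0 pt]]; first exact: boxvol_ge0.
split=> //; apply: (le_trans pt).
pose d' k := if c k ord0 ord0 <= t <= d k ord0 ord0 then tailr (d k) else tailr (c k).
apply: (le_trans (@volume_le _ _ _ (fun k => tailr (c k)) d' _ _)).
- by move=> k i; rewrite /d'; case: ifP.
- move=> y /= /cov[k _ /box_consr[h1 h2]]; exists k => //.
  by rewrite /d' h1.
rewrite le_eqVlt; apply/orP; left; apply/eqP/eq_eseriesr => k _.
by rewrite /d'; case: ifP => // _; rewrite boxvolxx.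
Qed.

(** * Measurable sets and affine images *)
Section norm_rV.
Context {R : realType} {n : nat}.
Implicit Types x y : 'rV[R]_n.

Lemma ler_coord_norm x i : `|x ord0 i| <= `|x|.
Proof. by rewrite [leRHS]/Num.norm/= mx_normrE; apply: (le_bigmax _ _ (ord0, i)). Qed.

Lemma norm_rV_leP x r : 0 <= r -> (forall i, `|x ord0 i| <= r) -> `|x| <= r.
Proof.
move=> r0 h; rewrite [leLHS]/Num.norm/= mx_normrE; apply/bigmax_leP; split=> // -[j i] _ /=.
by rewrite ord1.
Qed.

Lemma norm_rV_ltP x r : 0 < r -> (forall i, `|x ord0 i| < r) -> `|x| < r.
Proof.
move=> r0 h; rewrite [ltLHS]/Num.norm/= mx_normrE; apply/bigmax_ltP; split=> // -[j i] _ /=.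
by rewrite ord1.
Qed.

Lemma open_rVP (U : set 'rV[R]_n) :
  open U <-> forall x, U x -> exists2 r, 0 < r & forall y, `|x - y| < r -> U y.
Proof.
rewrite openE; split=> h x Ux.
  have /nbhs_ballP[r r0 hr] := h x Ux.
  by exists r => // y xy; apply: hr; rewrite mx_norm_ball.
have [r r0 hr] := h x Ux; apply/nbhs_ballP; exists r => // y.
by rewrite mx_norm_ball => /hr.
Qed.

Lemma bounded_rVP (A : set 'rV[R]_n) : bounded_set A <->
  exists2 M, 0 < M & forall x, A x -> `|x| <= M.
Proof.
split=> [[M [_ h]]|[M M0 h]].
  exists (`|M| + 1); first by rewrite ltr_wpDl.
  by apply: h; rewrite (le_lt_trans (ler_norm _))// ltrDl.
by exists M; split; rewrite ?num_real// => y My x /h /le_trans; apply; apply: ltW.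
Qed.

Lemma sub_bounded (A B : set 'rV[R]_n) : A `<=` B -> bounded_set B -> bounded_set A.
Proof.
move=> AB /bounded_rVP[M M0 h]; apply/bounded_rVP; exists M => // x /AB; exact: h.
Qed.

End norm_rV.

Section half_spaces.
Context {R : realType} {m : nat}.
Implicit Types (X A : set 'rV[R]_m.+1) (i : 'I_m.+1).

Definition set_coord (x : 'rV[R]_m.+1) i (v : R) : 'rV[R]_m.+1 :=
  \row_j if j == i then v else x ord0 j.

Lemma set_coordE x i v j : set_coord x i v ord0 j = if j == i then v else x ord0 j.
Proof. by rewrite mxE. Qed.

Lemma boxvolD1 (a b : 'rV[R]_m.+1) i :
  boxvol a b = (b ord0 i - a ord0 i) * \prod_(j | j != i) (b ord0 j - a ord0 j).
Proof. by rewrite /boxvol (bigD1 i). Qed.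

Lemma boxvol_split (a b : 'rV[R]_m.+1) i (u v : R) :
  u - a ord0 i + (b ord0 i - v) = b ord0 i - a ord0 i ->
  boxvol a (set_coord b i u) + boxvol (set_coord a i v) b = boxvol a b.
Proof.
move=> uv; rewrite !(boxvolD1 _ _ i) !set_coordE eqxx.
have -> : \prod_(j | j != i) (set_coord b i u ord0 j - a ord0 j) =
          \prod_(j | j != i) (b ord0 j - a ord0 j).
  by apply: eq_bigr => j /negPf ji; rewrite set_coordE ji.
have -> : \prod_(j | j != i) (b ord0 j - set_coord a i v ord0 j) =
          \prod_(j | j != i) (b ord0 j - a ord0 j).
  by apply: eq_bigr => j /negPf ji; rewrite set_coordE ji.
by rewrite -mulrDl uv.
Qed.

(** Cutting each box of a cover along the hyperplane gives covers of both parts with the same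
    total volume, so that half-spaces are Caratheodory measurable. *)
Lemma volume_split_ge X i (s : R) :
  (volume (X `&` [set x | (x ord0 i <= s)%R]) + volume (X `&` [set x | (s <= x ord0 i)%R])
   <= volume X)%E.
Proof.
apply: le_volumeP => c d cd cov.
(* The outer maximum and minimum keep the two pieces well-formed when the
   hyperplane misses the box. *)
pose u k := Num.max (c k ord0 i) (Num.min (d k ord0 i) s).
pose v k := Num.min (d k ord0 i) (Num.max (c k ord0 i) s).
have uv k : u k - c k ord0 i + (d k ord0 i - v k) = d k ord0 i - c k ord0 i.
  rewrite /u /v; have cdk := cd k i.
  have [ds|/ltW sd] := leP (d k ord0 i) s.
    by rewrite (max_r (le_trans cdk ds)) min_l// max_r// subrr addr0.
  have [cs|/ltW sc] := leP (c k ord0 i) s.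
    by rewrite min_r//; ring.
  by rewrite subrr add0r min_r.
have h1 k j : c k ord0 j <= set_coord (d k) i (u k) ord0 j.
  by rewrite set_coordE; case: eqP => [->|//]; rewrite /u le_max lexx.
have h2 k j : set_coord (c k) i (v k) ord0 j <= d k ord0 j.
  by rewrite set_coordE; case: eqP => [->|//]; rewrite /v ge_min lexx.
have -> : (\sum_(k <oo) (boxvol (c k) (d k))%:E =
    \sum_(k <oo) (boxvol (c k) (set_coord (d k) i (u k)))%:E +
    \sum_(k <oo) (boxvol (set_coord (c k) i (v k)) (d k))%:E)%E.
  rewrite -nneseriesD//; try by move=> k _ _; rewrite lee_fin boxvol_ge0.
  by apply: eq_eseriesr => k _; rewrite -EFinD boxvol_split.
apply: leeD; apply: volume_le => //.
- move=> x [/cov[k _ xk] /= xs]; exists k => // j; rewrite set_coordE.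
  have /andP[-> xd] := xk j; case: eqP => [ji|//]; rewrite ji in xd *.
  by rewrite /u le_max le_min xd xs orbT.
- move=> x [/cov[k _ xk] /= xs]; exists k => // j; rewrite set_coordE.
  have /andP[xd ->] := xk j; rewrite andbT; case: eqP => [ji|//]; rewrite ji in xd *.
  by rewrite /v ge_min ge_max xd xs orbT.
Qed.

Lemma caratheodory_le i s : (@volume R m.+1).-caratheodory [set x | x ord0 i <= s].
Proof.
apply: le_caratheodory_measurable => X; apply: le_trans (volume_split_ge X i s).
apply: leeD2l; apply: le_outer_measure => x [Xx /= /negP]; rewrite -ltNge => /ltW.
by split.
Qed.

Lemma caratheodory_ge i s : (@volume R m.+1).-caratheodory [set x | s <= x ord0 i].
Proof.
apply: le_caratheodory_measurable => X; apply: le_trans (volume_split_ge X i s).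
rewrite addeC; apply: leeD2r; apply: le_outer_measure => x [Xx /= /negP]; rewrite -ltNge => /ltW.
by split.
Qed.

Lemma caratheodory_box (a b : 'rV[R]_m.+1) : (@volume R m.+1).-caratheodory (box a b).
Proof.
pose H := (@volume R m.+1).-caratheodory.
have HI (r : seq 'I_m.+1) : H (\big[setI/setT]_(i <- r)
   ([set x : 'rV[R]_m.+1 | a ord0 i <= x ord0 i] `&` [set x | x ord0 i <= b ord0 i])).
  elim: r => [|i r IH].
    rewrite big_nil -setC0; apply: caratheodory_measurable_setC.
    exact: caratheodory_measurable_set0.
  rewrite big_cons; apply: caratheodory_measurable_setI => //.
  by apply: caratheodory_measurable_setI; [exact: caratheodory_ge|exact: caratheodory_le].
have := HI (index_enum 'I_m.+1).
congr (H _); apply/seteqP; split=> x.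
  rewrite -bigcap_seq => h i.
  by have [|/= -> ->] := h i; rewrite //= mem_index_enum.
by move=> h; rewrite -bigcap_seq => i _ /=; apply/andP/h.
Qed.

(** An open set is a countable union of boxes with rational corners. *)
Lemma caratheodory_open (U : set 'rV[R]_m.+1) : open U -> (@volume R m.+1).-caratheodory U.
Proof.
move=> oU.
pose rb (pq : 'rV[rat]_m.+1 * 'rV[rat]_m.+1) : set 'rV[R]_m.+1 :=
  box (map_mx ratr pq.1) (map_mx ratr pq.2).
pose F (k : nat) : set 'rV[R]_m.+1 :=
  if unpickle k is Some pq then (if `[< rb pq `<=` U >] then rb pq else set0) else set0.
have -> : U = \bigcup_k F k.
  apply/seteqP; split=> [x Ux|x [k _]]; last first.
    by rewrite /F; case: unpickle => // pq; case: asboolP => // h /h.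
  have [r r0 hr] := (open_rVP U).1 oU x Ux.
  have H i : exists q : rat * rat, (x ord0 i - r < ratr q.1 < x ord0 i)%R /\
      (x ord0 i < ratr q.2 < x ord0 i + r)%R.
    have [|p pP] := @rat_in_itvoo R (x ord0 i - r) (x ord0 i); first by rewrite gtrBl.
    have [|q qP] := @rat_in_itvoo R (x ord0 i) (x ord0 i + r); first by rewrite ltrDl.
    by exists (p, q); move: pP qP; rewrite !in_itv.
  have [q qP] := boolp.choice H.
  pose pq : 'rV[rat]_m.+1 * 'rV[rat]_m.+1 := (\row_i (q i).1, \row_i (q i).2).
  exists (pickle pq) => //; rewrite /F pickleK asboolT.
    by move=> i; rewrite !mxE; have [/andP[_ /ltW->] /andP[/ltW->]] := qP i.
  move=> y hy; apply: hr; apply: norm_rV_ltP => // i; have := hy i; rewrite !mxE.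
  have [/andP[h1 h2] /andP[h3 h4]] := qP i => /andP[h5 h6].
  by rewrite ltr_norml; apply/andP; split; lra.
apply: caratheodory_measurable_bigcup => k; rewrite /F.
case: unpickle => [pq|]; last exact: caratheodory_measurable_set0.
case: ifP => _; first exact: caratheodory_box.
exact: caratheodory_measurable_set0.
Qed.

Lemma caratheodory_closed (C : set 'rV[R]_m.+1) : closed C -> (@volume R m.+1).-caratheodory C.
Proof.
move=> cC; rewrite -(setCK C); apply/caratheodory_measurable_setC/caratheodory_open.
exact: closed_openC.
Qed.

End half_spaces.

Section transforms.
Context {R : realType} {m : nat}.
Implicit Types (A : set 'rV[R]_m.+1) (v : 'rV[R]_m.+1).

Let volume_affine_le (s : R) v A : 0 < s ->
  (volume [set (s *: x + v)%R | x in A] <= (s ^+ m.+1)%:E * volume A)%E.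
Proof.
move=> s0; rewrite -lee_pdivrMl ?exprn_gt0//; apply: le_volumeP => c d cd cov.
rewrite lee_pdivrMl ?exprn_gt0// -nneseriesZl; last first.
  by move=> k _; rewrite lee_fin boxvol_ge0.
have -> : (\sum_(k <oo) ((s ^+ m.+1)%:E * (boxvol (c k) (d k))%:E) =
    \sum_(k <oo) (boxvol (s *: c k + v) (s *: d k + v))%:E)%E.
  apply: eq_eseriesr => k _; rewrite -EFinM; congr (_%:E).
  rewrite /boxvol -[X in s ^+ X]card_ord -prodr_const -big_split /=.
  by apply: eq_bigr => i _; rewrite !mxE; ring.
apply: volume_le => [k i|x [y /cov[k _ yk] <-]].
  by rewrite !mxE lerD2r ler_pM2l.
by exists k => // i; rewrite !mxE !lerD2r !ler_pM2l//; exact: yk.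
Qed.

Lemma volume_affine (s : R) v A : 0 < s ->
  (volume [set (s *: x + v)%R | x in A] = (s ^+ m.+1)%:E * volume A)%E.
Proof.
move=> s0; apply/eqP; rewrite eq_le volume_affine_le//= -lee_pdivlMl ?exprn_gt0//.
rewrite -exprVn.
have := @volume_affine_le s^-1 (- (s^-1 *: v)) [set s *: x + v | x in A].
rewrite invr_gt0 s0 => /(_ isT); apply: le_trans; apply: le_outer_measure => x Ax.
exists (s *: x + v); first by exists x.
by rewrite scalerDr scalerA mulVf ?gt_eqF// scale1r addrK.
Qed.

Lemma volume_translate v A : volume [set x + v | x in A] = volume A.
Proof.
have := @volume_affine 1 v A ltr01; rewrite expr1n mul1e => <-; congr volume.
by apply: eq_imagel => x _; rewrite scale1r.
Qed.

Lemma volume_fin A : bounded_set A -> (volume A < +oo)%E.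
Proof.
move=> /bounded_rVP[M M0 AM].
apply: (@le_lt_trans _ _ (boxvol (const_mx (- M)) (const_mx M : 'rV_m.+1))%:E); last exact: ltry.
apply: volume_le_box => [i|x /AM xM i]; first by rewrite !mxE; lra.
by rewrite !mxE -ler_norml; apply: le_trans xM; apply: ler_coord_norm.
Qed.

Lemma volume_fin_num A : bounded_set A -> volume A \is a fin_num.
Proof. by move=> /volume_fin h; rewrite ge0_fin_numE// volume_ge0. Qed.

Definition vol A : R := fine (volume A).

Lemma volE A : bounded_set A -> volume A = (vol A)%:E.
Proof. by move=> bA; rewrite /vol fineK// volume_fin_num. Qed.

Lemma vol0 : vol set0 = 0.
Proof. by rewrite /vol outer_measure0. Qed.

Lemma vol_gt0_neq0 A : 0 < vol A -> A !=set0.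
Proof. by move=> A0; apply/set0P/eqP => Ae; move: A0; rewrite Ae vol0 ltxx. Qed.

Lemma vol_ge0 A : 0 <= vol A.
Proof. by rewrite fine_ge0// volume_ge0. Qed.

Lemma le_vol A B : bounded_set B -> A `<=` B -> vol A <= vol B.
Proof.
move=> bB AB; have bA : bounded_set A by exact: sub_bounded AB bB.
by rewrite -lee_fin -!volE//; apply: le_outer_measure.
Qed.

Lemma vol_caratheodory A C : bounded_set A -> (@volume R m.+1).-caratheodory C ->
  vol A = vol (A `&` C) + vol (A `\` C).
Proof.
move=> bA mC; apply: EFin_inj; rewrite EFinD -!volE//; do ?exact: mC.
- by apply: (sub_bounded _ bA) => x [].
- by apply: (sub_bounded _ bA) => x [].
Qed.

Lemma vol_affine s v A : 0 < s -> vol [set s *: x + v | x in A] = s ^+ m.+1 * vol A.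
Proof.
move=> s0; rewrite /vol volume_affine//; case: (volume A) => [r||]/=; first by [].
  by rewrite mulry gtr0_sg ?exprn_gt0// mul1e mulr0.
by rewrite mulrNy gtr0_sg ?exprn_gt0// mul1e mulr0.
Qed.

Lemma vol_translate v A : vol [set x + v | x in A] = vol A.
Proof. by rewrite /vol volume_translate. Qed.

End transforms.

(** * Euclidean norm and Hausdorff measure of isometric copies *)
Section euclidean_norm.
Context {R : realType} {n : nat}.
Implicit Types (x y z v : 'rV[R]_n) (c : R).

Lemma dotC x y : dot x y = dot y x.
Proof. by apply: eq_bigr => i _; rewrite mulrC. Qed.

Lemma dotDl x y z : dot (x + y) z = dot x z + dot y z.
Proof. by rewrite /dot -big_split; apply: eq_bigr => i _; rewrite !mxE mulrDl. Qed.

Lemma dotZl c x y : dot (c *: x) y = c * dot x y.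
Proof. by rewrite /dot mulr_sumr; apply: eq_bigr => i _; rewrite !mxE mulrA. Qed.

Lemma dotNl x y : dot (- x) y = - dot x y.
Proof. by rewrite -scaleN1r dotZl mulN1r. Qed.

Lemma dotDr x y z : dot z (x + y) = dot z x + dot z y.
Proof. by rewrite !(dotC z) dotDl. Qed.

Lemma dotZr c x y : dot x (c *: y) = c * dot x y.
Proof. by rewrite !(dotC x) dotZl. Qed.

Lemma dotNr x y : dot x (- y) = - dot x y.
Proof. by rewrite !(dotC x) dotNl. Qed.

Lemma dot0l x : dot 0 x = 0.
Proof. by rewrite -(scale0r 0) dotZl mul0r. Qed.

Lemma dot_ge0 x : 0 <= dot x x.
Proof. by apply: sumr_ge0 => i _; rewrite -expr2 sqr_ge0. Qed.

Lemma dot_coord_le x i : x ord0 i ^+ 2 <= dot x x.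
Proof.
by rewrite /dot (bigD1 i)//= -expr2 lerDl sumr_ge0// => j _; rewrite -expr2 sqr_ge0.
Qed.

Lemma dot_eq0 x : dot x x = 0 -> x = 0.
Proof.
move=> x0; apply/rowP => i; rewrite mxE; apply/eqP; rewrite -sqrf_eq0.
by rewrite eq_le sqr_ge0 andbT -x0 dot_coord_le.
Qed.

Lemma dot_cauchy x y : dot x y ^+ 2 <= dot x x * dot y y.
Proof.
have [y0|y0] := eqVneq (dot y y) 0.
  by rewrite (dot_eq0 y0) dotC dot0l expr0n dot0l mulr0.
have yp : 0 < dot y y by rewrite lt_neqAle eq_sym y0 dot_ge0.
have := dot_ge0 (dot y y *: x - dot x y *: y).
rewrite !(dotDl, dotDr, dotNl, dotNr, dotZl, dotZr) (dotC y x) => h.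
have : 0 <= dot y y * (dot x x * dot y y - dot x y ^+ 2).
  by apply: (le_trans h); rewrite le_eqVlt; apply/orP; left; apply/eqP; ring.
by rewrite pmulr_rge0// subr_ge0.
Qed.

Lemma enorm_ge0 x : 0 <= enorm x. Proof. exact: sqrtr_ge0. Qed.

Lemma enorm_sqr x : enorm x ^+ 2 = dot x x.
Proof. by rewrite sqr_sqrtr// dot_ge0. Qed.

Lemma enormN x : enorm (- x) = enorm x.
Proof. by rewrite /enorm dotNl dotNr opprK. Qed.

Lemma enormZ c x : enorm (c *: x) = `|c| * enorm x.
Proof. by rewrite /enorm dotZl dotZr mulrA -expr2 sqrtrM ?sqr_ge0// sqrtr_sqr. Qed.

Lemma dot_le_enorm x y : `|dot x y| <= enorm x * enorm y.
Proof.
rewrite -(ler_pXn2r (n:=2)) ?nnegrE ?mulr_ge0 ?enorm_ge0//.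
by rewrite exprMn !enorm_sqr -normrX ger0_norm ?sqr_ge0// dot_cauchy.
Qed.

Lemma enormD x y : enorm (x + y) <= enorm x + enorm y.
Proof.
rewrite -(ler_pXn2r (n:=2)) ?nnegrE ?addr_ge0 ?enorm_ge0//.
rewrite sqrrD !enorm_sqr dotDl !dotDr (dotC y x).
have := le_trans (ler_norm _) (dot_le_enorm x y); lra.
Qed.

Lemma coord_le_enorm x i : `|x ord0 i| <= enorm x.
Proof.
rewrite -(ler_pXn2r (n:=2)) ?nnegrE ?enorm_ge0//.
by rewrite enorm_sqr -normrX ger0_norm ?sqr_ge0// dot_coord_le.
Qed.

Lemma norm_le_enorm x : `|x| <= enorm x.
Proof. by apply: norm_rV_leP => [|i]; [exact: enorm_ge0|exact: coord_le_enorm]. Qed.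

Lemma enorm_le_norm x : enorm x <= n%:R * `|x|.
Proof.
rewrite -(ler_pXn2r (n:=2)) ?nnegrE ?enorm_ge0 ?mulr_ge0//.
rewrite enorm_sqr; apply: (@le_trans _ _ (\sum_(i < n) `|x| ^+ 2)).
  apply: ler_sum => i _; rewrite -expr2 -[leLHS]ger0_norm ?sqr_ge0// normrX.
  by rewrite ler_pXn2r ?nnegrE// ler_coord_norm.
rewrite sumr_const card_ord -[leLHS]mulr_natl exprMn ler_wpM2r ?sqr_ge0//.
case: (n) => [|k]; first by rewrite expr0n.
by rewrite expr2 ler_peMr// ler1n.
Qed.

Lemma diam_ub (E : set 'rV[R]_n) x y : E x -> E y -> ((enorm (x - y))%:E <= diam E)%E.
Proof. by move=> Ex Ey; apply: ereal_sup_ubound; right; exists (x, y). Qed.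

Lemma diam_leP (E : set 'rV[R]_n) (r : \bar R) : (0 <= r)%E ->
  (forall x y, E x -> E y -> ((enorm (x - y))%:E <= r)%E) -> (diam E <= r)%E.
Proof. by move=> r0 h; apply: ge_ereal_sup => _ [->//|[[x y] [/= Ex Ey] <-]]; exact: h. Qed.

End euclidean_norm.

Section hausdorff_lipschitz.
Context {R : realType}.

Lemma hausdorff_delta_le_raw n d (delta : R) (A : set 'rV[R]_n) : 0 < delta ->
  (hausdorff_delta d delta A <= hausdorff_raw d A)%E.
Proof. by move=> d0; apply: ereal_sup_ubound; exists delta. Qed.

Lemma hausdorff_delta_leP n d (delta : R) (A : set 'rV[R]_n) (F : nat -> set 'rV[R]_n) :
  (forall k, diam (F k) <= delta%:E)%E -> A `<=` \bigcup_k F k ->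
  (hausdorff_delta d delta A <= \sum_(k <oo) diam_pow d (F k))%E.
Proof. by move=> Fd AF; apply: ereal_inf_lbound; exists F. Qed.

Lemma le_hausdorff_deltaP n d (delta : R) (A : set 'rV[R]_n) (x : \bar R) :
  (forall F : nat -> set 'rV[R]_n,
    (forall k, diam (F k) <= delta%:E)%E -> A `<=` \bigcup_k F k ->
    (x <= \sum_(k <oo) diam_pow d (F k))%E) -> (x <= hausdorff_delta d delta A)%E.
Proof. by move=> h; apply: le_ereal_inf_tmp => _ [F [h1 h2] <-]; exact: h. Qed.

Lemma hausdorff_raw_lipschitz n p d (f : 'rV[R]_n -> 'rV[R]_p) (s : R) A : 0 < s ->
  (forall x y, A x -> A y -> enorm (f x - f y) <= s * enorm (x - y)) ->
  (hausdorff_raw d (f @` A) <= (s ^+ d)%:E * hausdorff_raw d A)%E.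
Proof.
move=> s0 fs; apply: ge_ereal_sup => _ [r /= r0 <-].
apply: (@le_trans _ _ ((s ^+ d)%:E * hausdorff_delta d (r / s) A)%E); last first.
  apply: lee_wpmul2l; first by rewrite lee_fin exprn_ge0// ltW.
  by apply: hausdorff_delta_le_raw; rewrite divr_gt0.
rewrite -lee_pdivrMl ?exprn_gt0//; apply: le_hausdorff_deltaP => F Fd AF.
rewrite lee_pdivrMl ?exprn_gt0// -nneseriesZl; last first.
  by move=> k _; exact: diam_pow_ge0.
pose G k := f @` (F k `&` A).
have GF k : (diam (G k) <= s%:E * diam (F k))%E.
  apply: diam_leP => [|_ _ [x [Fx Ax] <-] [y [Fy Ay] <-]].
    by apply: mule_ge0; [rewrite lee_fin ltW|exact: diam_ge0].
  apply: (@le_trans _ _ (s * enorm (x - y))%:E); first by rewrite lee_fin fs.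
  by rewrite EFinM; apply: lee_wpmul2l; [rewrite lee_fin ltW|exact: diam_ub].
apply: (le_trans (@hausdorff_delta_leP _ _ _ _ G _ _)).
- move=> k; apply: (le_trans (GF k)).
  rewrite -lee_pdivlMl// -EFinM mulrC; exact: Fd.
- by move=> _ [x Ax <-]; have [k _ Fx] := AF x Ax; exists k => //; exists x.
apply: lee_nneseries => k _; first by move=> _; exact: diam_pow_ge0.
rewrite /diam_pow; case: ifPn => G0.
  apply: mule_ge0; first by rewrite lee_fin exprn_ge0// ltW.
  by case: ifP => // _; apply: expe_ge0; exact: diam_ge0.
case: ifPn => F0.
  by move: G0; rewrite /G (eqP F0) set0I image_set0 eqxx.
have Fk : diam (F k) \is a fin_num.
  by rewrite ge0_fin_numE ?diam_ge0// (le_lt_trans (Fd k))// ltry.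
have Gk : diam (G k) \is a fin_num.
  rewrite ge0_fin_numE ?diam_ge0// (le_lt_trans (GF k))//.
  by rewrite -(fineK Fk) -EFinM ltry.
move: (GF k) (diam_ge0 (G k)); rewrite -(fineK Fk) -(fineK Gk) -EFinM !lee_fin => h1 h2.
by rewrite -!EFin_expe -EFinM lee_fin -exprMn lerXn2r ?nnegrE// (le_trans h2 h1).
Qed.

Lemma hausdorff_raw_isometry n p d (j : 'rV[R]_n -> 'rV[R]_p) (g : 'rV[R]_p -> 'rV[R]_n) A :
  cancel j g -> (forall x y, enorm (j x - j y) = enorm (x - y)) ->
  hausdorff_raw d (j @` A) = hausdorff_raw d A.
Proof.
move=> jg je; apply/eqP; rewrite eq_le; apply/andP; split.
  rewrite -[leRHS]mul1e -(expr1n _ d); apply: hausdorff_raw_lipschitz => // x y _ _.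
  by rewrite mul1r je.
have {1}-> : A = g @` (j @` A).
  by rewrite image_comp -[LHS]image_id; apply: eq_imagel => x _ /=; rewrite jg.
rewrite -[leRHS]mul1e -(expr1n _ d); apply: hausdorff_raw_lipschitz => //.
by move=> _ _ [x Ax <-] [y Ay <-]; rewrite mul1r !jg je.
Qed.

Lemma hausdorff_raw_affine n d (s : R) (v : 'rV[R]_n) A : 0 < s ->
  (hausdorff_raw d [set (s *: x + v)%R | x in A] = (s ^+ d)%:E * hausdorff_raw d A)%E.
Proof.
move=> s0.
have H (t : R) (w : 'rV[R]_n) B : 0 < t ->
    (hausdorff_raw d [set (t *: x + w)%R | x in B] <= (t ^+ d)%:E * hausdorff_raw d B)%E.
  move=> t0; apply: hausdorff_raw_lipschitz => // x y _ _.
  rewrite opprD addrACA subrr addr0 -scalerBr enormZ.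
  by rewrite (gtr0_norm t0).
apply/eqP; rewrite eq_le H//= -lee_pdivlMl ?exprn_gt0//.
rewrite -exprVn.
have := @H s^-1 (- (s^-1 *: v)) [set s *: x + v | x in A].
rewrite invr_gt0 s0 => /(_ isT); apply: le_trans; apply: le_hausdorff_raw => x Ax.
exists (s *: x + v); first by exists x.
by rewrite scalerDr scalerA mulVf ?gt_eqF// scale1r addrK.
Qed.

Lemma hausdorff_raw_translate n d (v : 'rV[R]_n) A :
  hausdorff_raw d [set x + v | x in A] = hausdorff_raw d A.
Proof.
have := @hausdorff_raw_affine n d 1 v A ltr01; rewrite expr1n mul1e => <-.
by congr hausdorff_raw; apply: eq_imagel => x _; rewrite scale1r.
Qed.

HB.instance Definition _ n d := isOuterMeasure.Build R 'rV[R]_n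
  (@hausdorff_raw R n d) (@hausdorff_raw0 R n d) (@hausdorff_raw_ge0 R n d)
  (@le_hausdorff_raw R n d) (@hausdorff_raw_sigma_subadditive R n d).

(** Positivity of the mesh is part of its type, so that every member of the family is an outer
    measure. *)
Definition hdelta n d (delta : {posnum R}) (A : set 'rV[R]_n) :=
  hausdorff_delta d delta%:num A.

Lemma hdelta0 n d delta : @hdelta n d delta set0 = 0%E.
Proof. by apply: cover_inf0 => /=; rewrite ?diam0 ?lee_fin//; [exact: diam_pow0|exact: diam_pow_ge0]. Qed.

Lemma hdelta_ge0 n d delta A : (0 <= @hdelta n d delta A)%E.
Proof. by apply: cover_inf_ge0 => /=; rewrite ?diam0 ?lee_fin//; exact: diam_pow_ge0. Qed.

Lemma le_hdelta n d delta : {homo @hdelta n d delta : A B / A `<=` B >-> (A <= B)%E}.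
Proof. by move=> A B AB; apply: le_cover_inf AB => /=; rewrite ?diam0 ?lee_fin//; exact: diam_pow_ge0. Qed.

Lemma hdelta_sigma_subadditive n d delta : sigma_subadditive (@hdelta n d delta).
Proof. by apply: cover_inf_sigma_subadditive => /=; rewrite ?diam0 ?lee_fin//; exact: diam_pow_ge0. Qed.

HB.instance Definition _ n d delta := isOuterMeasure.Build R 'rV[R]_n
  (@hdelta n d delta) (@hdelta0 n d delta) (@hdelta_ge0 n d delta)
  (@le_hdelta n d delta) (@hdelta_sigma_subadditive n d delta).

Lemma hdelta_translate n d delta (v : 'rV[R]_n) A :
  hdelta d delta [set x + v | x in A] = hdelta d delta A.
Proof.
have H (w : 'rV[R]_n) B : (hdelta d delta [set (x + w)%R | x in B] <= hdelta d delta B)%E.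
  apply: le_hausdorff_deltaP => F Fd BF.
  pose G k := [set x + w | x in F k].
  have GF k : diam (G k) = diam (F k).
    apply/eqP; rewrite eq_le; apply/andP; split; apply: diam_leP; rewrite ?diam_ge0//.
      by move=> _ _ [x Fx <-] [y Fy <-]; rewrite opprD addrACA subrr addr0 diam_ub.
    move=> x y Fx Fy; have -> : x - y = (x + w) - (y + w) by rewrite opprD addrACA subrr addr0.
    by apply: diam_ub; [exists x|exists y].
  apply: (le_trans (@hausdorff_delta_leP _ _ _ _ G _ _)).
  - by move=> k; rewrite GF.
  - by move=> _ [x Bx <-]; have [k _ Fx] := BF x Bx; exists k => //; exists x.
  apply: lee_nneseries => k _; first by move=> _; exact: diam_pow_ge0.
  rewrite /diam_pow GF; case: ifPn => G0.
    by case: ifPn => // _; apply: expe_ge0; exact: diam_ge0.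
  by case: ifPn => F0//; move: G0; rewrite /G (eqP F0) image_set0 eqxx.
apply/eqP; rewrite eq_le H//=.
have := H (- v) [set x + v | x in A]; apply: le_trans; apply: le_hdelta => x Ax.
by exists (x + v); [exists x|rewrite addrK].
Qed.

End hausdorff_lipschitz.

Section grid.
Context {R : realType} {m : nat} (nu : {outer_measure set 'rV[R]_m.+1 -> \bar R}).
Hypothesis nu_translate : forall v A, nu [set x + v | x in A] = nu A.

(** The directions are filled one after the other: [e s] reaches the far corner in the
    directions of [s] and has side [eta] in the others, and adding direction [i] to [s] costs
    [N i] translates. *)
Lemma grid_cover_le (a b : 'rV[R]_m.+1) (eta : R) (N : 'I_m.+1 -> nat) : 0 < eta ->
  (forall i, a ord0 i <= b ord0 i) -> (forall i, b ord0 i - a ord0 i < (N i)%:R * eta) ->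
  (nu (box a b) <= (\prod_i N i)%:R%:E * nu (box a (a + const_mx eta)))%E.
Proof.
move=> eta0 ab abN.
pose e (s : seq 'I_m.+1) : 'rV[R]_m.+1 :=
  \row_i (if i \in s then b ord0 i else a ord0 i + eta).
have H s : uniq s -> (nu (box a (e s)) <=
    (\prod_(i <- s) N i)%:R%:E * nu (box a (a + const_mx eta)))%E.
  elim: s => [_|i s IH /= /andP[iNs us]].
    rewrite big_nil mul1e; apply: le_outer_measure => x h i.
    by have := h i; rewrite !mxE in_nil.
  rewrite big_cons natrM EFinM -muleA.
  apply: (@le_trans _ _ ((N i)%:R%:E * nu (box a (e s)))%E); last first.
    by rewrite lee_wpmul2l ?lee_fin// IH.
  pose v k : 'rV[R]_m.+1 := \row_j (if j == i then k%:R * eta else 0).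
  pose F k := [set x + v k | x in box a (e s)].
  have cov : box a (e (i :: s)) `<=` \big[setU/set0]_(k < N i) F k.
    move=> x h; pose k := Num.truncn ((x ord0 i - a ord0 i) / eta).
    have /andP[axi xib] := h i; move: xib; rewrite mxE mem_head => xib.
    have q0 : 0 <= (x ord0 i - a ord0 i) / eta by apply: divr_ge0; [rewrite subr_ge0|exact: ltW].
    have [k1 k2] : k%:R * eta <= x ord0 i - a ord0 i /\ x ord0 i - a ord0 i < k.+1%:R * eta.
      have /andP := truncn_itv q0; rewrite ler_pdivlMr// ltr_pdivrMr//.
    have kN : (k < N i)%N.
      rewrite -(ltr_nat R) -(ltr_pM2r eta0) (le_lt_trans k1)//.
      by apply: le_lt_trans (abN i); rewrite lerD2r.
    rewrite -bigcup_mkord; exists k => //; exists (x - v k); last by rewrite subrK.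
    move=> j; rewrite !mxE; case: eqP => [->|/eqP ji]; last first.
      by have := h j; rewrite !mxE in_cons (negPf ji) /= oppr0 addr0.
    rewrite (negPf iNs); apply/andP; split; first lra.
    by move: k2; rewrite -natr1; lra.
  apply: (le_trans (le_outer_measure nu _ _ cov)).
  apply: (le_trans (outer_measure_subadditive nu F (N i))).
  under eq_bigr do rewrite nu_translate.
  by rewrite sumr_const card_ord mule_natl.
have := H (index_enum _) (index_enum_uniq _).
apply: le_trans; apply: le_outer_measure => x h i.
by rewrite mxE mem_index_enum; apply: h.
Qed.

End grid.

(** Rounding up the sides of a box to a grid of mesh [e] costs a volume of order [e]. *)
Lemma prod_perturb {R : realType} (I : Type) (s : seq I) (l : I -> R) :
  (forall i, 0 <= l i) -> exists2 C, 0 <= C & forall e, 0 <= e <= 1 ->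
    \prod_(i <- s) (l i + e) <= \prod_(i <- s) l i + C * e.
Proof.
move=> l0; elim: s => [|i s [C C0 IH]].
  by exists 0 => // e _; rewrite !big_nil mul0r addr0.
have P0 : 0 <= \prod_(i <- s) l i by apply: prodr_ge0.
exists (l i * C + \prod_(i <- s) l i + C) => [|e /andP[e0 e1]].
  by rewrite !addr_ge0 ?mulr_ge0.
rewrite !big_cons; apply: (@le_trans _ _ ((l i + e) * (\prod_(i <- s) l i + C * e))).
  by rewrite ler_wpM2l ?addr_ge0// IH// e0.
have : C * e * e <= C * e by rewrite ler_piMr// mulr_ge0.
move: (\prod_(i <- s) l i) => P; lra.
Qed.

Section hausdorff_volume.
Context {R : realType} {m : nat}.
Local Notation raw := (@hausdorff_raw R m.+1 m.+1).
Local Notation cube := (@box R m.+1 0 (const_mx 1)).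

Lemma box_affine (s : R) (v a b : 'rV[R]_m.+1) : 0 < s ->
  [set s *: x + v | x in box a b] = box (s *: a + v) (s *: b + v).
Proof.
move=> s0; apply/seteqP; split=> [_ [x h <-] i|x h].
  by rewrite !mxE !lerD2r !ler_pM2l//; exact: h.
exists (s^-1 *: (x - v)); last first.
  by rewrite scalerA divff ?gt_eqF// scale1r subrK.
move=> i; have := h i; rewrite !mxE => hi.
by rewrite (mulrC s^-1) ler_pdivlMr// ler_pdivrMr//; lra.
Qed.

(** A set of diameter r lies in a cube of side 2 r. The constant is not sharp: it serves to show
    that the Hausdorff measure of the unit cube, by which one normalizes, is not zero. *)
Lemma volume_le_raw A : (volume A <= (2 ^+ m.+1)%:E * raw A)%E.
Proof.
apply: (@le_trans _ _ ((2 ^+ m.+1)%:E * hausdorff_delta m.+1 1 A)%E); last first.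
  by apply: lee_wpmul2l; [rewrite lee_fin exprn_ge0|exact: hausdorff_delta_le_raw].
rewrite -lee_pdivrMl ?exprn_gt0//; apply: le_hausdorff_deltaP => F Fd AF.
rewrite lee_pdivrMl ?exprn_gt0// -nneseriesZl; last first.
  by move=> k _; exact: diam_pow_ge0.
apply: (@le_trans _ _ (volume (\bigcup_k F k))); first exact: le_outer_measure.
apply: (le_trans (outer_measure_sigma_subadditive (@volume R m.+1) F)).
apply: lee_nneseries => k _; first by move=> _; exact: volume_ge0.
rewrite /diam_pow; case: ifPn => [/eqP->|/set0P[x Fx]].
  rewrite mule0 le_eqVlt; apply/orP; left; apply/eqP; exact: volume0.
have Fk : diam (F k) \is a fin_num.
  by rewrite ge0_fin_numE ?diam_ge0// (le_lt_trans (Fd k))// ltry.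
rewrite -(fineK Fk) -EFin_expe -EFinM -exprMn; set r := fine _.
have r0 : 0 <= r by rewrite fine_ge0// diam_ge0.
apply: (le_trans (@volume_le_box _ _ (x - const_mx r) (x + const_mx r) _ (F k) _)).
- by move=> i; rewrite !mxE; lra.
- move=> y Fy i; rewrite !mxE.
  have : `|(x - y) ord0 i| <= r.
    apply: (le_trans (coord_le_enorm _ i)).
    by rewrite -lee_fin /r fineK// diam_ub.
  by rewrite !mxE ler_norml; lra.
rewrite lee_fin /boxvol -[X in _ ^+ X]card_ord -prodr_const.
by apply: ler_prod => i _; rewrite !mxE; apply/andP; split; lra.
Qed.

Lemma raw_cube_fin : (raw cube < +oo)%E.
Proof.
apply: (@le_lt_trans _ _ ((m.+1%:R ^+ m.+1 * 2 ^+ m.+1)%:E : \bar R)); last exact: ltry.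
apply: ge_ereal_sup => _ [r /= r0 <-].
pose delta := PosNum r0.
(* Cells of side 1 / N have Euclidean diameter at most (m + 1) / N. Taking 2 N of
   them in each direction leaves room for a strict inequality. *)
pose N := (Num.truncn (m.+1%:R / r)).+1.
have N0 : (0 : R) < N%:R by rewrite ltr0n.
have Nr : m.+1%:R * N%:R^-1 <= r.
  rewrite ler_pdivrMr// mulrC -ler_pdivrMr//.
  have /andP[_ /ltW] : (Num.truncn (m.+1%:R / r))%:R <= m.+1%:R / r < (Num.truncn (m.+1%:R / r)).+1%:R.
    by apply: truncn_itv; rewrite divr_ge0// ltW.
  by [].
have := @grid_cover_le R m (@hdelta R m.+1 m.+1 delta) (fun v A => hdelta_translate _ _ v A)
  0 (const_mx 1) N%:R^-1 (fun=> (N * 2)%N).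
rewrite invr_gt0 N0 => /(_ isT (fun i => ltac:(by rewrite !mxE))).
have H (i : 'I_m.+1) : (const_mx 1 : 'rV[R]_m.+1) ord0 i - (0 : 'rV[R]_m.+1) ord0 i < (N * 2)%:R * N%:R^-1.
  by rewrite !mxE subr0 natrM mulrAC divff ?gt_eqF// mul1r ltr1n.
move=> /(_ H) /le_trans; apply.
rewrite add0r prod_nat_const card_ord.
set E := box _ _.
have dE : (diam E <= (m.+1%:R * N%:R^-1)%:E)%E.
  apply: diam_leP => [|x y xE yE]; first by rewrite lee_fin mulr_ge0// invr_ge0 ltW.
  rewrite lee_fin (le_trans (enorm_le_norm _))// ler_wpM2l//.
  apply: norm_rV_leP => [|i]; first by rewrite invr_ge0 ltW.
  have := xE i; have := yE i; rewrite !mxE ler_norml; lra.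
have : (hdelta m.+1 delta E <= ((m.+1%:R * N%:R^-1) ^+ m.+1)%:E)%E.
  pose F : nat -> set 'rV[R]_m.+1 := fun k => if k is 0%N then E else set0.
  apply: (le_trans (@hausdorff_delta_leP _ _ _ _ _ F _ _)).
  - move=> [|k] /=; first by rewrite (le_trans dE)// lee_fin.
    by rewrite diam0 lee_fin ltW.
  - by move=> x Ex; exists 0%N.
  rewrite nneseries_recl//; last by move=> k *; exact: diam_pow_ge0.
  rewrite eseries0 ?adde0 => [|[//|k] _ _ /=]; last by rewrite diam_pow0.
  rewrite /diam_pow /F; case: ifP => _; first by rewrite lee_fin exprn_ge0// mulr_ge0// invr_ge0 ltW.
  have Ek : diam E \is a fin_num.
    by rewrite ge0_fin_numE ?diam_ge0// (le_lt_trans dE)// ltry.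
  move: dE (diam_ge0 E); rewrite -(fineK Ek) -EFin_expe !lee_fin => h1 h2.
  by rewrite lerXn2r ?nnegrE// (le_trans h2 h1).
move=> h; apply: (@le_trans _ _ (((N * 2) ^ m.+1)%:R%:E * ((m.+1%:R * N%:R^-1) ^+ m.+1)%:E)%E).
  by apply: lee_wpmul2l; rewrite ?lee_fin.
rewrite -EFinM lee_fin natrX natrM -!exprMn le_eqVlt; apply/orP; left; apply/eqP.
by congr (_ ^+ _); field; rewrite gt_eqF.
Qed.

Definition cube_raw : R := fine (raw cube).

Lemma raw_cubeE : raw cube = cube_raw%:E.
Proof. by rewrite /cube_raw fineK// ge0_fin_numE ?raw_cube_fin// hausdorff_raw_ge0. Qed.

Lemma boxvol_cube : boxvol (0 : 'rV[R]_m.+1) (const_mx 1) = 1.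
Proof. by rewrite /boxvol big1// => i _; rewrite !mxE subr0. Qed.

Lemma cube_raw_gt0 : 0 < cube_raw.
Proof.
have := volume_le_raw cube; rewrite volume_box; last by move=> i; rewrite !mxE.
rewrite raw_cubeE boxvol_cube -EFinM lee_fin => h.
by have := lt_le_trans ltr01 h; rewrite pmulr_rgt0 ?exprn_gt0.
Qed.

Lemma raw_cube_affine (s : R) (v : 'rV[R]_m.+1) : 0 < s ->
  raw (box v (v + const_mx s)) = (s ^+ m.+1 * cube_raw)%:E.
Proof.
move=> s0; have := hausdorff_raw_affine m.+1 v cube s0; rewrite raw_cubeE -EFinM => <-.
congr hausdorff_raw; rewrite box_affine// scaler0 add0r; congr box.
by apply/rowP => i; rewrite !mxE mulr1 addrC.
Qed.

(** A box is nearly a union of cubes of a small side [eta], whose measure is proportional to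
    eta^(m + 1) by homogeneity and translation invariance. *)
Lemma raw_box_le (a b : 'rV[R]_m.+1) : (forall i, a ord0 i <= b ord0 i) ->
  (raw (box a b) <= (cube_raw * boxvol a b)%:E)%E.
Proof.
move=> ab.
have l0 i : 0 <= b ord0 i - a ord0 i by rewrite subr_ge0.
have [C C0 hC] := @prod_perturb R _ (index_enum 'I_m.+1) (fun i => b ord0 i - a ord0 i) l0.
apply/lee_addgt0Pr => e e0.
have c0 := cube_raw_gt0.
pose eta := Num.min 1 (e / (cube_raw * (C + 1))).
have cC0 : 0 < cube_raw * (C + 1) by rewrite mulr_gt0// ltr_wpDl.
have eta0 : 0 < eta by rewrite lt_min ltr01 divr_gt0.
pose N i := (Num.truncn ((b ord0 i - a ord0 i) / eta)).+1.
have HN i : (b ord0 i - a ord0 i < (N i)%:R * eta) && ((N i)%:R * eta <= b ord0 i - a ord0 i + eta).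
  have /andP : (Num.truncn ((b ord0 i - a ord0 i) / eta))%:R <= (b ord0 i - a ord0 i) / eta < (N i)%:R.
    by apply: truncn_itv; apply: divr_ge0 => //; exact: ltW.
  rewrite ler_pdivlMr// ltr_pdivrMr// => -[h1 h2]; rewrite h2/= /N -natr1 mulrDl mul1r.
  by rewrite lerD2r.
have HN1 i : b ord0 i - a ord0 i < (N i)%:R * eta by case/andP: (HN i).
have /le_trans : (raw (box a b) <= (\prod_i N i)%:R%:E * raw (box a (a + const_mx eta)))%E :=
  grid_cover_le (fun v A => hausdorff_raw_translate m.+1 v A) eta0 ab HN1.
apply.
rewrite raw_cube_affine// -EFinM -EFinD lee_fin.
have -> : (\prod_i N i)%:R * (eta ^+ m.+1 * cube_raw) = cube_raw * \prod_i ((N i)%:R * eta).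
  rewrite big_split /= prodr_const card_ord natr_prod; ring.
apply: (@le_trans _ _ (cube_raw * (boxvol a b + C * eta))).
  apply: ler_wpM2l; first exact: ltW.
  apply: (@le_trans _ _ (\prod_i (b ord0 i - a ord0 i + eta))).
    apply: ler_prod => i _; case/andP: (HN i) => _ ->; rewrite andbT mulr_ge0//.
    exact: ltW.
  by apply: hC; rewrite ltW//= /eta ge_min lexx.
rewrite mulrDr lerD2l.
apply: (@le_trans _ _ (cube_raw * (C + 1) * eta)).
  by have : 0 <= cube_raw * eta by [apply: mulr_ge0; exact: ltW]; lra.
by rewrite -ler_pdivlMl// mulrC /eta ge_min lexx orbT.
Qed.

Lemma raw_le_volume A : (raw A <= cube_raw%:E * volume A)%E.
Proof.
have c0 := cube_raw_gt0.
rewrite -lee_pdivrMl//; apply: le_volumeP => c d cd cov.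
rewrite lee_pdivrMl// -nneseriesZl; last by move=> k _; rewrite lee_fin boxvol_ge0.
apply: (@le_trans _ _ (raw (\bigcup_k box (c k) (d k)))); first exact: le_hausdorff_raw.
apply: (le_trans (@hausdorff_raw_sigma_subadditive R m.+1 m.+1 (fun k => box (c k) (d k)))).
apply: lee_nneseries => k _; first by move=> _; exact: hausdorff_raw_ge0.
by rewrite -EFinM raw_box_le.
Qed.

(** One inequality holds for every set. For the other one, enclose [A] in a cube: there the two
    measures agree, [raw] is subadditive, and the volume is additive along [A]. *)
Lemma raw_eq_volume A : bounded_set A -> (@volume R m.+1).-caratheodory A ->
  raw A = (cube_raw%:E * volume A)%E.
Proof.
move=> bA mA; apply/eqP; rewrite eq_le raw_le_volume/=.
have /bounded_rVP[M M0 AM] := bA.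
pose v : 'rV[R]_m.+1 := const_mx (- M).
pose Q := box v (v + const_mx (M + M)).
have AQ : A `<=` Q.
  move=> x /AM xM i; have := le_trans (ler_coord_norm x i) xM.
  by rewrite !mxE ler_norml; lra.
have bQ : bounded_set Q.
  apply/bounded_rVP; exists M => // x h; apply: norm_rV_leP => [|i]; first exact: ltW.
  by have := h i; rewrite !mxE ler_norml; lra.
have bQA : bounded_set (Q `\` A) by apply: sub_bounded bQ => x [].
have vQ : vol Q = (M + M) ^+ m.+1.
  rewrite /vol volume_box/=; last by move=> i; rewrite !mxE; lra.
  rewrite /boxvol -[X in _ = _ ^+ X]card_ord -prodr_const.
  by apply: eq_bigr => i _; rewrite !mxE; lra.
have := vol_caratheodory bQ mA; rewrite (setIidr AQ) vQ => hvol.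
have : (raw Q <= raw A + cube_raw%:E * volume (Q `\` A))%E.
  apply: (@le_trans _ _ (raw A + raw (Q `\` A))%E); last first.
    by rewrite leeD2l// raw_le_volume.
  apply: le_trans (outer_measureU2 (@hausdorff_raw R m.+1 m.+1) A (Q `\` A)).
  by apply: le_hausdorff_raw => x Qx; have [Ax|nAx] := pselect (A x); [left|right].
rewrite raw_cube_affine ?addr_gt0// (volE bQA) (volE bA) -!EFinM.
have rA : raw A \is a fin_num.
  rewrite ge0_fin_numE ?hausdorff_raw_ge0//; apply: (le_lt_trans (raw_le_volume A)).
  by rewrite (volE bA) -EFinM ltry.
by rewrite -(fineK rA) -EFinD !lee_fin hvol; lra.
Qed.

(** This computes the Hausdorff measure of sets that are flat in the ambient space, such as the
    faces of a convex body: the measure does not see the ambient space, and in the space of the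
    same dimension it is the volume. *)
Lemma hausdorff_isometry_volume n (j : 'rV[R]_m.+1 -> 'rV[R]_n) (g : 'rV[R]_n -> 'rV[R]_m.+1) A :
  cancel j g -> (forall x y, enorm (j x - j y) = enorm (x - y)) ->
  bounded_set A -> (@volume R m.+1).-caratheodory A ->
  hausdorff m.+1 (j @` A) = volume A.
Proof.
move=> jg je bA mA; rewrite /hausdorff (hausdorff_raw_isometry _ _ jg je).
rewrite (raw_eq_volume bA mA) raw_cubeE /= muleA -EFinM mulVf ?mul1e//.
by rewrite gt_eqF// cube_raw_gt0.
Qed.

End hausdorff_volume.

(** * Closed sets are measurable for the Hausdorff measure *)
Section metric_outer_measure.
Context {R : realType} {n d : nat}.
Local Notation raw := (@hausdorff_raw R n d).
Implicit Types X Y C : set 'rV[R]_n.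

Lemma hausdorff_delta_ge0 delta X : (0 <= hausdorff_delta d delta X)%E.
Proof. by apply: cover_inf_ge0; exact: diam_pow_ge0. Qed.

Lemma hausdorff_delta_anti (r s : R) X : r <= s ->
  (hausdorff_delta d s X <= hausdorff_delta d r X)%E.
Proof.
move=> rs; apply: le_hausdorff_deltaP => F Fr XF; apply: hausdorff_delta_leP => // k.
by rewrite (le_trans (Fr k))// lee_fin.
Qed.

(** A covering set of diameter less than [delta] meets at most one of [X] and [Y], so that a
    fine cover of the union splits into covers of the two. *)
Lemma hausdorff_raw_separated X Y (delta : R) : 0 < delta ->
  (forall x y, X x -> Y y -> delta <= enorm (x - y)) ->
  (raw X + raw Y <= raw (X `|` Y))%E.
Proof.
move=> d0 sep.
have [->|/eqP Moo] := eqVneq (raw (X `|` Y)) +oo%E; first exact: leey.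
have rfin Z : Z `<=` X `|` Y -> raw Z \is a fin_num.
  move=> ZXY; rewrite ge0_fin_numE ?hausdorff_raw_ge0//.
  by apply: (le_lt_trans (@le_hausdorff_raw R n d _ _ ZXY)); rewrite ltey; apply/eqP.
have main (r1 r2 : R) : 0 < r1 -> 0 < r2 ->
    (hausdorff_delta d r1 X + hausdorff_delta d r2 Y <= raw (X `|` Y))%E.
  move=> r10 r20; pose r := Num.min (Num.min r1 r2) (delta / 2).
  have r0 : 0 < r by rewrite !lt_min r10 r20 divr_gt0.
  have rd : r < delta.
    by apply: (@le_lt_trans _ _ (delta / 2)); [rewrite /r ge_min lexx orbT|lra].
  apply: (@le_trans _ _ (hausdorff_delta d r X + hausdorff_delta d r Y)%E).
    by apply: leeD; apply: hausdorff_delta_anti; rewrite /r !ge_min lexx ?orbT.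
  apply: le_trans (hausdorff_delta_le_raw d (X `|` Y) r0).
  apply: le_hausdorff_deltaP => F Fr XYF.
  pose G (Z : set 'rV[R]_n) k := if `[< F k `&` Z !=set0 >] then F k else set0.
  have Gr Z k : (diam (G Z k) <= r%:E)%E.
    by rewrite /G; case: asboolP => // _; rewrite diam0 lee_fin ltW.
  have GZ Z : Z `<=` X `|` Y -> Z `<=` \bigcup_k G Z k.
    move=> ZXY z Zz; have [k _ Fz] := XYF z (ZXY z Zz); exists k => //.
    by rewrite /G; case: asboolP => // -[]; exists z.
  apply: (le_trans (leeD (hausdorff_delta_leP d (Gr X) (GZ X (@subsetUl _ _ _)))
    (hausdorff_delta_leP d (Gr Y) (GZ Y (@subsetUr _ _ _))))).
  rewrite -nneseriesD; try by move=> *; exact: diam_pow_ge0.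
  apply: lee_nneseries => k _; first by move=> _; apply: adde_ge0; exact: diam_pow_ge0.
  rewrite /G; case: asboolP => [[x [Fx Xx]]|_]; case: asboolP => [[y [Fy Yy]]|_];
    rewrite ?diam_pow0 ?adde0 ?add0e ?diam_pow_ge0//.
  have := sep _ _ Xx Yy; rewrite leNgt => /negP; case.
  by rewrite -lte_fin; apply: (le_lt_trans (diam_ub Fx Fy)); apply: (le_lt_trans (Fr k)); rewrite lte_fin.
have rX := rfin X (@subsetUl _ _ _); have rY := rfin Y (@subsetUr _ _ _).
rewrite -leeBrDr//; apply: ge_ereal_sup => _ [r1 /= r10 <-].
have h1 : hausdorff_delta d r1 X \is a fin_num.
  rewrite ge0_fin_numE ?hausdorff_delta_ge0//.
  apply: (le_lt_trans (hausdorff_delta_le_raw d X r10)).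
  by move: rX; rewrite ge0_fin_numE ?hausdorff_raw_ge0.
rewrite leeBrDr// -leeBrDl//; apply: ge_ereal_sup => _ [r2 /= r20 <-].
by rewrite leeBrDl//; exact: main.
Qed.

Section closed.
Variables (C X : set 'rV[R]_n).
Hypothesis cC : closed C.

Let far k : set 'rV[R]_n := [set x | X x /\ forall c, C c -> k.+1%:R^-1 <= enorm (x - c)].

Let far_nondecreasing i k : (i <= k)%N -> far i `<=` far k.
Proof.
move=> ik x [Xx h]; split=> // c /h; apply: le_trans.
by rewrite lef_pV2 ?posrE ?ltr0n// ler_nat ltnS.
Qed.

Let shell k := far k.+1 `\` far k.

Let far_separated k Y Z : Y `<=` far k -> (forall z, Z z -> X z /\ ~ far k.+1 z) ->
  (raw Y + raw Z <= raw (Y `|` Z))%E.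
Proof.
move=> Yk Zk; apply: (@hausdorff_raw_separated _ _ (k.+1%:R^-1 - k.+2%:R^-1)).
  by rewrite subr_gt0 ltf_pV2 ?posrE ?ltr0n// ltr_nat.
move=> y z /Yk[Xy hy] /Zk[Xz].
move=> /not_andP[//|/existsNP[c /not_implyP[Cc /negP]]].
rewrite -ltNge => hc.
have := hy c Cc; have -> : y - c = (y - z) + (z - c) by rewrite addrA subrK.
move=> /le_trans/(_ (enormD _ _)) h; rewrite lerBlDr; apply: (le_trans h).
by rewrite lerD2l ltW.
Qed.

Let shell_sum o N : (\sum_(j < N) raw (shell (2 * j + o).+1) <= raw X)%E.
Proof.
suff : (\sum_(j < N) raw (shell (2 * j + o).+1) <= raw (far (2 * N + o)))%E.
  by move=> /le_trans; apply; apply: le_hausdorff_raw => x [].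
elim: N => [|N IH]; first by rewrite big_ord0 hausdorff_raw_ge0.
rewrite big_ord_recr /=.
apply: (le_trans (leeD2r _ IH)).
have -> : (2 * N.+1 + o = (2 * N + o).+2)%N by rewrite mulnS !addSn.
set K := (2 * N + o)%N.
apply: le_trans (_ : raw (far K `|` shell K.+1) <= _)%E.
  apply: (@far_separated K) => // z [[Xz _] nz]; split=> //.
apply: le_hausdorff_raw => x [|[]//]; apply: far_nondecreasing.
by rewrite -addn2 leq_addr.
Qed.

Let shell_series o : (\sum_(j <oo) raw (shell (2 * j + o).+1) <= raw X)%E.
Proof.
apply: lime_le; first by apply: is_cvg_nneseries => k _ _; exact: hausdorff_raw_ge0.
by apply: nearW => N; rewrite big_mkord; exact: shell_sum.
Qed.

Let cover_far N : X `\` C `<=` far (2 * N).+1 `|`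
  (\bigcup_(j in ~` `I_N) shell (2 * j + 0).+1) `|`
  (\bigcup_(j in ~` `I_N) shell (2 * j + 1).+1).
Proof.
move=> x [Xx nCx].
have [k farx] : exists k, far k x.
  have /open_rVP/(_ x nCx)[r r0 hr] := closed_openC cC.
  pose k := Num.truncn r^-1; exists k; split=> // c Cc.
  apply: (@le_trans _ _ r).
    rewrite -[r]invrK lef_pV2 ?posrE ?ltr0n ?invr_gt0//.
    have r1 : 0 <= r^-1 by rewrite invr_ge0 ltW.
    by have /andP[_ /ltW] := truncn_itv r1.
  rewrite leNgt; apply/negP => h; apply: (hr c) => //.
  exact: le_lt_trans (norm_le_enorm _) h.
have [kN|Nk] := leqP k (2 * N).+1; first by left; left; exact: far_nondecreasing farx.
have : ~ far (2 * N).+1 x \/ far (2 * N).+1 x by have [|] := pselect (far (2 * N).+1 x); [right|left].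
case=> [nfar|]; last by left; left.
(* [i] is the last index at which [x] is still near [C]. *)
have [i [iN nfi fi]] : exists i, [/\ ((2 * N).+1 <= i)%N, ~ far i x & far i.+1 x].
  elim: k Nk farx => [//|k IH] Nk farx.
  have [fk|nfk] := pselect (far k x); last by exists k; split=> //; rewrite ltnS in Nk.
  move: Nk; rewrite ltnS leq_eqVlt => /orP[/eqP e|/IH]; last exact.
  by move: nfar; rewrite e.
have sh : shell i x by split.
case: i iN sh {nfi fi} => [//|i]; rewrite ltnS => iN sh.
have Ei := odd_double_half i; case: (boolP (odd i)) => oi; rewrite ?oi ?(negPf oi) in Ei.
  right; exists i./2; first by apply/negP; rewrite -leqNgt; lia.
  by have -> : (2 * i./2 + 1 = i)%N by lia.
left; right; exists i./2; first by apply/negP; rewrite -leqNgt; lia.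
by have -> : (2 * i./2 + 0 = i)%N by lia.
Qed.

(** Caratheodory's argument. Two shells whose indices have the same parity and differ are at
    positive distance, so that each of the two series of measures of shells is bounded by the
    measure of [X]. Hence the parts of [X] close to [C] but not in [C] have small measure, and
    what remains is far from [C]. *)
Lemma hausdorff_raw_closed_split : (raw (X `&` C) + raw (X `\` C) <= raw X)%E.
Proof.
have [->|/eqP Moo] := eqVneq (raw X) +oo%E; first exact: leey.
have rfin Z : Z `<=` X -> raw Z \is a fin_num.
  move=> ZX; rewrite ge0_fin_numE ?hausdorff_raw_ge0//.
  by apply: (le_lt_trans (@le_hausdorff_raw R n d _ _ ZX)); rewrite ltey; apply/eqP.
apply/lee_addgt0Pr => e e0.
have tail o : exists N, forall k, (N <= k)%N ->
    (\sum_(k <= j <oo) raw (shell (2 * j + o).+1) <= (e / 2)%:E)%E.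
  have h : (\sum_(j <oo) raw (shell (2 * j + o).+1) < +oo)%E.
    by apply: (le_lt_trans (shell_series o)); rewrite ltey; apply/eqP.
  have := nneseries_tail_cvg h (fun k _ => hausdorff_raw_ge0 d _).
  move=> /fine_cvgP[_ /cvgrPdist_le/(_ (e / 2))]; rewrite divr_gt0// => /(_ isT)[N _ hN].
  exists N => k Nk; have /= := hN k Nk; rewrite sub0r normrN => hk.
  have hfin : (\sum_(k <= j <oo) raw (shell (2 * j + o).+1) \is a fin_num)%E.
    rewrite ge0_fin_numE; last by apply: nneseries_ge0 => *; exact: hausdorff_raw_ge0.
    apply: le_lt_trans h; rewrite [leRHS](nneseries_split _ k)//; last by move=> *; exact: hausdorff_raw_ge0.
    by rewrite add0n leeDr// sume_ge0// => *; exact: hausdorff_raw_ge0.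
  by rewrite -(fineK hfin) lee_fin (le_trans (ler_norm _) hk).
have [N0 h0] := tail 0%N; have [N1 h1] := tail 1%N.
pose N := maxn N0 N1.
have sub Z o : (raw (Z `|` \bigcup_(j in ~` `I_N) shell (2 * j + o).+1) <=
    raw Z + \sum_(N <= j <oo) raw (shell (2 * j + o).+1))%E.
  apply: (le_trans (outer_measureU2 (@hausdorff_raw R n d) _ _)).
  apply: leeD2l.
  exact: (@outer_measure_sigma_subadditive_tail _ _ (@hausdorff_raw R n d) N (fun j => shell (2 * j + o).+1)).
apply: (@le_trans _ _ (raw (X `&` C) + (raw (far (2 * N).+1) + (e / 2)%:E + (e / 2)%:E))%E).
  apply: leeD2l; apply: (le_trans (@le_hausdorff_raw R n d _ _ (@cover_far N))).
  apply: (le_trans (sub _ 1%N)); apply: leeD; last by apply: h1; rewrite leq_maxr.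
  apply: (le_trans (sub _ 0%N)); apply: leeD2l; by apply: h0; rewrite leq_maxl.
rewrite -addeA -EFinD addeA; have -> : e / 2 + e / 2 = e by lra.
apply: leeD2r.
apply: (@le_trans _ _ (raw (X `&` C `|` far (2 * N).+1))).
  rewrite addeC setUC; apply: (@far_separated (2 * N).+1) => // z [Xz Cz]; split=> // -[_ /(_ z Cz)].
  rewrite subrr /enorm dot0l sqrtr0 leNgt => /negP; apply.
  by rewrite invr_gt0 ltr0n.
by apply: le_hausdorff_raw => x [[]|[]].
Qed.

End closed.

Lemma hausdorff_caratheodory_closed C : closed C -> (@hausdorff R n d).-caratheodory C.
Proof.
move=> cC; apply: le_caratheodory_measurable => X.
rewrite /hausdorff -ge0_muleDr ?hausdorff_raw_ge0//.
apply: lee_wpmul2l; first by rewrite lee_fin invr_ge0 fine_ge0// hausdorff_raw_ge0.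
exact: hausdorff_raw_closed_split.
Qed.

End metric_outer_measure.

(** * The Brunn-Minkowski inequality for convex sets *)
Section roots.
Context {R : realType}.

Definition rootr (k : nat) (x : R) : R := x `^ (k%:R^-1).

Lemma rootr_ge0 k x : 0 <= rootr k x. Proof. exact: powR_ge0. Qed.

Lemma rootrK k x : (0 < k)%N -> 0 <= x -> rootr k x ^+ k = x.
Proof.
move=> k0 x0; rewrite /rootr -powR_mulrn ?powR_ge0// -powRrM mulVf ?powRr1//.
by rewrite pnatr_eq0 -lt0n.
Qed.

Lemma rootr_gt0 k x : (0 < k)%N -> 0 < x -> 0 < rootr k x.
Proof. by move=> k0 x0; rewrite /rootr powR_gt0. Qed.

(** Divide by the right-hand side: the arithmetic-geometric mean inequality, applied to the
    [u i / (u i + v i)] and to the [v i / (u i + v i)], gives two arithmetic means whose sum is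
    1. *)
Lemma minkowski_prod (m : nat) (u v : 'I_m.+1 -> R) (alpha beta kappa : R) :
  0 < alpha -> 0 < beta -> 0 < kappa -> (forall i, 0 < u i) -> (forall i, 0 < v i) ->
  \prod_i u i = alpha ^+ m.+1 * kappa -> \prod_i v i = beta ^+ m.+1 * kappa ->
  (alpha + beta) ^+ m.+1 * kappa <= \prod_i (u i + v i).
Proof.
move=> a0 b0 k0 u0 v0 ua vb.
set P := \prod_i (u i + v i).
have P0 : 0 < P by apply: prodr_gt0 => i _; rewrite addr_gt0.
have kP : 0 < kappa / P by rewrite divr_gt0.
pose th := rootr m.+1 (kappa / P).
have th0 : 0 < th by apply: rootr_gt0.
have thE : th ^+ m.+1 = kappa / P by rewrite rootrK// ltW.
have agm (w : 'I_m.+1 -> R) (g : R) : 0 < g -> (forall i, 0 < w i) ->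
    \prod_i w i = g ^+ m.+1 * kappa ->
    th * g <= (\sum_i w i / (u i + v i)) / m.+1%:R.
  move=> g0 w0 wg.
  have x0 i : 0 <= w i / (u i + v i) by rewrite divr_ge0// ltW// addr_gt0.
  have := (leif_AGM (A := xpredT) (fun i _ => x0 i)).1.
  rewrite card_ord big_split /= prodfV -/P wg => h.
  rewrite -(ler_pXn2r (n:=m.+1))// ?nnegrE; first last.
  - by rewrite divr_ge0// sumr_ge0.
  - by rewrite mulr_ge0// ltW.
  by rewrite exprMn thE; apply: le_trans h; rewrite le_eqVlt; apply/orP; left; apply/eqP; ring.
have h1 := agm u alpha a0 u0 ua; have h2 := agm v beta b0 v0 vb.
have : th * (alpha + beta) <= 1.
  rewrite mulrDr; apply: (le_trans (lerD h1 h2)).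
  rewrite -mulrDl -big_split /= (eq_bigr (fun=> 1)) => [|i _].
    by rewrite sumr_const card_ord divff.
  by rewrite -mulrDl divff// gt_eqF// addr_gt0.
have tg : 0 <= th * (alpha + beta) by rewrite mulr_ge0 ?addr_ge0// ltW.
move=> /(exprn_ile1 m.+1 tg); rewrite exprMn thE.
rewrite mulrAC ler_pdivrMr// mul1r mulrC //.
Qed.

End roots.

Section boxes.
Context {R : realType} {m : nat}.
Local Notation V := 'rV[R]_m.+1.
Local Notation bx := (V * V)%type.
Implicit Types (p q : bx) (L : seq bx) (i : 'I_m.+1) (s r : R).

Definition boxset p : set V := box p.1 p.2.
Definition nondeg p := [forall i, p.1 ord0 i < p.2 ord0 i].
Definition separated p q :=
  [exists i, (p.2 ord0 i <= q.1 ord0 i) || (q.2 ord0 i <= p.1 ord0 i)].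
Definition total L : R := \sum_(p <- L) boxvol p.1 p.2.

Lemma boxvol_gt0 p : nondeg p -> 0 < boxvol p.1 p.2.
Proof. by move=> /forallP h; apply: prodr_gt0 => i _; rewrite subr_gt0. Qed.

Lemma total_gt0 L : all nondeg L -> L != [::] -> 0 < total L.
Proof.
case: L => [//|p L] /= /andP[pn Ln] _; rewrite /total big_cons ltr_pwDl ?boxvol_gt0//.
rewrite big_seq; apply: sumr_ge0 => q qL; apply/ltW/boxvol_gt0.
by move/allP: Ln; apply.
Qed.

Definition cutlo i s L : seq bx :=
  [seq (p.1, set_coord p.2 i (Num.min (p.2 ord0 i) s)) | p <- L & p.1 ord0 i < s].
Definition cuthi i s L : seq bx :=
  [seq (set_coord p.1 i (Num.max (p.1 ord0 i) s), p.2) | p <- L & s < p.2 ord0 i].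

Let width i p := \prod_(j | j != i) (p.2 ord0 j - p.1 ord0 j).

Let cutlo_vol i s p : boxvol p.1 (set_coord p.2 i (Num.min (p.2 ord0 i) s)) =
  width i p * (Num.min (p.2 ord0 i) s - p.1 ord0 i).
Proof.
rewrite (boxvolD1 _ _ i) set_coordE eqxx mulrC; congr (_ * _).
by apply: eq_bigr => j /negPf ji; rewrite set_coordE ji.
Qed.

Let cuthi_vol i s p : boxvol (set_coord p.1 i (Num.max (p.1 ord0 i) s)) p.2 =
  width i p * (p.2 ord0 i - Num.max (p.1 ord0 i) s).
Proof.
rewrite (boxvolD1 _ _ i) set_coordE eqxx mulrC; congr (_ * _).
by apply: eq_bigr => j /negPf ji; rewrite set_coordE ji.
Qed.

Let box_vol i p : boxvol p.1 p.2 = width i p * (p.2 ord0 i - p.1 ord0 i).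
Proof. by rewrite (boxvolD1 _ _ i) mulrC. Qed.

Let total_cutloE i s L : all nondeg L -> total (cutlo i s L) =
  \sum_(p <- L) width i p * (Num.min (p.2 ord0 i) s - Num.min (p.1 ord0 i) s).
Proof.
rewrite /total /cutlo big_map big_filter big_mkcond /=.
elim: L => [|p L IH] /=; first by rewrite !big_nil.
move=> /andP[/forallP pn /IH {}IH]; rewrite !big_cons IH; congr (_ + _).
case: (boolP (p.1 ord0 i < s)) => [ps|]; first by rewrite cutlo_vol (min_l (ltW ps)).
by rewrite -leNgt => sp; rewrite !min_r ?subrr ?mulr0// (le_trans sp)// ltW.
Qed.

Lemma total_cut i s L : all nondeg L ->
  total (cutlo i s L) + total (cuthi i s L) = total L.
Proof.
move=> Ln; rewrite total_cutloE// /total /cuthi big_map big_filter [X in _ + X]big_mkcond /=.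
elim: L Ln => [|p L IH] /=; first by rewrite !big_nil addr0.
move=> /andP[/forallP pn /IH {}IH]; rewrite !big_cons -IH addrACA; congr (_ + _).
have pi := pn i; rewrite (box_vol i); case: (boolP (s < p.2 ord0 i)) => [sp|].
  rewrite cuthi_vol (min_r (ltW sp)); case: (leP (p.1 ord0 i) s) => h; ring.
by rewrite -leNgt => ps; rewrite min_l// min_l ?addr0// (le_trans (ltW pi)).
Qed.

Lemma nondeg_cutlo i s L : all nondeg L -> all nondeg (cutlo i s L).
Proof.
move=> /allP h; apply/allP => _ /mapP[p + ->]; rewrite mem_filter => /andP[ps /h /forallP pn].
apply/forallP => j; rewrite /= set_coordE; case: eqP => [->|//].
by rewrite lt_min pn.
Qed.

Lemma nondeg_cuthi i s L : all nondeg L -> all nondeg (cuthi i s L).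
Proof.
move=> /allP h; apply/allP => _ /mapP[p + ->]; rewrite mem_filter => /andP[ps /h /forallP pn].
apply/forallP => j; rewrite /= set_coordE; case: eqP => [->|//].
by rewrite gt_max pn.
Qed.

Lemma separated_cutlo i s L : pairwise separated L -> pairwise separated (cutlo i s L).
Proof.
move=> h; rewrite /cutlo pairwise_map.
apply: sub_pairwise (subseq_pairwise (filter_subseq _ _) h) => p q /existsP[j hj] /=.
apply/existsP; exists j; rewrite /= !set_coordE; case: eqP hj => [->|_//] /orP[hj|hj].
  by rewrite ge_min hj.
by rewrite (ge_min (p.1 ord0 i)) hj orbT.
Qed.

Lemma separated_cuthi i s L : pairwise separated L -> pairwise separated (cuthi i s L).
Proof.
move=> h; rewrite /cuthi pairwise_map.
apply: sub_pairwise (subseq_pairwise (filter_subseq _ _) h) => p q /existsP[j hj] /=.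
apply/existsP; exists j; rewrite /= !set_coordE; case: eqP hj => [->|_//] /orP[hj|hj].
  by rewrite le_max hj.
by rewrite (le_max (q.2 ord0 i)) hj orbT.
Qed.

Lemma size_cutlo i s L : (size (cutlo i s L) <= size L)%N.
Proof. by rewrite size_map size_filter count_size. Qed.

Lemma size_cuthi i s L : (size (cuthi i s L) <= size L)%N.
Proof. by rewrite size_map size_filter count_size. Qed.

Lemma cutlo_coord i s L p : p \in cutlo i s L -> exists2 q, q \in L &
  [/\ p.1 = q.1, forall j, p.2 ord0 j <= q.2 ord0 j & p.2 ord0 i <= s].
Proof.
move=> /mapP[q]; rewrite mem_filter => /andP[qs qL] ->; exists q => //=.
split=> // [j|]; rewrite set_coordE; last by rewrite eqxx ge_min lexx orbT.
by case: eqP => [->|//]; rewrite ge_min lexx.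
Qed.

Lemma cuthi_coord i s L p : p \in cuthi i s L -> exists2 q, q \in L &
  [/\ p.2 = q.2, forall j, q.1 ord0 j <= p.1 ord0 j & s <= p.1 ord0 i].
Proof.
move=> /mapP[q]; rewrite mem_filter => /andP[qs qL] ->; exists q => //=.
split=> // [j|]; rewrite set_coordE; last by rewrite eqxx le_max lexx orbT.
by case: eqP => [->|//]; rewrite le_max lexx.
Qed.

(** By the intermediate value theorem, as the volume below the cut is continuous in the position
    of the cut. *)
Lemma cut_fraction i L (t : R) : all nondeg L -> 0 <= t <= total L ->
  exists r, total (cutlo i r L) = t.
Proof.
move=> Ln tL.
pose f (r : R) : R := \sum_(p <- L) width i p * (Num.min (p.2 ord0 i) r - Num.min (p.1 ord0 i) r).
have [M M0 HM] : exists2 M : R, 0 < M & forall p, p \in L -> -M <= p.1 ord0 i /\ p.2 ord0 i <= M.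
  elim: (L) => [|p L' [M M0 IH]]; first by exists 1.
  exists (M + `|p.1 ord0 i| + `|p.2 ord0 i|); first by rewrite ltr_pwDl// ltr_pwDl.
  move=> q; rewrite in_cons => /orP[/eqP->|/IH[h1 h2]].
    have := ler_norm (p.2 ord0 i); have := ler_norm (- p.1 ord0 i); rewrite normrN.
    by have := normr_ge0 (p.1 ord0 i); have := normr_ge0 (p.2 ord0 i); lra.
  by have := normr_ge0 (p.1 ord0 i); have := normr_ge0 (p.2 ord0 i); lra.
have fc : continuous f.
  have -> : f = (fun r => \sum_(p <- L) width i p * (Num.min (p.2 ord0 i) r - Num.min (p.1 ord0 i) r)) by [].
  elim: (L) => [|p L' IH].
    by under eq_fun do rewrite big_nil; exact: cst_continuous.
  under eq_fun do rewrite big_cons.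
  move=> r; apply: (@continuousD _ _ _ (fun r => width i p * (Num.min (p.2 ord0 i) r - Num.min (p.1 ord0 i) r))); last exact: IH.
  apply: continuousM; first exact: cst_continuous.
  apply: continuousB; apply: (@continuous_min R R (cst _) id); try exact: cst_continuous; by move=> ?; exact: cvg_id.
have fl : f (- M) = 0.
  rewrite /f big_seq big1// => p pL; have [h1 h2] := HM p pL.
  have /forallP/(_ i) := allP Ln p pL => /ltW h3.
  by rewrite !min_r ?subrr ?mulr0// (le_trans h1).
have fh : f M = total L.
  rewrite /f /total big_seq [RHS]big_seq; apply: eq_bigr => p pL; have [h1 h2] := HM p pL.
  have /forallP/(_ i) := allP Ln p pL => /ltW h3.
  by rewrite (box_vol i) !min_l// (le_trans h3).
have [|||r _ fr] := @IVT R f (- M) M t; first lra.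
- by apply: continuous_subspaceT => x; exact: fc.
- by rewrite fl fh; have /andP[h1 h2] := tL; rewrite ge_min le_max h1 h2 orbT.
by exists r; rewrite total_cutloE.
Qed.

(** The induction of Hadwiger and Ohmann, on the number of boxes. Two separated boxes of a
    family lie on different sides of a coordinate hyperplane; cut the other family in the same
    ratio by a parallel hyperplane. The sums of corresponding parts then lie on different sides
    of a third one. Writing the volumes with a common factor [kappa] makes the claim additive in
    [kappa] and thus stable under cuts. *)
Lemma brunn_minkowski_boxes (As Bs : seq bx) (alpha beta kappa : R) (X : set V) :
  0 < alpha -> 0 < beta -> 0 < kappa ->
  all nondeg As -> all nondeg Bs -> pairwise separated As -> pairwise separated Bs ->
  total As = alpha ^+ m.+1 * kappa -> total Bs = beta ^+ m.+1 * kappa ->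
  (forall p q, p \in As -> q \in Bs -> box (p.1 + q.1) (p.2 + q.2) `<=` X) ->
  (((alpha + beta) ^+ m.+1 * kappa)%:E <= volume X)%E.
Proof.
have [N] := ubnP (size As + size Bs).
elim: N As Bs alpha beta kappa X => [//|N IH] As Bs alpha beta kappa X + a0 b0 k0.
(* The cutting step, for a first family with at least two boxes. *)
have step As' Bs' alpha' beta' : (size As' + size Bs' < N.+1)%N -> 0 < alpha' -> 0 < beta' ->
    (1 < size As')%N ->
    all nondeg As' -> all nondeg Bs' -> pairwise separated As' -> pairwise separated Bs' ->
    total As' = alpha' ^+ m.+1 * kappa -> total Bs' = beta' ^+ m.+1 * kappa ->
    (forall p q, p \in As' -> q \in Bs' -> box (p.1 + q.1) (p.2 + q.2) `<=` X) ->
    (((alpha' + beta') ^+ m.+1 * kappa)%:E <= volume X)%E.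
  move=> {a0 b0 alpha beta As Bs}.
  case: As' => [//|p [//|q As]] sz a0 b0 _ An Bn As_ Bs_ Aa Bb ABX.
  have [i [s [ps [qs pq]]]] : exists i s, [\/ p.1 ord0 i < s | q.1 ord0 i < s] /\
      [\/ s < p.2 ord0 i | s < q.2 ord0 i] /\
      ((s <= p.1 ord0 i \/ s <= q.1 ord0 i) /\ (p.2 ord0 i <= s \/ q.2 ord0 i <= s)).
    move: As_ An => /= /andP[/andP[/existsP[i /orP h] _] _] /and3P[/forallP pn /forallP qn _].
    exists i; have pi := pn i; have qi := qn i; case: h => h.
      exists (p.2 ord0 i); split; first by constructor 1.
      split; first by constructor 2; apply: le_lt_trans h qi.
      by split; [right|left].
    exists (q.2 ord0 i); split; first by constructor 2.
    split; first by constructor 1; apply: le_lt_trans h pi.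
    by split; [left|right].
  set A := [:: p, q & As] in sz An As_ Aa ABX *.
  have lo0 : cutlo i s A != [::].
    by rewrite -size_eq0 size_map size_filter -lt0n -has_count /= ; case: ps => ->; rewrite ?orbT.
  have hi0 : cuthi i s A != [::].
    by rewrite -size_eq0 size_map size_filter -lt0n -has_count /= ; case: qs => ->; rewrite ?orbT.
  have szlo : (size (cutlo i s A) < size A)%N.
    rewrite size_map size_filter -(count_predC (fun p : bx => p.1 ord0 i < s) A).
    rewrite -[X in (X < _)%N]addn0 ltn_add2l -has_count /=; case: pq.1 => h; rewrite -!leNgt h ?orbT//.
  have szhi : (size (cuthi i s A) < size A)%N.
    rewrite size_map size_filter -(count_predC (fun p : bx => s < p.2 ord0 i) A).
    rewrite -[X in (X < _)%N]addn0 ltn_add2l -has_count /=; case: pq.2 => h; rewrite -!leNgt h ?orbT//.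
  have Slo := total_gt0 (nondeg_cutlo i s An) lo0.
  have Shi := total_gt0 (nondeg_cuthi i s An) hi0.
  have Scut := total_cut i s An.
  have aM : 0 < alpha' ^+ m.+1 by rewrite exprn_gt0.
  have bM : 0 < beta' ^+ m.+1 by rewrite exprn_gt0.
  pose k1 := total (cutlo i s A) / alpha' ^+ m.+1.
  pose k2 := total (cuthi i s A) / alpha' ^+ m.+1.
  have k12 : k1 + k2 = kappa.
    by rewrite /k1 /k2 -mulrDl Scut Aa mulrC mulKf// gt_eqF.
  have k10 : 0 < k1 by rewrite divr_gt0.
  have k20 : 0 < k2 by rewrite divr_gt0.
  have [|r Br] := @cut_fraction i Bs' (beta' ^+ m.+1 * k1) Bn.
    rewrite Bb; apply/andP; split; first by apply: mulr_ge0; exact: ltW.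
    by rewrite ler_pM2l// -k12 lerDl ltW.
  have Bcut := total_cut i r Bn.
  have Br2 : total (cuthi i r Bs') = beta' ^+ m.+1 * k2.
    by move: Bcut; rewrite Br Bb -k12; lra.
  apply: le_trans (volume_split_ge X i (s + r)).
  rewrite -k12 mulrDr EFinD; apply: leeD.
    apply: (IH (cutlo i s A) (cutlo i r Bs')) => //.
    - by apply: leq_trans (sz : (size A + size Bs' <= N)%N); rewrite -addSn leq_add// size_cutlo.
    - exact: nondeg_cutlo. - exact: nondeg_cutlo.
    - exact: separated_cutlo. - exact: separated_cutlo.
    - by rewrite /k1 mulrC divfK// gt_eqF.
    move=> p' q' /cutlo_coord[p0 p0A [e1 e2 e3]] /cutlo_coord[q0 q0B [f1 f2 f3]] x hx.
    split.
      apply: (ABX p0 q0 p0A q0B) => j; have := hx j; rewrite !mxE e1 f1.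
      by have := e2 j; have := f2 j; lra.
    by have := hx i; rewrite /= !mxE; lra.
  apply: (IH (cuthi i s A) (cuthi i r Bs')) => //.
  - by apply: leq_trans (sz : (size A + size Bs' <= N)%N); rewrite -addSn leq_add// size_cuthi.
  - exact: nondeg_cuthi. - exact: nondeg_cuthi.
  - exact: separated_cuthi. - exact: separated_cuthi.
  - by rewrite /k2 mulrC divfK// gt_eqF.
  move=> p' q' /cuthi_coord[p0 p0A [e1 e2 e3]] /cuthi_coord[q0 q0B [f1 f2 f3]] x hx.
  split.
    apply: (ABX p0 q0 p0A q0B) => j; have := hx j; rewrite !mxE e1 f1.
    by have := e2 j; have := f2 j; lra.
  by have := hx i; rewrite /= !mxE; lra.
move=> sz An Bn As_ Bs_ Aa Bb ABX.
have [sA|sA] := ltnP 1 (size As); first exact: step ABX.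
have [sB|sB] := ltnP 1 (size Bs).
  rewrite addrC; apply: (step Bs As) => //; first by rewrite addnC.
  by move=> p q pB qA; rewrite addrC [q in box _ q]addrC; exact: ABX.
case: As sA Aa An ABX {sz As_} => [_|p [|//] _ Aa /= /andP[/forallP pn _] ABX].
  by rewrite /total big_nil => /esym/eqP; rewrite mulf_eq0 expf_eq0 !gt_eqF.
case: Bs sB Bb Bn ABX {Bs_} => [_|q [|//] _ Bb /= /andP[/forallP qn _] ABX].
  by rewrite /total big_nil => /esym/eqP; rewrite mulf_eq0 expf_eq0 !gt_eqF.
have pq := ABX p q (mem_head _ _) (mem_head _ _).
apply: (@le_trans _ _ (volume (box (p.1 + q.1) (p.2 + q.2)))); last exact: (le_outer_measure (@volume R m.+1) _ _ pq).
rewrite volume_box; last by move=> i; rewrite !mxE lerD// ltW.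
rewrite lee_fin /boxvol (eq_bigr (fun i => (p.2 ord0 i - p.1 ord0 i) + (q.2 ord0 i - q.1 ord0 i))); last first.
  by move=> i _; rewrite !mxE; ring.
move: Aa Bb; rewrite /total !big_seq1 => Aa Bb.
by apply: minkowski_prod => // i; rewrite subr_gt0.
Qed.

End boxes.

Section convex.
Context {R : realType}.

Definition cvx n (A : set 'rV[R]_n) := forall x y (t : R), A x -> A y -> 0 <= t <= 1 ->
  A (t *: x + (1 - t) *: y).

(** The ball around [p] is contracted towards [x]: a homothety of ratio less than 1 and centre
    [p] maps a convex set into its interior. *)
Lemma cvx_scale_interior n (A : set 'rV[R]_n) p (rho eta : R) x y :
  cvx A -> (forall y, `|p - y| < rho -> A y) -> 0 <= eta < 1 -> A x ->
  `|(p + eta *: (x - p)) - y| < (1 - eta) * rho -> A y.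
Proof.
move=> cA pA /andP[eta0 eta1] Ax h.
have e0 : 0 < 1 - eta by lra.
pose w := (1 - eta)^-1 *: (y - (p + eta *: (x - p))).
have hw : A (p + w).
  apply: pA; rewrite opprD addrA subrr add0r normrN normrZ gtr0_norm ?invr_gt0//.
  by rewrite mulrC ltr_pdivrMr// mulrC distrC.
have := cA _ _ eta Ax hw; rewrite eta0 (ltW eta1) => /(_ isT).
congr A; rewrite scalerDr /w scalerA mulfV ?gt_eqF// scale1r scalerBr scalerBl scale1r.
apply/rowP => i; rewrite !mxE; ring.
Qed.

Lemma volume_list_le m (I : Type) (s : seq I) (F : I -> set 'rV[R]_m.+1) (X : set 'rV[R]_m.+1) :
  (forall x, X x -> exists2 n, (n < size s)%N & forall i0, F (nth i0 s n) x) ->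
  (volume X <= \sum_(i <- s) volume (F i))%E.
Proof.
elim: s X => [|i s IH] X h.
  rewrite big_nil (_ : X = set0); first by rewrite outer_measure0.
  by apply/seteqP; split=> // x /h[].
rewrite big_cons; apply: (@le_trans _ _ (volume (F i `|` (X `\` F i)))).
  by apply: le_outer_measure => x Xx; have [|] := pselect (F i x); [left|right].
apply: (le_trans (outer_measureU2 (@volume R m.+1) _ _)); apply: leeD2l; apply: IH.
move=> x [/h[[|k] /= ks Fk] nF]; first by have := Fk i.
by exists k.
Qed.

(** The grid cells that meet the homothetic copy of [F] of ratio [eta] are contained in [F] when
    the mesh is small against [(1 - eta) * rho]. *)
Lemma inner_boxes m (F : set 'rV[R]_m.+1) p (rho eta : R) :
  bounded_set F -> cvx F -> 0 < rho -> (forall y, `|p - y| < rho -> F y) -> 0 < eta < 1 ->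
  exists L : seq ('rV[R]_m.+1 * 'rV[R]_m.+1),
    [/\ all nondeg L, pairwise separated L, (forall q, q \in L -> boxset q `<=` F) &
        eta ^+ m.+1 * vol F <= total L].
Proof.
move=> bF cF r0 pF /andP[eta0 eta1].
have /bounded_rVP[B B0 FB] := bF.
have Fp : F p by apply: pF; rewrite subrr normr0.
pose h := (1 - eta) * rho / 2.
have h0 : 0 < h by rewrite divr_gt0// mulr_gt0// subr_gt0.
have hr : h < (1 - eta) * rho.
  have : 0 < (1 - eta) * rho by rewrite mulr_gt0// subr_gt0.
  by rewrite /h; lra.
pose N := (Num.truncn ((B + B) / h)).+1.
have HN : B + B < N%:R * h.
  rewrite -ltr_pdivrMr//; have q0 : 0 <= (B + B) / h.
    by rewrite divr_ge0// ?addr_ge0// ltW.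
  by have /andP[_] := truncn_itv q0.
pose a (k : {ffun 'I_m.+1 -> 'I_N}) : 'rV[R]_m.+1 := \row_i (- B + (k i)%:R * h).
pose cell k := (a k, a k + const_mx h).
pose L := [seq cell k | k <- enum {ffun 'I_m.+1 -> 'I_N} & `[< boxset (cell k) `<=` F >]].
exists L; split.
- apply/allP => _ /mapP[k _ ->]; apply/forallP => i; rewrite /= !mxE; lra.
- rewrite /L pairwise_map; apply: (sub_pairwise (r := [rel x y | x != y])).
    move=> k k' /= kk'; apply/existsP.
    have [i ki] : exists i, k i != k' i.
      apply/existsP; rewrite -negb_forall; apply: contra kk' => /forallP e.
      by apply/eqP/ffunP => i; apply/eqP.
    exists i; rewrite /= !mxE.
    have := ki; rewrite -val_eqE /= neq_ltn => /orP[kl|kl]; apply/orP; [left|right].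
      have : (k i).+1%:R * h <= (k' i)%:R * h by rewrite ler_pM2r// ler_nat.
      by rewrite -natr1; lra.
    have : (k' i).+1%:R * h <= (k i)%:R * h by rewrite ler_pM2r// ler_nat.
    by rewrite -natr1; lra.
  by rewrite -uniq_pairwise filter_uniq// enum_uniq.
- by move=> q /mapP[k]; rewrite mem_filter => /andP[/asboolP kF _] ->.
pose F' := [set eta *: x + (p - eta *: p) | x in F].
have F'F : F' `<=` F.
  move=> _ [x Fx <-]; have := cF x p eta Fx Fp; rewrite (ltW eta0) (ltW eta1) => /(_ isT).
  by congr F; rewrite scalerBl scale1r.
have bF' : bounded_set F' by exact: sub_bounded bF.
rewrite -(vol_affine (p - eta *: p))// -lee_fin -volE//.
apply: (@le_trans _ _ (\sum_(q <- L) volume (boxset q))%E); last first.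
  rewrite /total -sumEFin le_eqVlt; apply/orP; left; apply/eqP.
  rewrite big_seq [RHS]big_seq; apply: eq_bigr => _ /mapP[k _ ->].
  by rewrite /boxset volume_box// => i; rewrite /= !mxE; lra.
apply: volume_list_le => z F'z.
have zB i : - B <= z ord0 i <= B.
  by rewrite -ler_norml (le_trans (ler_coord_norm _ _))// FB//; exact: F'F.
pose kn i := Num.truncn ((z ord0 i + B) / h).
have knE i : (kn i)%:R * h <= z ord0 i + B < (kn i).+1%:R * h.
  rewrite -ler_pdivlMr// -ltr_pdivrMr//; apply: truncn_itv.
  by apply: divr_ge0; [have := zB i; lra|exact: ltW].
have knN i : (kn i < N)%N.
  rewrite -(ltr_nat R) -(ltr_pM2r h0); have /andP[h1 _] := knE i.
  by apply: (le_lt_trans h1); apply: le_lt_trans HN; have := zB i; lra.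
pose k : {ffun 'I_m.+1 -> 'I_N} := [ffun i => Ordinal (knN i)].
have zk : boxset (cell k) z.
  by move=> i; rewrite !mxE ffunE /=; have := knE i; rewrite -natr1; lra.
have kL : cell k \in L.
  apply/mapP; exists k => //; rewrite mem_filter mem_enum andbT; apply/asboolP => y yk.
  have [x Fx xz] := F'z.
  apply: (@cvx_scale_interior _ F p rho eta x) => //; first by rewrite ltW.
  apply: le_lt_trans hr; apply: norm_rV_leP => [|i]; first exact: ltW.
  have -> : p + eta *: (x - p) = z by rewrite -xz scalerBr addrCA addrA.
  have := zk i; have := yk i; rewrite !mxE ffunE /= ler_norml; lra.
exists (index (cell k) L); first by rewrite index_mem.
by move=> i0; rewrite nth_index.
Qed.

Lemma expr_onem_ge (e : R) k : 0 <= e <= 1 -> 1 - k%:R * e <= (1 - e) ^+ k.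
Proof.
move=> /andP[e0 e1]; elim: k => [|k IH]; first by rewrite mul0r subr0 expr0.
rewrite exprS; apply: (@le_trans _ _ ((1 - e) * (1 - k%:R * e))); last first.
  by rewrite ler_wpM2l// subr_ge0.
rewrite -natr1; have : 0 <= k%:R * e * e by rewrite !mulr_ge0.
lra.
Qed.

(** This removes a homothety of ratio close to 1 from a volume estimate. *)
Lemma le_of_scaled (c v : R) k : 0 <= c ->
  (forall eta, 0 < eta < 1 -> eta ^+ k * c <= v) -> c <= v.
Proof.
move=> c0 h; apply/ler_addgt0Pr => e e0.
pose d := Num.min (1 / 2) (e / (k%:R * c + 1)).
have kc : 0 <= k%:R * c by rewrite mulr_ge0.
have kc1 : 0 < k%:R * c + 1 by lra.
have d0 : 0 < d by rewrite lt_min !divr_gt0.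
have d1 : d <= 1 / 2 by rewrite /d ge_min lexx.
have d2 : d * (k%:R * c + 1) <= e.
  by rewrite -ler_pdivlMr// /d ge_min lexx orbT.
have := h (1 - d); have -> : 0 < 1 - d < 1 by lra.
move=> /(_ isT) h1.
have : (1 - k%:R * d) * c <= (1 - d) ^+ k * c.
  by rewrite ler_wpM2r// expr_onem_ge//; lra.
lra.
Qed.

Lemma brunn_minkowski_interior m (F G X : set 'rV[R]_m.+1) p q (rho : R) (alpha beta : R) :
  bounded_set F -> bounded_set G -> bounded_set X -> cvx F -> cvx G -> 0 < rho ->
  (forall y, `|p - y| < rho -> F y) -> (forall y, `|q - y| < rho -> G y) ->
  (forall x y, F x -> G y -> X (x + y)) ->
  0 < alpha -> 0 < beta -> vol F = alpha ^+ m.+1 -> vol G = beta ^+ m.+1 ->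
  (alpha + beta) ^+ m.+1 <= vol X.
Proof.
move=> bF bG bX cF cG r0 pF qG FGX a0 b0 vF vG.
apply: (@le_of_scaled _ _ m.+1); first by rewrite exprn_ge0// addr_ge0// ltW.
move=> eta /[dup] he /andP[eta0 eta1].
have [As [An As_ AF SA]] := inner_boxes bF cF r0 pF he.
have [Bs [Bn Bs_ BG SB]] := inner_boxes bG cG r0 qG he.
have SA0 : 0 < total As by apply: lt_le_trans SA; rewrite vF mulr_gt0 ?exprn_gt0.
have SB0 : 0 < total Bs by apply: lt_le_trans SB; rewrite vG mulr_gt0 ?exprn_gt0.
have := @brunn_minkowski_boxes R m As Bs (rootr m.+1 (total As)) (rootr m.+1 (total Bs)) 1 X.
rewrite !rootr_gt0// ltr01 !mulr1 !rootrK ?(ltW SA0) ?(ltW SB0)// => /(_ isT isT isT An Bn As_ Bs_ erefl erefl).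
move=> H; have {H} : (((rootr m.+1 (total As) + rootr m.+1 (total Bs)) ^+ m.+1)%:E <= volume X)%E.
  apply: H => s t sA tB x hx.
  have sn := allP An s sA; have tn := allP Bn t tB.
  (* The first summand follows [x - t.1] up to the far corner of its box; the
     second one takes the rest. *)
  pose y : 'rV[R]_m.+1 := \row_i Num.min (s.2 ord0 i) (x ord0 i - t.1 ord0 i).
  have -> : x = y + (x - y) by rewrite addrC subrK.
  apply: FGX; [apply: (AF s sA) | apply: (BG t tB)] => i; have := hx i;
    have /forallP/(_ i) := sn; have /forallP/(_ i) := tn; rewrite !mxE => h1 h2 h3;
    case: (leP (s.2 ord0 i) (x ord0 i - t.1 ord0 i)) => h4; lra.
rewrite volE// lee_fin; apply: le_trans; rewrite -exprMn.
rewrite lerXn2r ?nnegrE ?addr_ge0 ?rootr_ge0 ?mulr_ge0 ?addr_ge0 ?(ltW eta0) ?(ltW a0) ?(ltW b0)//.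
rewrite mulrDr lerD// -(ler_pXn2r (n:=m.+1)) ?nnegrE ?rootr_ge0 ?mulr_ge0 ?(ltW eta0) ?(ltW a0) ?(ltW b0)//.
  by rewrite exprMn rootrK ?(ltW SA0)// -vF.
by rewrite exprMn rootrK ?(ltW SB0)// -vG.
Qed.

End convex.

Section slabs.
Context {R : realType} {m : nat}.
Local Notation V := 'rV[R]_m.+1.

Lemma caratheodory_translate (A : set V) (v : V) : (@volume R m.+1).-caratheodory A ->
  (@volume R m.+1).-caratheodory [set x + v | x in A].
Proof.
move=> mA X; rewrite -[LHS](volume_translate (- v)) mA.
have tr (Y Z : set V) : [set x - v | x in Y] `&` Z = [set x - v | x in Y `&` [set x + v | x in Z]].
  apply/seteqP; split=> [_ [[y Yy <-] Zy]|_ [y [Yy [z Zz zy]] <-]].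
    by exists y => //; split=> //; exists (y - v) => //; rewrite subrK.
  by split; [exists y|rewrite -zy addrK].
rewrite !tr !volume_translate; congr (_ + volume (_ `&` _))%E.
apply/seteqP; split=> [_ [z nz <-] [y Ay] /addIr yz|y ny]; first by apply: nz; rewrite -yz.
by exists (y - v); [move=> Ay; apply: ny; exists (y - v) => //|]; rewrite subrK.
Qed.

(** The translates of the slab piece along [v] by even multiples of its width are disjoint, and
    about [1 / w] of them fit into a fixed box. *)
Lemma slab_volume_le (v : V) (B : R) : 0 < B -> v != 0 -> exists2 C, 0 <= C &
  forall (c w : R) (A : set V), 0 < w -> (@volume R m.+1).-caratheodory A ->
    (forall x, A x -> `|x| <= B) -> (forall x, A x -> c <= dot x v <= c + w) ->
    vol A <= C * w.
Proof.
move=> B0 v0; set vv := dot v v.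
have vv0 : 0 < vv.
  by rewrite lt_neqAle dot_ge0 andbT eq_sym; apply: contra v0 => /eqP/dot_eq0 ->.
pose L := B + `|v|.
have L0 : 0 < L by rewrite ltr_pwDl.
pose Q : set V := box (const_mx (- L)) (const_mx L).
have bQ : bounded_set Q.
  apply/bounded_rVP; exists L => // x h; apply: norm_rV_leP => [|i]; first exact: ltW.
  by have := h i; rewrite !mxE ler_norml.
have Qball x : `|x| <= L -> Q x.
  by move=> xL i; rewrite !mxE -ler_norml (le_trans (ler_coord_norm _ _)).
exists (4 * vol Q / vv) => [|c w A w0 mA AB Ac].
  by rewrite divr_ge0 ?mulr_ge0 ?vol_ge0// ltW.
have bA : bounded_set A by apply/bounded_rVP; exists B.
have AQ : A `<=` Q.
  by move=> x /AB xB; apply: Qball; rewrite (le_trans xB)// lerDl.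
pose q := vv / (2 * w).
have q0 : 0 < q by rewrite divr_gt0// mulr_gt0.
have -> : 4 * vol Q / vv * w = 2 * vol Q / q.
  by rewrite /q; field; rewrite !gt_eqF.
rewrite ler_pdivlMr//.
pose N := Num.truncn q.
have /andP[Nq qN] := truncn_itv (ltW q0).
pose tau := (2 * w / vv) *: v.
pose F (k : nat) : set V := [set x + k%:R *: tau | x in A].
have Fdot k x : F k x -> c + 2 * k%:R * w <= dot x v <= c + 2 * k%:R * w + w.
  move=> [y /Ac yc <-]; rewrite dotDl !dotZl -/vv.
  have -> : k%:R * (2 * w / vv * vv) = 2 * k%:R * w by field; rewrite gt_eqF.
  lra.
have tF : trivIset setT F.
  apply/trivIsetP => i j _ _ ij; apply/seteqP; split=> // x [/Fdot hi /Fdot hj].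
  wlog lij : i j {ij} hi hj / (i < j)%N.
    by move: ij; rewrite neq_ltn => /orP[|] h H; [exact: (H i j)|exact: (H j i)].
  have : i.+1%:R <= j%:R :> R by rewrite ler_nat.
  rewrite -natr1 => h; have : (i%:R + 1) * w <= j%:R * w by rewrite ler_wpM2r// ltW.
  lra.
have mF k : (@volume R m.+1).-caratheodory (F k) by exact: caratheodory_translate.
have FQ k : (k < N)%N -> F k `<=` Q.
  move=> kN _ [x /AB xB <-]; apply: Qball; apply: (le_trans (ler_normD _ _)).
  apply: lerD => //; rewrite /tau scalerA normrZ ger0_norm; last first.
    by rewrite mulr_ge0// divr_ge0 ?mulr_ge0// ltW.
  rewrite ler_piMl// mulrA ler_pdivrMr// mul1r mulrA (mulrC k%:R) -mulrA mulrCA.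
  have : k%:R * (2 * w) <= vv; last lra.
  by rewrite -ler_pdivlMr ?mulr_gt0//; apply: le_trans Nq; rewrite ler_nat ltnW.
have sumF : N%:R * vol A <= vol Q.
  have := caratheodory_additive mF tF N setT.
  rewrite setTI (eq_bigr (fun=> volume A)) => [|k _]; last by rewrite setTI; exact: volume_translate.
  rewrite (volE bA) sumEFin sumr_const card_ord => e.
  by rewrite mulr_natl -lee_fin -e -(volE bQ); apply: le_outer_measure; rewrite -bigcup_mkord => x [k /= kN /FQ]; exact.
have vA := le_vol bQ AQ; have vA0 := vol_ge0 A.
have [q1|q1] := leP 1 q.
  have qN2 : q <= N%:R * 2.
    have : (1 <= N)%N by rewrite -ltnS -(ltr_nat R); exact: le_lt_trans qN.
    by rewrite -(ler_nat R) => N1; move: qN; rewrite -natr1; lra.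
  have : vol A * q <= vol A * (N%:R * 2) by rewrite ler_wpM2l.
  lra.
have : vol A * q <= vol A * 1 by rewrite ler_wpM2l// ltW.
lra.
Qed.

End slabs.

Section continuity_tools.
Context {R : realType} {n : nat}.

Lemma dot_lipschitz (v x y : 'rV[R]_n) :
  `|dot x v - dot y v| <= (n%:R * enorm v) * `|x - y|.
Proof.
rewrite -dotNl -dotDl (le_trans (dot_le_enorm _ _))// mulrAC ler_wpM2r ?enorm_ge0//.
exact: enorm_le_norm.
Qed.

Lemma dot_continuous (v : 'rV[R]_n) : continuous (fun x => dot x v).
Proof.
rewrite /dot; elim: (index_enum _) => [|i s IH].
  by under eq_fun do rewrite big_nil; exact: cst_continuous.
under eq_fun do rewrite big_cons.
move=> x; apply: (@continuousD _ _ _ (fun x : 'rV[R]_n => x ord0 i * v ord0 i)); last exact: IH.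
apply: (@continuousM _ _ (fun x : 'rV[R]_n => x ord0 i)); first exact: coord_continuous.
exact: cst_continuous.
Qed.

Lemma closed_dot_le (v : 'rV[R]_n) s : closed [set x | dot x v <= s].
Proof. by apply: (@closed_comp _ _ _ [set y : R | y <= s]); [move=> x _; exact: dot_continuous|exact: closed_le]. Qed.

Lemma closed_dot_ge (v : 'rV[R]_n) s : closed [set x | s <= dot x v].
Proof. by apply: (@closed_comp _ _ _ [set y : R | s <= y]); [move=> x _; exact: dot_continuous|exact: closed_ge]. Qed.

Lemma closed_dot_eq (v : 'rV[R]_n) s : closed [set x | dot x v = s].
Proof. by apply: (@closed_comp _ _ _ [set y : R | y = s]); [move=> x _; exact: dot_continuous|exact: closed_eq]. Qed.

Lemma closed_box (a b : 'rV[R]_n) : closed (box a b).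
Proof.
rewrite (_ : box a b = \bigcap_i ([set x : 'rV[R]_n | a ord0 i <= x ord0 i] `&` [set x : 'rV[R]_n | x ord0 i <= b ord0 i])).
  apply: closed_bigI => i _; apply: closedI.
    by apply: (@closed_comp _ _ (fun x : 'rV[R]_n => x ord0 i) [set y : R | a ord0 i <= y]); [move=> x _; exact: coord_continuous|exact: closed_ge].
  by apply: (@closed_comp _ _ (fun x : 'rV[R]_n => x ord0 i) [set y : R | y <= b ord0 i]); [move=> x _; exact: coord_continuous|exact: closed_le].
by apply/seteqP; split=> x h => [i _|i]; have := h i; [move=> /andP[]|case=> // -> ->].
Qed.

End continuity_tools.

Section degenerate.
Context {R : realType} {m : nat}.
Local Notation V := 'rV[R]_m.+1.

Lemma dotE (x v : V) : dot x v = (x *m v^T) ord0 ord0.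
Proof. by rewrite mxE; apply: eq_bigr => i _; rewrite mxE. Qed.

Lemma hyperplane_volume0 (A : set V) v c : bounded_set A -> v != 0 ->
  (forall x, A x -> dot x v = c) -> vol A = 0.
Proof.
move=> /[dup] bA /bounded_rVP[B B0 AB] v0 Av.
pose Q : set V := box (const_mx (- B)) (const_mx B) `&` [set x | dot x v = c].
have QB x : Q x -> `|x| <= B.
  move=> [h _]; apply: norm_rV_leP => [|i]; first exact: ltW.
  by have := h i; rewrite !mxE ler_norml.
have bQ : bounded_set Q by apply/bounded_rVP; exists B.
have AQ : A `<=` Q.
  move=> x Ax; split; last exact: Av.
  by move=> i; rewrite !mxE -ler_norml (le_trans (ler_coord_norm _ _))// AB.
have mQ : (@volume R m.+1).-caratheodory Q.
  by apply: caratheodory_closed; apply: closedI; [exact: closed_box|exact: closed_dot_eq].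
have [C C0 HC] := @slab_volume_le R m v B B0 v0.
apply/eqP; rewrite eq_le vol_ge0 andbT.
apply/ler_addgt0Pr => e e0; rewrite add0r.
apply: (le_trans (le_vol bQ AQ)).
have w0 : 0 < e / (C + 1) by rewrite divr_gt0// ltr_wpDl.
apply: (le_trans (HC c (e / (C + 1)) Q w0 mQ QB _)) => [x [_ ->]|].
  by rewrite lexx/= lerDl ltW.
rewrite mulrA ler_pdivrMr ?ltr_wpDl//.
have : 0 <= C * e by rewrite mulr_ge0// ltW.
lra.
Qed.

(** A convex combination in which the missing weight goes to [a0]. *)
Lemma cvx_sum (A : set V) (a0 : V) (I : eqType) (s : seq I) (w : I -> R) (r : I -> V) :
  cvx A -> A a0 -> (forall i, A (a0 + r i)) -> (forall i, 0 <= w i) ->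
  \sum_(i <- s) w i <= 1 -> A (a0 + \sum_(i <- s) w i *: r i).
Proof.
move=> cA Aa Ar; elim: s w => [|i s IH] w w0; first by rewrite !big_nil addr0.
rewrite !big_cons => h.
have S0 (w' : I -> R) : (forall i, 0 <= w' i) -> 0 <= \sum_(j <- s) w' j by move=> ?; exact: sumr_ge0.
have Sw := S0 w w0.
have [w1|w1] := ltP (w i) 1.
  have e0 : 0 < 1 - w i by lra.
  pose w' j := (1 - w i)^-1 * w j.
  have := IH w'; have w'0 j : 0 <= w' j by rewrite mulr_ge0 ?invr_ge0// ltW.
  move=> /(_ w'0); rewrite -mulr_sumr mulrC ler_pdivrMr// mul1r lerBrDl => /(_ h) Arest.
  have := cA _ _ (w i) (Ar i) Arest; rewrite w0 (ltW w1) => /(_ isT).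
  have -> : \sum_(j <- s) w' j *: r j = (1 - w i)^-1 *: \sum_(j <- s) w j *: r j.
    by rewrite scaler_sumr; apply: eq_bigr => j _; rewrite scalerA.
  congr A; rewrite !scalerDr scalerA mulfV ?gt_eqF// scale1r scalerBl scale1r.
  by rewrite addrACA subrKC addrA.
have S1 : \sum_(j <- s) w j = 0 by lra.
have wi1 : w i = 1 by lra.
rewrite wi1 scale1r [X in _ + (_ + X)](_ : _ = 0) ?addr0//.
move: S1 => /eqP; rewrite psumr_eq0// => /allP hs.
by rewrite big_seq big1// => j /hs /= /eqP ->; rewrite scale0r.
Qed.

(** Choose a maximal free family of vectors leading from [a0] to points of [A]. If it is a
    basis, then [A] contains a simplex, and a ball around the point [p] with equal barycentric
    coordinates; otherwise [A] is contained in the translate of a proper subspace. *)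
Lemma cvx_interior_or_flat (A : set V) : bounded_set A -> cvx A -> A !=set0 ->
  (exists p rho, 0 < rho /\ forall y, `|p - y| < rho -> A y) \/
  (exists v c, v != 0 /\ forall x, A x -> dot x v = c).
Proof.
move=> bA cA [a0 Aa0].
pose P k := `[< exists M : 'M[R]_(k, m.+1), row_free M /\ forall i, A (a0 + row i M) >].
have P0 : exists k, P k.
  exists 0%N; apply/asboolP; exists 0; split=> [|[]//].
  by rewrite /row_free mxrank0.
have Pm k : P k -> (k <= m.+1)%N.
  by move=> /asboolP[M [/eqP Mr _]]; have := rank_leq_col M; rewrite Mr.
case: (ex_maxnP P0 Pm) => k /asboolP[M [Mf MA]] kmax.
have := Pm k; rewrite leq_eqVlt => /(_ (asboolT (ex_intro _ M (conj Mf MA)))) /orP[/eqP km|km].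
  left; subst k.
  have Mu : M \in unitmx by rewrite -row_free_unit.
  pose d : R := m.+1%:R.
  have d0 : 0 < d by rewrite ltr0n.
  pose l0 := (d + 1)^-1.
  have l00 : 0 < l0 by rewrite invr_gt0 ltr_wpDl// ltW.
  pose K := `|invmx M|.
  pose rho := l0 / (d * d * (K + 1)).
  have K0 : 0 <= K := normr_ge0 _.
  have K1 : 0 < K + 1 by rewrite ltr_wpDl.
  have dd : 0 < d * d * (K + 1) by rewrite !mulr_gt0.
  have rho0 : 0 < rho by rewrite divr_gt0.
  pose p := a0 + \sum_i l0 *: row i M.
  exists p, rho; split=> // y py.
  pose e := (y - p) *m invmx M.
  have eb i : `|e ord0 i| <= l0 / d.
    rewrite mxE; apply: (le_trans (ler_norm_sum _ _ _)).
    apply: (@le_trans _ _ (\sum_(j < m.+1) rho * (K + 1))).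
      apply: ler_sum => j _; rewrite normrM; apply: ler_pM => //.
        by apply: (le_trans (ler_coord_norm _ _)); rewrite distrC ltW.
      apply: (@le_trans _ _ K); last by rewrite lerDl.
      by rewrite /K [leRHS]/Num.norm/= mx_normrE; apply: (le_bigmax _ _ (j, i)).
    rewrite sumr_const card_ord -mulr_natr -/d le_eqVlt; apply/orP; left; apply/eqP.
    by rewrite /rho; field; rewrite !gt_eqF.
  have -> : y = a0 + \sum_i (l0 + e ord0 i) *: row i M.
    under eq_bigr do rewrite scalerDl.
    rewrite big_split /= addrA -/p -mulmx_sum_row /e mulmxKV//.
    by rewrite addrC subrK.
  apply: cvx_sum => // [i|].
    have := eb i; rewrite ler_norml => /andP[h _].
    have : l0 / d <= l0 by rewrite ler_pdivrMr// ler_peMr ?(ltW l00)// ler1n.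
    by move=> h'; rewrite -lerBlDl sub0r (le_trans _ h)// lerN2.
  rewrite big_split /= sumr_const card_ord -mulr_natl -/d.
  have : \sum_i e ord0 i <= l0.
    apply: (@le_trans _ _ (\sum_(i < m.+1) l0 / d)).
      by apply: ler_sum => i _; have := eb i; rewrite ler_norml => /andP[].
    by rewrite sumr_const card_ord -[leLHS]mulr_natl -/d mulrCA divff ?gt_eqF// mulr1.
  have : d * l0 + l0 = 1 by rewrite /l0 -[X in _ + X]mul1r -mulrDl divff// gt_eqF// ltr_wpDl// ltW.
  lra.
right.
have : kermx M^T != 0.
  rewrite kermx_eq0 /row_free mxrank_tr (eqP Mf).
  by rewrite ltn_eqF.
move=> /rowV0Pn[v /sub_kermxP vM v0].
exists v, (dot a0 v); split=> // x Ax; apply/eqP; rewrite -subr_eq0 -dotNl -dotDl.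
apply: contraT => xv.
have Mv : M *m v^T = 0 by apply: trmx_inj; rewrite trmx_mul trmxK vM trmx0.
have nsub : ~~ ((x - a0) <= M)%MS.
  apply: contra xv => /submxP[D ->]; rewrite dotE -mulmxA Mv mulmx0 mxE //.
have Pk : P (k + 1)%N.
  apply/asboolP; exists (col_mx M (x - a0)); split.
    rewrite /row_free eqn_leq rank_leq_row /=.
    suff : (\rank M < \rank (col_mx M (x - a0)))%N.
      by rewrite (eqP Mf) => h; apply: leq_trans h; rewrite addn1.
    apply: rank_ltmx; rewrite /ltmx; apply/andP; split.
      by rewrite -addsmxE addsmxSl.
    apply: contra nsub; apply: submx_trans.
    by rewrite -addsmxE addsmxSr.
  move=> i; case: (split_ordP i) => j ->; rewrite ?rowKu ?rowKd//.
  by rewrite row_id addrC subrK.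
by have := kmax _ Pk; rewrite addn1 ltnn.
Qed.

Lemma cvx_vol_gt0_interior (A : set V) : bounded_set A -> cvx A -> 0 < vol A ->
  exists p rho, 0 < rho /\ forall y, `|p - y| < rho -> A y.
Proof.
move=> bA cA vA; have [|[x Ax]] : A = set0 \/ A !=set0.
  by have [/eqP|/set0P] := boolP (A == set0); [left|right].
  by move=> A0; move: vA; rewrite A0 /vol outer_measure0 ltxx.
have := cvx_interior_or_flat bA cA (ex_intro _ x Ax); case=> // -[v [c [v0 Av]]].
by move: vA; rewrite (hyperplane_volume0 bA v0 Av) ltxx.
Qed.

Lemma rootr0 k : rootr k.+1 (0 : R) = 0.
Proof. by rewrite /rootr powR0// invr_eq0 pnatr_eq0. Qed.

(** If one of the sets has volume zero, [X] contains a translate of the other one; if not, both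
    have interior points and can be exhausted by boxes. *)
Lemma brunn_minkowski (F G X : set V) :
  bounded_set F -> bounded_set G -> bounded_set X -> cvx F -> cvx G ->
  F !=set0 -> G !=set0 -> (forall x y, F x -> G y -> X (x + y)) ->
  (rootr m.+1 (vol F) + rootr m.+1 (vol G)) ^+ m.+1 <= vol X.
Proof.
move=> bF bG bX cF cG [x0 Fx0] [y0 Gy0] FGX.
have := vol_ge0 F; rewrite le_eqVlt => /orP[/eqP F0|F0].
  rewrite -F0 rootr0 add0r rootrK ?vol_ge0// -(vol_translate x0); apply: le_vol => //.
  by move=> _ [y Gy <-]; rewrite addrC; exact: FGX.
have := vol_ge0 G; rewrite le_eqVlt => /orP[/eqP G0|G0].
  rewrite -G0 rootr0 addr0 rootrK ?vol_ge0// -(vol_translate y0); apply: le_vol => //.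
  by move=> _ [y Fy <-]; exact: FGX.
have [p [r1 [r10 pF]]] := cvx_vol_gt0_interior bF cF F0.
have [q [r2 [r20 qG]]] := cvx_vol_gt0_interior bG cG G0.
apply: (@brunn_minkowski_interior _ _ F G X p q (Num.min r1 r2)); rewrite ?rootr_gt0 ?rootrK ?vol_ge0//.
- by rewrite lt_min r10.
- by move=> y; rewrite lt_min => /andP[h _]; exact: pF.
- by move=> y; rewrite lt_min => /andP[_ h]; exact: qG.
Qed.

End degenerate.

(** * Quantiles of convex sets in a given direction *)
Section telescoping.
Context {R : realType}.

(** Applied at [rho] with step [d], the third hypothesis bounds the increment of [r] by the next
    increment of [s] up to an error quadratic in [d], by the Lipschitz bounds of the first one.
    The sum of the errors over a subdivision of [a, b] is therefore linear in the mesh. *)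
Lemma telescoping_compare (A : R) (s r : R -> R) :
  (forall e, 0 < e -> exists2 L, 0 <= L & forall x y, e <= x -> x <= y -> y <= A - e ->
     s y - s x <= L * (y - x) /\ r y - r x <= L * (y - x)) ->
  (forall x y, 0 < x -> x <= y -> y < A -> r x <= r y) ->
  (forall rho d, 0 < d -> 0 < rho - 2 * d -> rho + d < A ->
     s (rho - 2 * d ^+ 2 / rho) + r (rho - 2 * d ^+ 2 / rho) <= s (rho + d) + r (rho - d)) ->
  forall a b, 0 < a -> a < b -> b < A -> r b - r a <= s b - s a.
Proof.
move=> lip rmono step a b a0 ab bA.
pose e := Num.min a (A - b) / 2.
have e0 : 0 < e by rewrite divr_gt0// lt_min a0 subr_gt0.
have ea : 2 * e <= a.
  have : Num.min a (A - b) <= a by rewrite ge_min lexx.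
  by rewrite /e; lra.
have eb : b <= A - 2 * e.
  have : Num.min a (A - b) <= A - b by rewrite ge_min lexx orbT.
  by rewrite /e; lra.
have [L L0 HL] := lip e e0.
pose K := 2 * L * (2 / e).
have K0 : 0 <= K by rewrite !mulr_ge0// invr_ge0 ltW.
have ab0 : 0 < b - a by rewrite subr_gt0.
have one rho d : 0 < d -> 2 * d <= e -> a <= rho -> rho + d <= b ->
    r rho - r (rho - d) <= s (rho + d) - s rho + K * d ^+ 2.
  move=> d0 de ar rb.
  have r0 : 0 < rho by lra.
  set q := 2 * d ^+ 2 / rho.
  have q0 : 0 <= q by rewrite divr_ge0 ?mulr_ge0 ?sqr_ge0// ltW.
  have qd : q <= d.
    rewrite ler_pdivrMr// expr2 mulrCA ler_pM2l//; lra.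
  have qe : q <= 2 / e * d ^+ 2.
    rewrite /q mulrAC ler_wpM2r ?sqr_ge0// ler_wpM2l// lef_pV2 ?posrE//; lra.
  have st : s (rho - q) + r (rho - q) <= s (rho + d) + r (rho - d) by apply: step => //; lra.
  have [h1 h2] : s rho - s (rho - q) <= L * (rho - (rho - q)) /\ r rho - r (rho - q) <= L * (rho - (rho - q)).
    by apply: HL; lra.
  have h3 : L * q <= L * (2 / e * d ^+ 2) by rewrite ler_wpM2l.
  have -> : K * d ^+ 2 = 2 * (L * (2 / e * d ^+ 2)) by rewrite /K; ring.
  have e1 : rho - (rho - q) = q by ring.
  rewrite e1 in h1 h2; lra.
apply/ler_addgt0Pr => eta eta0.
pose C := L + K * (b - a).
have C0 : 0 <= C by rewrite addr_ge0// mulr_ge0// ltW.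
pose d0 := Num.min (e / 2) (eta / (C + 1)).
have C1 : 0 < C + 1 by rewrite ltr_wpDl.
have d00 : 0 < d0 by rewrite lt_min; apply/andP; split; exact: divr_gt0.
pose N := (Num.truncn ((b - a) / d0)).+1.
have Npos : (0 : R) < N%:R by rewrite ltr0n.
pose d := (b - a) / N%:R.
have dpos : 0 < d by rewrite divr_gt0.
have q0 : 0 <= (b - a) / d0 by rewrite divr_ge0// ltW.
have dd0 : d <= d0.
  have /andP[_ /ltW h] := truncn_itv q0.
  by rewrite ler_pdivrMr// mulrC -ler_pdivrMr.
have de : 2 * d <= e.
  have : d0 <= e / 2 by rewrite /d0 ge_min lexx.
  lra.
have deta : d * (C + 1) <= eta.
  have : d0 <= eta / (C + 1) by rewrite /d0 ge_min lexx orbT.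
  by rewrite -ler_pdivlMr//; exact: le_trans.
have Nd : N%:R * d = b - a by rewrite /d mulrC divfK// gt_eqF.
have sum k : (k <= N)%N -> r (a + k%:R * d - d) - r (a - d) <=
    s (a + k%:R * d) - s a + k%:R * (K * d ^+ 2).
  elim: k => [_|k IH kN]; first by rewrite !mul0r !addr0 !subrr.
  have kN' : k.+1%:R * d <= N%:R * d by rewrite ler_pM2r// ler_nat.
  have k0 : 0 <= k%:R * d by rewrite mulr_ge0// ltW.
  have e1 : a + k.+1%:R * d - d = a + k%:R * d by rewrite -natr1; ring.
  have e2 : a + k.+1%:R * d = a + k%:R * d + d by rewrite -natr1; ring.
  have e3 : k.+1%:R * (K * d ^+ 2) = k%:R * (K * d ^+ 2) + K * d ^+ 2 by rewrite -natr1; ring.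
  have := one (a + k%:R * d) d dpos de; rewrite lerDl k0 => /(_ isT).
  rewrite -e2 => /(_ ltac:(lra)) h1; have h2 := IH (ltnW kN).
  by rewrite e1 e3; lra.
have := sum N (leqnn N); rewrite Nd [a + (b - a)]addrC subrK.
have -> : N%:R * (K * d ^+ 2) = K * (b - a) * d by rewrite -Nd; ring.
have rm : r (a - d) <= r a by apply: rmono; lra.
have [_ rl] : s b - s (b - d) <= L * (b - (b - d)) /\ r b - r (b - d) <= L * (b - (b - d)) by apply: HL; lra.
have e1 : b - (b - d) = d by ring.
rewrite e1 in rl.
have : d * (C + 1) = L * d + K * (b - a) * d + d by rewrite /C; ring.
lra.
Qed.

End telescoping.

Section power_inequalities.
Context {R : realType}.

(** The geometric mean lies in between. The harmonic mean is rational in the volumes, which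
    makes the error terms for the quantiles explicit. *)
Lemma harmonic_le_mean_pow k (a b : R) : 0 <= a -> 0 <= b -> 0 < a ^+ k + b ^+ k ->
  2 * a ^+ k * b ^+ k / (a ^+ k + b ^+ k) <= ((a + b) / 2) ^+ k.
Proof.
move=> a0 b0 s0; have ak : 0 <= a ^+ k by rewrite exprn_ge0.
have bk : 0 <= b ^+ k by rewrite exprn_ge0.
have m0 : 0 <= (a + b) / 2 by rewrite divr_ge0// addr_ge0.
rewrite -(@ler_pXn2r _ 2) ?nnegrE ?exprn_ge0//; last first.
  by apply: divr_ge0; [rewrite !mulr_ge0|exact: ltW].
apply: (@le_trans _ _ (a ^+ k * b ^+ k)).
  rewrite exprMn exprVn ler_pdivrMr ?exprn_gt0// -subr_ge0.
  have : 0 <= a ^+ k * b ^+ k * (a ^+ k - b ^+ k) ^+ 2.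
    by rewrite mulr_ge0 ?sqr_ge0// mulr_ge0.
  by move=> /le_trans; apply; rewrite le_eqVlt; apply/orP; left; apply/eqP; ring.
rewrite -exprMn exprAC; apply: lerXn2r; rewrite ?nnegrE; [exact: mulr_ge0|exact: sqr_ge0|rewrite -subr_ge0].
have : 0 <= (a - b) ^+ 2 / 4 by rewrite divr_ge0// sqr_ge0.
by move=> /le_trans; apply; rewrite le_eqVlt; apply/orP; left; apply/eqP; field.
Qed.

Lemma rootr_le k (x y : R) : 0 <= x -> x <= y -> rootr k x <= rootr k y.
Proof. by move=> x0 xy; rewrite /rootr ge0_ler_powR// ?nnegrE// ?invr_ge0// (le_trans x0). Qed.

(** The power function grows from [q] at least as fast as its tangent; the rate is bounded below
    in terms of [a] and [eps]. *)
Lemma convex_pow_gap m (a q eps t : R) : 0 <= q -> q <= a -> 0 < eps ->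
  eps <= q ^+ m.+1 -> eps <= a ^+ m.+1 - q ^+ m.+1 -> 0 <= t ->
  q ^+ m.+1 + t * (eps / (m.+1%:R * (a + 1) ^+ m) * rootr m.+1 eps ^+ m) <=
  ((1 - t) * q + t * a) ^+ m.+1.
Proof.
move=> q0 qa e0 eq ea t0.
have a0 : 0 <= a by exact: le_trans qa.
have a10 : 0 <= a + 1 by rewrite addr_ge0.
have den : 0 < m.+1%:R * (a + 1) ^+ m by rewrite mulr_gt0 ?ltr0n// exprn_gt0// ltr_wpDl.
have aq : eps / (m.+1%:R * (a + 1) ^+ m) <= a - q.
  rewrite ler_pdivrMr//; apply: (le_trans ea).
  rewrite subrXX ler_wpM2l ?subr_ge0//.
  apply: (@le_trans _ _ (\sum_(i < m.+1) (a + 1) ^+ m)); last first.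
    by rewrite sumr_const card_ord -[leLHS]mulr_natl.
  apply: ler_sum => i _.
  have im : (i <= m)%N by rewrite -ltnS.
  rewrite /= -[X in _ <= _ ^+ X](subnK im) exprD; apply: ler_pM; rewrite ?exprn_ge0//.
    by rewrite lerXn2r ?nnegrE// lerDl.
  by rewrite lerXn2r ?nnegrE// (le_trans qa)// lerDl.
set e := rootr m.+1 eps; have ee : 0 <= e := rootr_ge0 _ _.
have eqm : e ^+ m <= q ^+ m.
  rewrite lerXn2r ?nnegrE// -(@ler_pXn2r _ m.+1) ?nnegrE//.
  by rewrite rootrK// ltW.
have h0 : 0 <= t * (a - q) by rewrite mulr_ge0 ?subr_ge0.
have -> : (1 - t) * q + t * a = q + t * (a - q) by ring.
rewrite !exprS; apply: (@le_trans _ _ ((q + t * (a - q)) * q ^+ m)); last first.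
  by rewrite ler_wpM2l ?addr_ge0// lerXn2r ?nnegrE ?addr_ge0// lerDl.
rewrite mulrDl lerD2l -[leRHS]mulrA ler_wpM2l//.
by apply: ler_pM => //; rewrite ?exprn_ge0// divr_ge0// ltW.
Qed.

End power_inequalities.

Opaque vol rootr.

Section cuts.
Context {R : realType} {m : nat}.
Local Notation V := 'rV[R]_m.+1.
Implicit Types (A F G : set V) (v : V) (s : R).

Definition lo A v s := A `&` [set x | dot x v <= s].
Definition hi A v s := A `&` [set x | s <= dot x v].

Lemma lo_sub A v s : lo A v s `<=` A. Proof. by move=> x []. Qed.
Lemma hi_sub A v s : hi A v s `<=` A. Proof. by move=> x []. Qed.

Lemma bounded_lo A v s : bounded_set A -> bounded_set (lo A v s).
Proof. by apply: sub_bounded; exact: lo_sub. Qed.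

Lemma bounded_hi A v s : bounded_set A -> bounded_set (hi A v s).
Proof. by apply: sub_bounded; exact: hi_sub. Qed.

Lemma cvx_lo A v s : cvx A -> cvx (lo A v s).
Proof.
move=> cA x y t [Ax xs] [Ay ys] t01; split; first exact: cA.
rewrite /= dotDl !dotZl; move: t01 xs ys => /andP[t0 t1] /= xs ys.
have h1 : t * dot x v <= t * s by rewrite ler_wpM2l.
have h2 : (1 - t) * dot y v <= (1 - t) * s by rewrite ler_wpM2l// subr_ge0.
lra.
Qed.

Lemma hi_lo A v s : hi A v s = lo A (- v) (- s).
Proof. by apply/seteqP; split=> x [Ax /= h]; split=> //=; move: h; rewrite dotNr lerN2. Qed.

Lemma cvx_hi A v s : cvx A -> cvx (hi A v s).
Proof. by rewrite hi_lo; exact: cvx_lo. Qed.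

Lemma vol_setU_le A F G : bounded_set F -> bounded_set G -> A `<=` F `|` G ->
  vol A <= vol F + vol G.
Proof.
move=> bF bG AFG.
have bFG : bounded_set (F `|` G).
  move/bounded_rVP: bF => [M M0 hM]; move/bounded_rVP: bG => [N N0 hN].
  apply/bounded_rVP; exists (Num.max M N); first by rewrite lt_max M0.
  by move=> x [/hM|/hN] h; rewrite le_max h ?orbT.
apply: (le_trans (le_vol bFG AFG)).
by rewrite -lee_fin EFinD -!volE//; exact: outer_measureU2.
Qed.

Lemma vol_cut A v s : bounded_set A -> v != 0 -> vol (lo A v s) + vol (hi A v s) = vol A.
Proof.
move=> bA v0; rewrite (vol_caratheodory bA (caratheodory_closed (@closed_dot_le R m.+1 v s))).
congr (_ + _); apply/eqP; rewrite eq_le; apply/andP; split.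
  pose H := A `&` [set x | dot x v = s].
  have bH : bounded_set H by apply: sub_bounded bA => x [].
  have H0 : vol H = 0 by apply: (hyperplane_volume0 (v := v) (c := s)) => // x [].
  rewrite -[leRHS]addr0 -H0; apply: vol_setU_le => //.
    by apply: sub_bounded bA => x [].
  move=> x [Ax /= h]; have [e|ne] := eqVneq (dot x v) s; first by right.
  left; split=> //= h2; move: ne; rewrite eq_le h2 h //.
apply: le_vol; first exact: bounded_hi.
by move=> x [Ax /= /negP]; rewrite -ltNge => /ltW h; split.
Qed.

Lemma le_vol_lo A v s s' : bounded_set A -> s <= s' -> vol (lo A v s) <= vol (lo A v s').
Proof.
move=> bA ss; apply: le_vol; first exact: bounded_lo.
by move=> x [Ax /= h]; split=> //=; exact: le_trans ss.
Qed.

Lemma vol_lo_inc A v s s' : bounded_set A -> vol (lo A v s) < vol (lo A v s') -> s < s'.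
Proof. by move=> bA h; rewrite ltNge; apply/negP => /(le_vol_lo v bA); rewrite leNgt h. Qed.

Lemma brunn_minkowski_harmonic F G X : bounded_set F -> bounded_set G -> bounded_set X ->
  cvx F -> cvx G -> (forall x y, F x -> G y -> X (x + y)) -> 0 < vol F -> 0 < vol G ->
  2 ^+ m.+1 * (2 * vol F * vol G / (vol F + vol G)) <= vol X.
Proof.
move=> bF bG bX cF cG FGX F0 G0.
apply: le_trans (brunn_minkowski bF bG bX cF cG (vol_gt0_neq0 F0) (vol_gt0_neq0 G0) FGX).
have aE : rootr m.+1 (vol F) ^+ m.+1 = vol F by rewrite rootrK// ltW.
have bE : rootr m.+1 (vol G) ^+ m.+1 = vol G by rewrite rootrK// ltW.
have FG : 0 < vol F + vol G by rewrite addr_gt0.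
have := @harmonic_le_mean_pow R m.+1 _ _ (rootr_ge0 m.+1 (vol F)) (rootr_ge0 m.+1 (vol G)).
rewrite aE bE => /(_ FG) h.
rewrite [leRHS](_ : _ = 2 ^+ m.+1 * ((rootr m.+1 (vol F) + rootr m.+1 (vol G)) / 2) ^+ m.+1).
  by rewrite ler_pM2l ?exprn_gt0.
by rewrite -exprMn; congr (_ ^+ _); field.
Qed.

Lemma brunn_minkowski_scaled k l F G X : 0 < k -> 0 < l ->
  bounded_set F -> bounded_set G -> bounded_set X -> cvx F -> cvx G -> F !=set0 -> G !=set0 ->
  (forall x y, [set k *: z | z in F] x -> [set l *: z | z in G] y -> X (x + y)) ->
  (k * rootr m.+1 (vol F) + l * rootr m.+1 (vol G)) ^+ m.+1 <= vol X.
Proof.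
move=> k0 l0 bF bG bX cF cG [x0 Fx0] [y0 Gy0] sub.
have scal (Y : set V) s : 0 < s -> bounded_set Y -> bounded_set [set s *: z | z in Y].
  move=> s0 /bounded_rVP[M M0 hM]; apply/bounded_rVP; exists (s * M); first by rewrite mulr_gt0.
  by move=> _ [z Yz <-]; rewrite normrZ gtr0_norm// ler_pM2l// hM.
have scalc (Y : set V) s : cvx Y -> cvx [set s *: z | z in Y].
  move=> cY _ _ t [z Yz <-] [w Yw <-] t01; exists (t *: z + (1 - t) *: w); first exact: cY.
  by rewrite scalerDr !scalerA mulrC (mulrC s).
have scalv (Y : set V) s : 0 < s -> rootr m.+1 (vol [set s *: z | z in Y]) = s * rootr m.+1 (vol Y).
  move=> s0; have -> : vol [set s *: z | z in Y] = s ^+ m.+1 * vol Y.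
    by rewrite -(vol_affine 0)//; congr vol; apply: eq_imagel => z _; rewrite addr0.
  apply: (@pexpIrn _ m.+1) => //; rewrite ?nnegrE ?rootr_ge0//.
    by rewrite mulr_ge0 ?rootr_ge0// ltW.
  rewrite exprMn !rootrK ?vol_ge0// mulr_ge0 ?vol_ge0//.
  by rewrite exprn_ge0// ltW.
rewrite -!scalv//; apply: brunn_minkowski => //; [exact: scal|exact: scal|exact: scalc|exact: scalc| |].
- by exists (k *: x0), x0.
- by exists (l *: y0), y0.
Qed.

(** The bound on the volume of slabs makes the distribution function continuous. *)
Lemma exists_quantile A v t : bounded_set A -> closed A -> v != 0 -> 0 < t < vol A ->
  exists s, vol (lo A v s) = t.
Proof.
move=> /[dup] bA /bounded_rVP[B B0 AB] clA v0 /andP[t0 tA].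
have [C C0 HC] := @slab_volume_le R m v B B0 v0.
pose D := m.+1%:R * enorm v * B.
have D0 : 0 <= D by rewrite !mulr_ge0// ?enorm_ge0// ltW.
have AD x : A x -> - D <= dot x v <= D.
  move=> Ax; rewrite -ler_norml; have := dot_lipschitz v x 0.
  rewrite dot0l !subr0 => h; apply: (le_trans h); rewrite ler_wpM2l ?AB//.
  by rewrite mulr_ge0// enorm_ge0.
pose f s := vol (lo A v s).
have flip x y : x < y -> f y <= f x + C * (y - x).
  move=> xy; pose W := A `&` [set z | x <= dot z v] `&` [set z | dot z v <= y].
  have WA : W `<=` A by move=> z [[]].
  have bW : bounded_set W by exact: sub_bounded WA bA.
  apply: (@le_trans _ _ (f x + vol W)).
    apply: vol_setU_le => //; first exact: bounded_lo.
    move=> z [Az /= zy]; have [zx|xz] := leP (dot z v) x; first by left.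
    by right; split=> //; split=> //=; exact: ltW.
  rewrite lerD2l; apply: (HC x (y - x)).
  - by rewrite subr_gt0.
  - apply: caratheodory_closed; apply: closedI; last exact: closed_dot_le.
    by apply: closedI => //; exact: closed_dot_ge.
  - by move=> z /WA; exact: AB.
  - by move=> z [[_ /= h1] /= h2]; rewrite h1 addrC subrK.
have fc : continuous f.
  move=> x; apply/cvgrPdist_le => e e0.
  have C1 : 0 < C + 1 by rewrite ltr_wpDl.
  near=> y.
  have : `|x - y| <= e / (C + 1).
    near: y; apply: cvgr_dist_le; last by rewrite divr_gt0.
    exact: cvg_id.
  rewrite ler_pdivlMr// => h.
  have : C * `|x - y| <= e.
    have := normr_ge0 (x - y); nra.
  have mono : forall x y, x <= y -> f x <= f y by move=> *; exact: le_vol_lo.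
  have [xy|yx|->] := ltgtP x y; last by rewrite !subrr !normr0 => _; exact: ltW.
    have := flip x y xy; have := mono x y (ltW xy).
    by rewrite (ltr0_norm (_ : x - y < 0)) ?subr_lt0// ler_norml; lra.
  have := flip y x yx; have := mono y x (ltW yx).
  by rewrite (gtr0_norm (_ : 0 < x - y)) ?subr_gt0// ler_norml; lra.
have f1 : f (- D - 1) = 0.
  rewrite /f (_ : lo _ _ _ = set0) ?vol0//.
  by apply/seteqP; split=> // x [/AD /andP[h _] /= h2]; lra.
have f2 : f D = vol A.
  by congr vol; apply/seteqP; split=> [x []//|x Ax]; split=> //=; case/andP: (AD x Ax).
have [|||s _ fs] := @IVT R f (- D - 1) D t; first lra.
- by apply: continuous_subspaceT => x; exact: fc.
- by rewrite f1 f2 ge_min le_max (ltW t0) (ltW tA) orbT.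
by exists s.
Unshelve. all: by end_near. Qed.

Lemma quantile_function A v : bounded_set A -> closed A -> v != 0 ->
  exists s : R -> R, forall t, 0 < t < vol A -> vol (lo A v (s t)) = t.
Proof.
move=> bA clA v0.
have H t : exists s, 0 < t < vol A -> vol (lo A v s) = t.
  have [h|h] := boolP (0 < t < vol A); last by exists 0.
  by have [s hs] := exists_quantile bA clA v0 h; exists s.
by have [s sE] := boolp.choice H; exists s.
Qed.

(** The part of [A] below [y] contains a combination of the part below [x] and of [A] itself,
    with a weight on [A] proportional to [y - x]; by Brunn-Minkowski its volume exceeds that of
    the part below [x] at a definite rate. In other words, quantiles are Lipschitz away from the
    two ends. *)
Lemma vol_lo_expansive A v eps : bounded_set A -> cvx A -> v != 0 -> 0 < eps ->
  exists2 c, 0 < c & forall x y, x <= y -> eps <= vol (lo A v x) ->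
    vol (lo A v y) <= vol A - eps -> c * (y - x) <= vol (lo A v y) - vol (lo A v x).
Proof.
move=> /[dup] bA /bounded_rVP[B B0 AB] cA v0 e0.
pose D := m.+1%:R * enorm v * B + 1.
have D0 : 0 < D by rewrite ltr_wpDl// !mulr_ge0// ?enorm_ge0// ltW.
have AD x : A x -> - D < dot x v < D.
  move=> Ax; rewrite -ltr_norml; have := dot_lipschitz v x 0.
  rewrite dot0l !subr0 => h; apply: (le_lt_trans h); rewrite /D.
  rewrite (@le_lt_trans _ _ (m.+1%:R * enorm v * B))// ?ltrDl// ler_wpM2l ?AB//.
  by rewrite mulr_ge0// enorm_ge0.
pose a := rootr m.+1 (vol A).
pose K := eps / (m.+1%:R * (a + 1) ^+ m) * rootr m.+1 eps ^+ m.
have a0 : 0 <= a := rootr_ge0 _ _.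
have K0 : 0 < K.
  apply: mulr_gt0; last by rewrite exprn_gt0// rootr_gt0.
  by apply: divr_gt0 => //; rewrite mulr_gt0 ?ltr0n// exprn_gt0// ltr_wpDl.
exists (K / (2 * D)); first by apply: divr_gt0 => //; exact: mulr_gt0.
move=> x y; rewrite le_eqVlt => /orP[/eqP<-|xy] ex ye; first by rewrite !subrr mulr0.
have aE : a ^+ m.+1 = vol A by apply: rootrK => //; exact: vol_ge0.
pose q := rootr m.+1 (vol (lo A v x)).
have q0 : 0 <= q := rootr_ge0 _ _.
have qE : q ^+ m.+1 = vol (lo A v x) by apply: rootrK => //; exact: vol_ge0.
have bx := bounded_lo v x bA; have by_ := bounded_lo v y bA.
have px : vol (lo A v x) <= vol (lo A v y) by apply: le_vol_lo => //; exact: ltW.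
have p0 : 0 < vol (lo A v x) by exact: lt_le_trans ex.
have A0 : 0 < vol A by apply: (lt_le_trans p0); apply: le_vol => //; exact: lo_sub.
have xD : - D < x.
  by have [z [/AD /andP[h _] /= h2]] := vol_gt0_neq0 p0; exact: lt_le_trans h2.
have yD : y < D.
  rewrite ltNge; apply/negP => Dy.
  suff /le_trans/(_ ye) : vol A <= vol (lo A v y) by rewrite leNgt gtrBl e0.
  by apply: le_vol => // z Az; split=> //=; case/andP: (AD z Az) => _ /ltW h; exact: le_trans Dy.
have Dx : 0 < D - x by rewrite subr_gt0 (lt_trans xy).
pose t := (y - x) / (D - x).
have t0 : 0 < t by apply: divr_gt0 => //; rewrite subr_gt0.
have t1 : t < 1 by rewrite /t ltr_pdivrMr// mul1r ltrD2r.
have tE : (1 - t) * x + t * D = y by rewrite /t; field; rewrite gt_eqF.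
have t1' : 0 < 1 - t by rewrite subr_gt0.
have bm : ((1 - t) * q + t * a) ^+ m.+1 <= vol (lo A v y).
  have sub z w : [set (1 - t) *: z | z in lo A v x] z -> [set t *: z | z in A] w ->
      lo A v y (z + w).
    move=> [z' [Az /= zx] <-] [w' Aw <-]; split.
      have := cA w' z' t Aw Az; rewrite (ltW t0) (ltW t1) => /(_ isT).
      by rewrite addrC.
    rewrite /= dotDl !dotZl -tE; have /andP[_ /ltW wD] := AD w' Aw.
    by apply: lerD; rewrite ler_pM2l.
  have := brunn_minkowski_scaled t1' t0 bx bA by_ (cvx_lo cA) cA (vol_gt0_neq0 p0) (vol_gt0_neq0 A0) sub.
  by rewrite -/q -/a.
have qa : q <= a.
  by apply: rootr_le; [exact: vol_ge0|apply: le_vol => //; exact: lo_sub].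
rewrite lerBrDl; apply: le_trans bm; rewrite -qE.
apply: le_trans (@convex_pow_gap R m a q eps t q0 qa e0 _ _ (ltW t0)); last 2 first.
- by rewrite qE.
- by rewrite aE qE lerBrDl -lerBrDr (le_trans px).
rewrite lerD2l -/K.
have -> : K / (2 * D) * (y - x) = (y - x) / (2 * D) * K by ring.
apply: ler_wpM2r; first exact: ltW.
apply: ler_wpM2l; first by rewrite subr_ge0 ltW.
rewrite lef_pV2 ?posrE; [|exact: mulr_gt0|exact: Dx].
by rewrite mulrDl !mul1r lerD2l lerNl ltW.
Qed.

End cuts.

Section quantiles.
Context {R : realType} {m : nat}.
Local Notation V := 'rV[R]_m.+1.
Implicit Types (F G X : set V) (v : V).

Lemma quantile_inj F v s s' t : bounded_set F -> cvx F -> v != 0 -> 0 < t < vol F ->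
  vol (lo F v s) = t -> vol (lo F v s') = t -> s = s'.
Proof.
move=> bF cF v0 /andP[t0 tF].
wlog ss' : s s' / s <= s'.
  move=> H h h'; have [/H|/ltW/H] := leP s s'; first exact.
  by move=> /(_ h' h).
move=> h h'; pose e := Num.min t (vol F - t).
have e0 : 0 < e by rewrite lt_min t0 subr_gt0.
have [c c0 Hc] := vol_lo_expansive bF cF v0 e0.
have et : e <= t by rewrite /e ge_min lexx.
have et' : e <= vol F - t by rewrite /e ge_min lexx orbT.
have := Hc s s' ss'; rewrite h h' subrr => /(_ et).
have -> : t <= vol F - e by move: et'; lra.
move=> /(_ isT); rewrite pmulr_rle0// subr_le0 => h2.
by apply/eqP; rewrite eq_le ss' h2.
Qed.

(** With [A] the common volume and q = 2 d^2 / rho, the part of [X] below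
    s (rho + d) + r (rho - d) has volume at least 2^(m + 1) times the harmonic mean
    rho - d^2 / rho of rho + d and rho - d, and the part above s (rho - q) + r (rho - q) at
    least 2^(m + 1) (A - rho + q). Together they exceed the volume of [X], so they overlap: the
    second level is the lower one, which is the last hypothesis of [telescoping_compare]. *)
Lemma quantile_growth F G X v (s r : R -> R) :
  bounded_set F -> bounded_set G -> bounded_set X -> cvx F -> cvx G -> v != 0 ->
  (forall x y, F x -> G y -> X (x + y)) -> 0 < vol F -> vol G = vol F ->
  vol X <= 2 ^+ m.+1 * vol F ->
  (forall t, 0 < t < vol F -> vol (lo F v (s t)) = t) ->
  (forall t, 0 < t < vol F -> vol (lo G v (r t)) = t) ->
  forall a b, 0 < a -> a < b -> b < vol F -> r b - r a <= s b - s a.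
Proof.
move=> bF bG bX cF cG v0 FGX A0 GA XA sE rE.
set A := vol F in A0 GA XA sE rE *.
have M0 : (0 : R) < 2 ^+ m.+1 by rewrite exprn_gt0.
apply: (@telescoping_compare R A).
- move=> e e0.
  have [c1 c10 H1] := vol_lo_expansive bF cF v0 e0.
  have [c2 c20 H2] := vol_lo_expansive bG cG v0 e0.
  have c1i : 0 < c1^-1 by rewrite invr_gt0.
  have c2i : 0 < c2^-1 by rewrite invr_gt0.
  exists (c1^-1 + c2^-1); first by rewrite ltW// addr_gt0.
  move=> x y ex xy yA.
  have xt : 0 < x < A by apply/andP; split; lra.
  have yt : 0 < y < A by apply/andP; split; lra.
  have yx : 0 <= y - x by rewrite subr_ge0.
  have L1 : c1^-1 * (y - x) <= (c1^-1 + c2^-1) * (y - x).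
    by rewrite ler_wpM2r// lerDl ltW.
  have L2 : c2^-1 * (y - x) <= (c1^-1 + c2^-1) * (y - x).
    by rewrite ler_wpM2r// lerDr ltW.
  split.
    have [sx|/ltW xs] := leP (s y) (s x).
      have h : 0 <= c1^-1 * (y - x) by rewrite mulr_ge0// ltW.
      by apply: le_trans L1; apply: le_trans h; rewrite subr_le0.
    apply: le_trans L1; rewrite -ler_pdivrMl ?invr_gt0// invrK.
    by have := H1 _ _ xs; rewrite !sE//; exact.
  have [sx|/ltW xs] := leP (r y) (r x).
    have h : 0 <= c2^-1 * (y - x) by rewrite mulr_ge0// ltW.
    by apply: le_trans L2; apply: le_trans h; rewrite subr_le0.
  apply: le_trans L2; rewrite -ler_pdivrMl ?invr_gt0// invrK.
  by have := H2 _ _ xs; rewrite !rE// GA; exact.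
- move=> x y x0 xy yA.
  have xt : 0 < x < A by rewrite x0 (le_lt_trans xy).
  have yt : 0 < y < A by rewrite (lt_le_trans x0).
  move: xy; rewrite le_eqVlt => /orP[/eqP->//|xy].
  by apply/ltW/(@vol_lo_inc R m G v) => //; rewrite !rE.
move=> rho d d0 rd rdA.
have r0 : 0 < rho by lra.
set q := 2 * d ^+ 2 / rho.
have dd : 0 < d ^+ 2 / rho by rewrite divr_gt0// exprn_gt0.
have qE : q = 2 * (d ^+ 2 / rho) by rewrite /q; ring.
have q0 : 0 < rho - q.
  have : q <= d by rewrite ler_pdivrMr// expr2 mulrCA ler_pM2l//; lra.
  by lra.
have lo1 : 2 ^+ m.+1 * (rho - d ^+ 2 / rho) <= vol (lo X v (s (rho + d) + r (rho - d))).
  have t1 : 0 < rho + d < A by apply/andP; split; lra.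
  have t2 : 0 < rho - d < A by apply/andP; split; lra.
  have := @brunn_minkowski_harmonic R m (lo F v (s (rho + d))) (lo G v (r (rho - d)))
    (lo X v (s (rho + d) + r (rho - d))) (bounded_lo _ _ bF) (bounded_lo _ _ bG) (bounded_lo _ _ bX)
    (cvx_lo cF) (cvx_lo cG).
  rewrite sE// rE// => H.
  apply: le_trans (H _ _ _).
  - rewrite ler_pM2l// le_eqVlt; apply/orP; left; apply/eqP; field.
    by rewrite !gt_eqF//; lra.
  - by move=> x y [Fx /= xs] [Gy /= ys]; split; [exact: FGX|rewrite /= dotDl lerD].
  - by lra.
  - by lra.
have t3 : 0 < rho - q < A by apply/andP; split; lra.
have hi1 : 2 ^+ m.+1 * (A - (rho - q)) <= vol (hi X v (s (rho - q) + r (rho - q))).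
  have hF : vol (hi F v (s (rho - q))) = A - (rho - q).
    by have := vol_cut (s (rho - q)) bF v0; rewrite sE// -/A; lra.
  have hG : vol (hi G v (r (rho - q))) = A - (rho - q).
    by have := vol_cut (r (rho - q)) bG v0; rewrite rE// GA; lra.
  have := @brunn_minkowski_harmonic R m (hi F v (s (rho - q))) (hi G v (r (rho - q)))
    (hi X v (s (rho - q) + r (rho - q))) (bounded_hi _ _ bF) (bounded_hi _ _ bG) (bounded_hi _ _ bX)
    (cvx_hi cF) (cvx_hi cG).
  rewrite hF hG => H.
  have w0 : 0 < A - (rho - q) by lra.
  apply: le_trans (H _ w0 w0).
  - rewrite ler_pM2l// le_eqVlt; apply/orP; left; apply/eqP; field.
    by rewrite gt_eqF// addr_gt0.
  - by move=> x y [Fx /= xs] [Gy /= ys]; split; [exact: FGX|rewrite /= dotDl lerD].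
have Xcut := vol_cut (s (rho - q) + r (rho - q)) bX v0.
apply/ltW/(@vol_lo_inc R m X v) => //.
apply: lt_le_trans lo1.
have : 2 ^+ m.+1 * (rho - q) < 2 ^+ m.+1 * (rho - d ^+ 2 / rho).
  by rewrite ltr_pM2l//; lra.
have -> : 2 ^+ m.+1 * (rho - q) = 2 ^+ m.+1 * A - 2 ^+ m.+1 * (A - (rho - q)) by ring.
lra.
Qed.

(** The hypotheses are symmetric in [F] and [G], so that [quantile_growth] applies both ways and
    all increments of the quantiles agree. *)
Lemma quantile_shift F G X v : bounded_set F -> bounded_set G -> bounded_set X ->
  closed F -> closed G -> cvx F -> cvx G -> v != 0 ->
  (forall x y, F x -> G y -> X (x + y)) -> 0 < vol F -> vol G = vol F ->
  vol X <= 2 ^+ m.+1 * vol F ->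
  exists c, forall t s r, 0 < t < vol F -> vol (lo F v s) = t -> vol (lo G v r) = t -> s = r + c.
Proof.
move=> bF bG bX clF clG cF cG v0 FGX A0 GA XA.
have [s sE] := quantile_function bF clF v0.
have [r rE] := quantile_function bG clG v0; rewrite GA in rE.
have GFX x y : G x -> F y -> X (x + y) by move=> Gx Fy; rewrite addrC; exact: FGX.
have incr a b : 0 < a -> a < b -> b < vol F -> s b - s a = r b - r a.
  move=> a0 ab bA; apply/eqP; rewrite eq_le; apply/andP; split; last first.
    exact: (quantile_growth bF bG bX cF cG v0 FGX A0 GA XA sE rE).
  apply: (quantile_growth bG bF bX cG cF v0 GFX); rewrite ?GA//.
pose h := vol F / 2.
have h0 : 0 < h by rewrite divr_gt0.
have hA : h < vol F by rewrite /h ltr_pdivrMr// ltr_pMr// ltr1n.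
exists (s h - r h) => t s' r' tA hs hr.
have -> : s' = s t by apply: (quantile_inj bF cF v0 tA hs (sE t tA)).
have tA' : 0 < t < vol G by rewrite GA.
have -> : r' = r t by apply: (quantile_inj bG cG v0 tA' hr (rE t tA)).
move: tA => /andP[t0 tF].
have [th|ht|->] := ltgtP t h; last by rewrite addrC subrK.
  by have := incr t h t0 th hA; lra.
by have := incr h t h0 ht tF; lra.
Qed.

(** If [x] violated the bound, a small homothetic copy of [F] near [x] would be a part of [F] of
    positive volume above the level [g + c]; the quantiles of [F] in that range would correspond
    to levels of [G] above its maximum [g]. *)
Lemma shift_upper_bound F G v c g : bounded_set F -> bounded_set G -> closed F -> closed G ->
  cvx F -> v != 0 -> 0 < vol F -> vol G = vol F ->
  (forall t s r, 0 < t < vol F -> vol (lo F v s) = t -> vol (lo G v r) = t -> s = r + c) ->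
  (forall y, G y -> dot y v <= g) -> forall x, F x -> dot x v <= g + c.
Proof.
move=> bF bG clF clG cF v0 A0 GA sh Gg x1 Fx1; rewrite leNgt; apply/negP => gx.
pose s0 := (dot x1 v + (g + c)) / 2.
have s0x : s0 < dot x1 v by rewrite /s0; lra.
have gs0 : g + c < s0 by rewrite /s0; lra.
have [B B0 FB] := (bounded_rVP F).1 bF.
pose D := m.+1%:R * enorm v * (B + B) + 1.
have D0 : 0 < D by rewrite ltr_wpDl// !mulr_ge0// ?enorm_ge0// addr_ge0// ltW.
have FD y : F y -> dot x1 v - dot y v <= D.
  move=> Fy; apply: (le_trans (ler_norm _)); apply: (le_trans (dot_lipschitz _ _ _)).
  rewrite /D (@le_trans _ _ (m.+1%:R * enorm v * (B + B)))// ?lerDl// ler_wpM2l//.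
    by rewrite mulr_ge0// enorm_ge0.
  by apply: (le_trans (ler_normB _ _)); apply: lerD; exact: FB.
pose eta := Num.min (1 / 2) ((dot x1 v - s0) / D).
have e0 : 0 < eta by rewrite lt_min; apply/andP; split; apply: divr_gt0 => //; rewrite subr_gt0.
have e1 : eta <= 1 / 2 by rewrite /eta ge_min lexx.
have e2 : eta * D <= dot x1 v - s0 by rewrite -ler_pdivlMr// /eta ge_min lexx orbT.
pose F' := [set eta *: y + (1 - eta) *: x1 | y in F].
have F'hi : F' `<=` hi F v s0.
  move=> _ [y Fy <-]; split.
    by apply: cF => //; apply/andP; split; lra.
  rewrite /= dotDl !dotZl; have := FD y Fy => h.
  have : eta * (dot x1 v - dot y v) <= eta * D by rewrite ler_wpM2l// ltW.
  lra.
have h0 : 0 < vol (hi F v s0).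
  apply: lt_le_trans (le_vol (bounded_hi v s0 bF) F'hi).
  by rewrite vol_affine// mulr_gt0// exprn_gt0.
have cut := vol_cut s0 bF v0.
have lo0 := vol_ge0 (lo F v s0).
pose t := vol F - vol (hi F v s0) / 2.
have tA : 0 < t < vol F by rewrite /t; apply/andP; split; lra.
have [s hs] := exists_quantile bF clF v0 tA.
have [|r hr] := @exists_quantile R m G v t bG clG v0; first by rewrite GA.
have ss : s0 < s by apply: (@vol_lo_inc R m F v) => //; rewrite hs /t; lra.
have sr := sh t s r tA hs hr.
have : vol (lo G v r) = vol G.
  congr vol; apply/seteqP; split=> [y []//|y Gy]; split=> //=.
  by apply: (le_trans (Gg y Gy)); lra.
by rewrite hr GA; move: tA => /andP[_ h1] h2; rewrite h2 ltxx in h1.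
Qed.

End quantiles.

(** * Centroids and equality in the Brunn-Minkowski inequality *)
Section moments.
Context {R : realType} {m : nat}.
Local Notation V := 'rV[R]_m.+1.
Implicit Types (F G : set V) (v : V).

Definition vol_measure (A : set (caratheodory_type (@volume R m.+1))) := volume A.

HB.instance Definition _ := isMeasure.Build _
  (caratheodory_type (@volume R m.+1)) R vol_measure
  (@caratheodory_measure0 _ _ (@volume R m.+1))
  (@caratheodory_measure_ge0 _ _ (@volume R m.+1))
  (@caratheodory_measure_sigma_additive _ _ (@volume R m.+1)).

Local Notation T := (caratheodory_type (@volume R m.+1)).

(** Linear in [v]: it is the scalar product of [v] with the centroid of [F], times the volume. *)
Definition moment F v : R := \int[vol_measure]_(x in (F : set T)) (dot x v).

Let mF F : closed F -> measurable (F : set T).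
Proof. exact: caratheodory_closed. Qed.

Lemma measurable_dot v : measurable_fun [set: T] (fun x : T => dot x v).
Proof.
apply: (@measurability _ _ T (measurableTypeR R) _ _ _ (RGenCInfty.measurableE R)) => //= _ [_ [r ->] <-].
rewrite setTI; apply: mF.
rewrite (_ : _ @^-1` _ = [set x : V | r <= dot x v]); first exact: closed_dot_ge.
by apply/seteqP; split=> x /=; rewrite in_itv/= andbT.
Qed.

Lemma integrable_dot F v : measurable (F : set T) -> bounded_set F ->
  vol_measure.-integrable (F : set T) (EFin \o (fun x : T => dot x v)).
Proof.
move=> mF' bF; apply: measurable_bounded_integrable => //.
- exact: volume_fin.
- by apply: measurable_funS (measurable_dot v).
have [B B0 FB] := (bounded_rVP F).1 bF.
exists (m.+1%:R * enorm v * B); split; first exact: num_real.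
move=> M BM x Fx /=; apply: le_trans (ltW BM).
have := dot_lipschitz v x 0; rewrite dot0l !subr0 => h; apply: (le_trans h).
by rewrite ler_wpM2l ?FB// mulr_ge0// enorm_ge0.
Qed.

Lemma moment_diff_bounds F G v a b : measurable (F : set T) -> measurable (G : set T) ->
  bounded_set G -> F `<=` G -> (forall x, G x -> ~ F x -> a <= dot x v <= b) ->
  a * (vol G - vol F) <= moment G v - moment F v <= b * (vol G - vol F).
Proof.
move=> mF' mG bG FG ab.
have bF : bounded_set F by exact: sub_bounded FG bG.
have mD : measurable (G `\` F : set T) by exact: measurableD.
have bD : bounded_set (G `\` F) by apply: sub_bounded bG => x [].
have GE : F `|` (G `\` F) = G.
  by apply/seteqP; split=> [x [/FG//|[]//]|x Gx]; have [|] := pselect (F x); [left|right].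
have vD : vol G - vol F = vol (G `\` F).
  by rewrite (vol_caratheodory bG mF') (setIidr FG); ring.
have -> : moment G v - moment F v = moment (G `\` F) v.
  rewrite /moment -[in X in X - _]GE Rintegral_setU//; first by ring.
  - by rewrite GE; exact: integrable_dot.
  - by apply/eqP/seteqP; split=> // x [Fx []].
have cst_int (k : R) : vol_measure.-integrable (G `\` F : set T) (EFin \o cst k).
  apply: measurable_bounded_integrable => //; first exact: volume_fin.
  by exists `|k|; split; [exact: num_real|move=> M kM x _ /=; exact: ltW].
have cE (k : R) : k * vol (G `\` F) = \int[vol_measure]_(x in (G `\` F : set T)) (cst k x).
  by rewrite Rintegral_cst.
rewrite vD !cE; apply/andP; split; apply: le_Rintegral => //; try exact: integrable_dot.
- by move=> x [Gx nFx]; case/andP: (ab x Gx nFx).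
- by move=> x [Gx nFx]; case/andP: (ab x Gx nFx).
Qed.

Lemma momentD F v w : measurable (F : set T) -> bounded_set F ->
  moment F (v + w) = moment F v + moment F w.
Proof.
move=> mF' bF; rewrite /moment -RintegralD//; try exact: integrable_dot.
by apply: eq_Rintegral => x _; rewrite dotDr.
Qed.

Lemma momentZ F k v : measurable (F : set T) -> bounded_set F ->
  moment F (k *: v) = k * moment F v.
Proof.
move=> mF' bF; rewrite /moment -RintegralZl//; last exact: integrable_dot.
by apply: eq_Rintegral => x _; rewrite dotZr.
Qed.

Lemma moment_coord F : measurable (F : set T) -> bounded_set F ->
  exists g : V, forall v, moment F v = dot g v.
Proof.
move=> mF' bF; exists (\row_i moment F (delta_mx 0 i)) => v.
rewrite {1}(row_sum_delta v) /dot.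
have m0 : moment F 0 = 0 by rewrite -(scale0r 0) momentZ// mul0r.
rewrite (@big_morph _ _ (moment F) 0 +%R 0 +%R) => [|x y|]//; last exact: momentD.
by apply: eq_bigr => i _; rewrite momentZ// mxE mulrC.
Qed.

Lemma closed_lo F v s : closed F -> closed (lo F v s).
Proof. by move=> cF; apply: closedI => //; exact: closed_dot_le. Qed.

(** Between the quantiles of order [a] and [b], the moments of [F] and of [G] change by amounts
    that differ by [c * (b - a)], up to [b - a] times the difference of the levels. Over a
    subdivision of mesh [d] the errors sum up to at most [d] times the total width. *)
Lemma moment_shift F G v c : bounded_set F -> bounded_set G -> closed F -> closed G ->
  v != 0 -> 0 < vol F -> vol G = vol F ->
  (forall t s r, 0 < t < vol F -> vol (lo F v s) = t -> vol (lo G v r) = t -> s = r + c) ->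
  moment F v = moment G v + c * vol F.
Proof.
move=> bF bG clF clG v0 A0 GA sh.
have [D D0 [FD GD]] : exists2 D, 0 < D &
    (forall x, F x -> - D <= dot x v <= D) /\ (forall x, G x -> - D <= dot x v <= D).
  have [B B0 FB] := (bounded_rVP F).1 bF; have [C C0 GC] := (bounded_rVP G).1 bG.
  have k0 : 0 <= m.+1%:R * enorm v by rewrite mulr_ge0// enorm_ge0.
  exists (m.+1%:R * enorm v * (B + C) + 1).
    by rewrite ltr_wpDl// mulr_ge0// addr_ge0// ltW.
  have key x : `|x| <= B + C -> - (m.+1%:R * enorm v * (B + C) + 1) <= dot x v <= m.+1%:R * enorm v * (B + C) + 1.
    move=> xB; rewrite -ler_norml; have := dot_lipschitz v x 0; rewrite dot0l !subr0 => h.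
    apply: (le_trans h); apply: (@le_trans _ _ (m.+1%:R * enorm v * (B + C))).
      by rewrite ler_wpM2l.
    by rewrite lerDl.
  by split=> x hx; apply: key; [apply: (le_trans (FB x hx)); rewrite lerDl ltW
    | apply: (le_trans (GC x hx)); rewrite lerDr ltW].
set A := vol F in A0 GA sh *.
have [s sE] := quantile_function bF clF v0.
have [r rE] := quantile_function bG clG v0; rewrite GA in rE.
have srE t : 0 < t < A -> s t = r t + c by move=> h; apply: (sh t) => //; [exact: sE|exact: rE].
have sD t : 0 < t < A -> - D <= s t <= D.
  move=> h; have vt := sE t h; apply/andP; split.
    have : lo F v (s t) !=set0.
      by apply/set0P/eqP => e; move: vt h; rewrite e vol0 => <-; rewrite ltxx.
    by move=> [x [Fx /= xs]]; apply: le_trans xs; case/andP: (FD x Fx).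
  rewrite leNgt; apply/negP => Ds; suff : vol (lo F v (s t)) = A.
    by rewrite vt => e; move: h; rewrite e ltxx andbF.
  congr vol; apply/seteqP; split=> [x []//|x Fx]; split=> //=.
  by case/andP: (FD x Fx) => _ h1; apply: (le_trans h1); exact: ltW.
have cmp (a b : R) : 0 < a -> a < b -> b < A ->
    `|(moment (lo F v (s b)) v - moment (lo G v (r b)) v - c * b) -
      (moment (lo F v (s a)) v - moment (lo G v (r a)) v - c * a)| <= (s b - s a) * (b - a).
  move=> a0 ab bA.
  have at_ : 0 < a < A by rewrite a0 (lt_trans ab).
  have bt : 0 < b < A by rewrite bA (lt_trans a0).
  have sab : s a <= s b by apply/ltW/(@vol_lo_inc R m F v) => //; rewrite !sE.
  have rab : r a <= r b by apply/ltW/(@vol_lo_inc R m G v) => //; rewrite !rE.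
  have /andP[h1 h2] : s a * (b - a) <= moment (lo F v (s b)) v - moment (lo F v (s a)) v <= s b * (b - a).
    have := @moment_diff_bounds (lo F v (s a)) (lo F v (s b)) v (s a) (s b).
    rewrite (sE b bt) (sE a at_); apply.
    - exact/mF/closed_lo. - exact/mF/closed_lo. - exact: bounded_lo.
    - by move=> x [Fx /= h]; split=> //=; exact: le_trans sab.
    - move=> x [Fx /= h] n; rewrite h andbT leNgt; apply/negP => h2; apply: n; split=> //=; exact: ltW.
  have /andP[h3 h4] : r a * (b - a) <= moment (lo G v (r b)) v - moment (lo G v (r a)) v <= r b * (b - a).
    have := @moment_diff_bounds (lo G v (r a)) (lo G v (r b)) v (r a) (r b).
    rewrite (rE b bt) (rE a at_); apply.
    - exact/mF/closed_lo. - exact/mF/closed_lo. - exact: bounded_lo.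
    - by move=> x [Gx /= h]; split=> //=; exact: le_trans rab.
    - move=> x [Gx /= h] n; rewrite h andbT leNgt; apply/negP => h2'; apply: n; split=> //=; exact: ltW.
  rewrite (srE a at_) (srE b bt) in h1 h2 *.
  by rewrite ler_norml; apply/andP; split; lra.
apply/eqP; rewrite -subr_eq0 -normr_le0; apply/ler_addgt0Pr => e e0; rewrite add0r.
pose W := 6 * D + 2 * `|c| + 1.
have W0 : 0 < W by rewrite ltr_wpDl// addr_ge0 ?mulr_ge0// ltW.
pose N := (Num.truncn (A * W / e)).+2.
have Npos : (0 : R) < N%:R by rewrite ltr0n.
pose d := A / N%:R.
have d0 : 0 < d by rewrite divr_gt0.
have Nd : N%:R * d = A by rewrite /d mulrC divfK// gt_eqF.
have dW : d * W <= e.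
  have q0 : 0 <= A * W / e by rewrite divr_ge0 ?mulr_ge0// ltW.
  rewrite /d mulrAC ler_pdivrMr// [leRHS]mulrC -ler_pdivrMr//.
  have /andP[_ /ltW h] := truncn_itv q0; apply: (le_trans h).
  by rewrite ler_nat.
pose Delta (t : R) := moment (lo F v (s t)) v - moment (lo G v (r t)) v - c * t.
have kd k : (0 < k)%N -> (k < N)%N -> 0 < k%:R * d < A.
  by move=> k0 kN; rewrite mulr_gt0 ?ltr0n//= -Nd ltr_pM2r// ltr_nat.
have tel k : (k.+1 < N)%N -> `|Delta (k.+1%:R * d) - Delta (1 * d)| <= (s (k.+1%:R * d) - s (1 * d)) * d.
  elim: k => [_|k IH kN]; first by rewrite !subrr normr0 mul0r.
  have -> : Delta (k.+2%:R * d) - Delta (1 * d) =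
      (Delta (k.+2%:R * d) - Delta (k.+1%:R * d)) + (Delta (k.+1%:R * d) - Delta (1 * d)) by ring.
  apply: (le_trans (ler_normD _ _)).
  have h1 := IH (ltnW kN).
  have /andP[k0 _] := kd k.+1 isT (ltnW kN).
  have /andP[_ kA] := kd k.+2 isT kN.
  have kk : k.+1%:R * d < k.+2%:R * d by rewrite ltr_pM2r// ltr_nat.
  have := cmp _ _ k0 kk kA.
  have -> : k.+2%:R * d - k.+1%:R * d = d by rewrite -[k.+2%:R]natr1; ring.
  by rewrite -/(Delta _) -/(Delta _); lra.
have N1 : (N.-2.+1 < N)%N by rewrite /N.
set b := N.-2.+1%:R * d.
have bE : b = A - d by rewrite /b -Nd /N /= -[in RHS]natr1; ring.
have bt : 0 < b < A by apply: kd.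
have at_ : 0 < 1 * d < A by apply: (kd 1%N).
have h1 := tel N.-2 N1; rewrite -/b in h1.
have e1 (H : set V) (q : R -> R) : closed H -> bounded_set H -> vol H = A ->
    (forall x, H x -> - D <= dot x v <= D) -> (forall t, 0 < t < A -> vol (lo H v (q t)) = t) ->
    (- D * d <= moment (lo H v (q (1 * d))) v <= D * d) /\
    (- D * d <= moment H v - moment (lo H v (q b)) v <= D * d).
  move=> clH bH HA HD qE; split.
    have := @moment_diff_bounds set0 (lo H v (q (1 * d))) v (- D) D.
    rewrite vol0 (qE _ at_) mul1r subr0 /moment Rintegral_set0 subr0; apply.
    - exact: measurable0. - exact/mF/closed_lo. - exact: bounded_lo. - exact: sub0set.
    by move=> x [Hx _] _; exact: HD.
  have := @moment_diff_bounds (lo H v (q b)) H v (- D) D.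
  rewrite (qE _ bt) HA bE; have -> : A - (A - d) = d by ring.
  apply; [exact/mF/closed_lo|exact: mF|exact: bH|exact: lo_sub|by move=> x Hx _; exact: HD].
have [/andP[f1 f2] /andP[f3 f4]] := e1 F s clF bF erefl FD sE.
have [/andP[g1 g2] /andP[g3 g4]] := e1 G r clG bG GA GD rE.
have /andP[sb1 sb2] := sD _ bt; have /andP[sa1 sa2] := sD _ at_.
have sd : (s b - s (1 * d)) * d <= (D + D) * d by rewrite ler_wpM2r ?(ltW d0)//; lra.
apply: le_trans dW.
have c1 : c <= `|c| := ler_norm c.
have c2 : - c <= `|c| by rewrite -normrN ler_norm.
have c3 : c * d <= `|c| * d by rewrite ler_wpM2r// ltW.
have c4 : - c * d <= `|c| * d by rewrite ler_wpM2r// ltW.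
move: h1; rewrite /Delta ler_norml => /andP[h1 h2].
have bb : c * b = c * A - c * d by rewrite bE; ring.
rewrite mul1r in h1 h2 f1 f2 g1 g2 sd.
have W1 : d * W = 6 * (D * d) + 2 * (`|c| * d) + d by rewrite /W; ring.
rewrite ler_norml W1; apply/andP; split; lra.
Qed.

End moments.

Section equality.
Context {R : realType} {m : nat}.
Local Notation V := 'rV[R]_m.+1.
Implicit Types (F G X : set V) (v : V).

Let dot_sub_sqr (t : R) (w v : V) :
  dot (t *: w - v) (t *: w - v) = t * (t * dot w w) - 2 * (t * dot w v) + dot v v.
Proof.
by rewrite !(dotDl, dotDr, dotNl, dotNr, dotZl, dotZr) (dotC v w); ring.
Qed.

(** The hyperplane through the point of [G] nearest to [z], orthogonal to the segment between
    them. *)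
Lemma separation G (z : V) : bounded_set G -> closed G -> cvx G -> G !=set0 -> ~ G z ->
  exists v g, [/\ v != 0, (forall y, G y -> dot y v <= g) & g < dot z v].
Proof.
move=> bG clG cG G0 nGz.
have cmp : compact G by exact: bounded_closed_compact.
pose f (y : V) := dot (y - z) (y - z).
have fc : {within G, continuous f}.
  apply: continuous_subspaceT => y.
  rewrite /f /dot; elim: (index_enum _) => [|i s IH].
    by under eq_fun do rewrite big_nil; exact: cst_continuous.
  under eq_fun do rewrite big_cons.
  have h : continuous (fun x : V => (x - z) ord0 i).
    move=> x; under eq_fun do rewrite mxE.
    by apply: continuousD; [exact: coord_continuous|exact: cst_continuous].
  apply: (@continuousD _ _ _ (fun x : V => (x - z) ord0 i * (x - z) ord0 i)); last exact: IH.
  by apply: (@continuousM _ _ (fun x : V => (x - z) ord0 i)); exact: h.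
have [y0 /set_mem Gy0 ymin] := EVT_min_rV G0 cmp fc.
pose v := z - y0.
have v0 : v != 0 by rewrite subr_eq0; apply: contra_notN nGz => /eqP ->.
have vv : 0 < dot v v.
  by rewrite lt_neqAle dot_ge0 andbT eq_sym; apply: contra v0 => /eqP/dot_eq0 ->.
exists v, (dot y0 v); split=> //; last by rewrite -subr_gt0 -dotNl -dotDl.
move=> y Gy; rewrite -subr_le0 -dotNl -dotDl.
set w := y - y0; rewrite leNgt; apply/negP => wv.
have ww := dot_ge0 w.
pose t := Num.min 1 (dot w v / (dot w w + 1)).
have w1 : 0 < dot w w + 1 by rewrite ltr_wpDl.
have t0 : 0 < t by rewrite lt_min ltr01 divr_gt0.
have t1 : t <= 1 by rewrite /t ge_min lexx.
have tw : t * (dot w w + 1) <= dot w v by rewrite -ler_pdivlMr// /t ge_min lexx orbT.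
have Gyt : G (t *: y + (1 - t) *: y0) by apply: cG => //; rewrite (ltW t0).
have := ymin _ (mem_set Gyt); rewrite /f.
have -> : t *: y + (1 - t) *: y0 - z = t *: w - v.
  by rewrite /w /v; apply/rowP => i; rewrite !mxE; ring.
have -> : y0 - z = - v by rewrite /v opprB.
rewrite dotNl dotNr opprK dot_sub_sqr.
have tww : t * (t * dot w w) <= t * dot w v.
  by rewrite ler_pM2l//; apply: le_trans tw; rewrite ler_pM2l// lerDl.
have tv : 0 < t * dot w v by rewrite mulr_gt0.
lra.
Qed.

(** In each direction [v] the quantiles of [F] and [G] differ by a constant. Integration shows
    that it is the difference of the [v]-coordinates of the centroids, that is [dot t v] for one
    vector [t]; so [F] and the translate of [G] by [t] are contained in the same half-spaces. *)
Lemma brunn_minkowski_eq F G X : bounded_set F -> bounded_set G -> bounded_set X ->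
  closed F -> closed G -> cvx F -> cvx G ->
  (forall x y, F x -> G y -> X (x + y)) -> 0 < vol F -> vol G = vol F ->
  vol X <= 2 ^+ m.+1 * vol F ->
  exists t, F = [set y + t | y in G].
Proof.
move=> bF bG bX clF clG cF cG FGX A0 GA XA.
have mF : measurable (F : set (caratheodory_type (@volume R m.+1))).
  exact: caratheodory_closed.
have mG : measurable (G : set (caratheodory_type (@volume R m.+1))).
  exact: caratheodory_closed.
have [gF gFE] := moment_coord mF bF.
have [gG gGE] := moment_coord mG bG.
pose t := (vol F)^-1 *: (gF - gG).
have tE v c : moment F v = moment G v + c * vol F -> c = dot t v.
  rewrite gFE gGE dotZl dotDl dotNl => ->; rewrite addrAC subrr add0r mulrC mulfK//.
  by rewrite gt_eqF.
have GFX x y : G x -> F y -> X (x + y) by move=> Gx Fy; rewrite addrC; exact: FGX.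
have G0 : 0 < vol G by rewrite GA.
have sub v : v != 0 -> exists c, c = dot t v /\
    (forall t s r, 0 < t < vol F -> vol (lo F v s) = t -> vol (lo G v r) = t -> s = r + c).
  move=> v0; have [c hc] := quantile_shift bF bG bX clF clG cF cG v0 FGX A0 GA XA.
  exists c; split=> //; apply: tE; exact: moment_shift.
exists t; apply/seteqP; split=> [x Fx|_ [y Gy <-]].
  exists (x - t); last by rewrite subrK.
  apply: contrapT => nG.
  have [v [g [v0 Gg gx]]] := separation bG clG cG (vol_gt0_neq0 G0) nG.
  have [c [cE hc]] := sub v v0.
  have := shift_upper_bound bF bG clF clG cF v0 A0 GA hc Gg Fx.
  by move: gx; rewrite dotDl dotNl cE; lra.
apply: contrapT => nF.
have [v [g [v0 Fg gx]]] := separation bF clF cF (vol_gt0_neq0 A0) nF.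
have [c [cE hc]] := sub v v0.
have hc' t0 s r : 0 < t0 < vol G -> vol (lo G v s) = t0 -> vol (lo F v r) = t0 -> s = r + - c.
  by rewrite GA => h1 h2 h3; rewrite (hc t0 r s h1 h3 h2) addrK.
have := shift_upper_bound bG bF clG clF cG v0 G0 (esym GA) hc' Fg Gy.
by move: gx; rewrite dotDl cE; lra.
Qed.

End equality.

(** * Frusta *)
Section power_integral.
Context {R : realType}.

Lemma integral_affine_pow (M : nat) (l r alpha beta : R) : l < r ->
  (\int[lebesgue_measure]_(s in `[l, r])
     ((beta + (alpha - beta) / (r - l) * (s - l)) ^+ M)%:E =
   ((r - l) / M.+1%:R * \sum_(i < M.+1) alpha ^+ (M - i) * beta ^+ i)%:E)%E.
Proof.
move=> lr; have rl : 0 < r - l by rewrite subr_gt0.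
set c := (alpha - beta) / (r - l).
have [c0|c0] := eqVneq c 0.
  have ab : alpha = beta.
    by apply/eqP; rewrite -subr_eq0; move/eqP: c0; rewrite mulf_eq0 invr_eq0 (gt_eqF rl) orbF.
  rewrite c0 (eq_integral (fun=> (beta ^+ M)%:E)) => [|s _]; last by rewrite mul0r addr0.
  rewrite integral_cst//= lebesgue_measure_itv/= lte_fin lr -EFinB -EFinM; congr (_%:E).
  rewrite ab (eq_bigr (fun=> beta ^+ M)) => [|i _]; last first.
    by rewrite -exprD subnK// -ltnS.
  by rewrite sumr_const card_ord -[in RHS]mulr_natr; field; rewrite gt_eqF ?ltr0n.
pose q : {poly R} := (beta - c * l)%:P + c *: 'X.
pose p : {poly R} := (M.+1%:R * c)^-1 *: (q ^+ M.+1).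
have M0 : M.+1%:R != 0 :> R by rewrite pnatr_eq0.
have qE s : q.[s] = beta + c * (s - l).
  by rewrite /q hornerD hornerC hornerZ hornerX; ring.
have p'E : p^`() = q ^+ M.
  rewrite /p derivZ deriv_exp /q derivD derivC derivZ derivX add0r /= -/q.
  rewrite -scalerAl mul1r scalerMnl scalerA -mulr_natl.
  by rewrite (_ : _ * _ = 1) ?scale1r//; field; apply/andP.
rewrite (@continuous_FTC2 _ _ (horner p) l r lr).
- rewrite -EFinB; congr (_%:E); rewrite /p !hornerZ !horner_exp !qE.
  have -> : beta + c * (r - l) = alpha by rewrite /c; field; rewrite gt_eqF.
  rewrite subrr mulr0 addr0 -mulrBr subrXX mulrA; congr (_ * _).
  have -> : alpha - beta = c * (r - l) by rewrite /c divfK// gt_eqF.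
  by clearbody c; field; rewrite c0 addrC natr1 M0.
- apply: continuous_subspaceT => s.
  rewrite (_ : (fun _ => _) = horner (q ^+ M)); first exact: continuous_horner.
  by apply/funext => t; rewrite horner_exp qE.
- split=> [s _||]; first exact: derivable_horner.
  + by apply: cvg_at_right_filter; exact: continuous_horner.
  + by apply: cvg_at_left_filter; exact: continuous_horner.
- by move=> s _; rewrite -derivE p'E horner_exp qE.
Qed.

End power_integral.

Section slices.
Context {R : realType}.

Definition slice m (C : set 'rV[R]_m.+1) (s : R) : set 'rV[R]_m :=
  [set y | C (consr s y)].

Lemma consr_comb m (t t' s s' : R) (y y' : 'rV[R]_m) :
  t *: consr s y + t' *: consr s' y' = consr (t * s + t' * s') (t *: y + t' *: y').
Proof.
by apply/rowP => i; rewrite !mxE; case: unliftP => [j|] _; rewrite ?mxE.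
Qed.

Lemma slice_cvx m (C : set 'rV[R]_m.+1) s : cvx C -> cvx (slice C s).
Proof.
move=> cC x y t Cx Cy t01; have := cC _ _ t Cx Cy t01.
by rewrite consr_comb -mulrDl addrC subrK mul1r.
Qed.

Lemma slice_bounded m (C : set 'rV[R]_m.+1) s :
  bounded_set C -> bounded_set (slice C s).
Proof.
move=> /bounded_rVP[M M0 CM]; apply/bounded_rVP; exists M => // y Cy.
apply/norm_rV_leP; first exact: ltW.
move=> i; rewrite -(consrS s y i); apply: le_trans (CM _ Cy).
exact: ler_coord_norm.
Qed.

Lemma slice_closed m (C : set 'rV[R]_m.+1) s : closed C -> closed (slice C s).
Proof.
move=> cC; rewrite -openC; apply/open_rVP => y Cy.
have /open_rVP/(_ _ Cy)[d d0 dC] : open (~` C) by exact: closed_openC.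
exists d => // z yz; apply: dC; apply/norm_rV_ltP => // i; rewrite !mxE.
case: unliftP => [j|] _; last by rewrite subrr normr0.
by have := ler_coord_norm (y - z) j; rewrite !mxE => /le_lt_trans; exact.
Qed.

Lemma slice_comb m (C : set 'rV[R]_m.+1) (k l s t : R) x y : cvx C ->
    0 <= k -> 0 <= l -> k + l = 1 -> slice C s x -> slice C t y ->
  slice C (k * s + l * t) (k *: x + l *: y).
Proof.
move=> cC k0 l0 kl Cx Cy; rewrite /slice/= -consr_comb.
have -> : l = 1 - k by rewrite -kl addrC addKr.
by apply: cC => //; rewrite k0 -kl lerDl.
Qed.

Lemma rootr_pow m (A : set 'rV[R]_m.+1) : rootr m.+1 (vol A) ^+ m.+1 = vol A.
Proof. by rewrite rootrK// vol_ge0. Qed.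

(** By Brunn-Minkowski the root of the volume of a slice is concave in its height. The left-hand
    side is the integral of the power of the affine function with the same values at [l] and
    [r]. *)
Lemma frustum_lower m (C : set 'rV[R]_m.+2) (l r : R) : l < r ->
    bounded_set C -> cvx C -> slice C l !=set0 -> slice C r !=set0 ->
  (r - l) / m.+2%:R * \sum_(i < m.+2)
    rootr m.+1 (vol (slice C r)) ^+ (m.+1 - i) * rootr m.+1 (vol (slice C l)) ^+ i
  <= vol C.
Proof.
move=> lr bC cC nl nr; set alpha := rootr _ _; set beta := rootr _ (vol (slice C l)).
have rl : 0 < r - l by rewrite subr_gt0.
rewrite -lee_fin -volE// -integral_affine_pow//.
apply: integral_slices_le_volume => [|s /andP[ls sr]].
  apply/measurable_EFinP; apply: measurable_funX; apply: measurable_funD => //.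
  by apply: measurable_funM => //; apply: measurable_funB.
have a0 : 0 <= alpha by exact: rootr_ge0.
have b0 : 0 <= beta by exact: rootr_ge0.
pose t := (s - l) / (r - l).
have t0 : 0 <= t by apply: divr_ge0; rewrite ?subr_ge0// ltW.
have t1 : t <= 1 by rewrite ler_pdivrMr// mul1r lerD2r.
have t'0 : 0 <= 1 - t by rewrite subr_ge0.
have -> : beta + (alpha - beta) / (r - l) * (s - l) = t * alpha + (1 - t) * beta.
  by rewrite /t; field; rewrite gt_eqF.
have sE : s = t * r + (1 - t) * l by rewrite /t; field; rewrite gt_eqF.
split.
  rewrite lee_fin; exact: (exprn_ge0 _ (addr_ge0 (mulr_ge0 t0 a0) (mulr_ge0 t'0 b0))).
rewrite -/(slice C s) (volE (slice_bounded _ bC)) lee_fin.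
have [t0'|t0'] := eqVneq t 0.
  by rewrite sE t0' mul0r add0r subr0 !mul1r mul0r add0r /beta rootr_pow.
have [t1'|t1'] := eqVneq t 1.
  by rewrite sE t1' subrr !mul0r !mul1r !addr0 /alpha rootr_pow.
apply: (brunn_minkowski_scaled (F := slice C r) (G := slice C l)) => //.
- by rewrite lt_neqAle eq_sym t0'.
- by rewrite subr_gt0 lt_neqAle t1'.
- exact: slice_bounded.
- exact: slice_bounded.
- exact: slice_bounded.
- exact: slice_cvx.
- exact: slice_cvx.
move=> _ _ [x xr <-] [y yl <-]; rewrite sE; apply: slice_comb => //.
by rewrite addrC subrK.
Qed.

(** If the slice at [s] were larger, the bounds of [frustum_lower] for the parts of [C] on the
    two sides of [s] would add up to more than the volume. *)
Lemma tight_slice_le m (C : set 'rV[R]_m.+2) (l s r A : R) : l < s < r ->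
    bounded_set C -> cvx C -> slice C l !=set0 -> slice C r !=set0 ->
    slice C s !=set0 ->
    vol (slice C l) = A -> vol (slice C r) = A -> vol C <= (r - l) * A ->
  vol (slice C s) <= A.
Proof.
move=> /andP[ls sr] bC cC nl nr ns vl vr vC; rewrite leNgt; apply/negP => As.
have A0 : 0 <= A by rewrite -vl vol_ge0.
pose C1 := C `&` [set x | x ord0 ord0 <= s].
pose C2 := C `&` [set x | s <= x ord0 ord0].
have bC1 : bounded_set C1 by apply: sub_bounded bC => x [].
have bC2 : bounded_set C2 by apply: sub_bounded bC => x [].
have c1 : cvx C1.
  move=> x y t [Cx xs] [Cy ys] /andP[t0 t1]; split; first by apply: cC => //; apply/andP.
  rewrite /= !mxE; apply: (@le_trans _ _ (t * s + (1 - t) * s)).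
    by apply: lerD; apply: ler_wpM2l => //; rewrite subr_ge0.
  by rewrite -mulrDl addrC subrK mul1r.
have c2 : cvx C2.
  move=> x y t [Cx xs] [Cy ys] /andP[t0 t1]; split; first by apply: cC => //; apply/andP.
  rewrite /= !mxE; apply: (@le_trans _ _ (t * s + (1 - t) * s)).
    by rewrite -mulrDl addrC subrK mul1r.
  by apply: lerD; apply: ler_wpM2l => //; rewrite subr_ge0.
have sl1 t : t <= s -> slice C1 t = slice C t.
  by move=> ts; apply/seteqP; split=> y /=; [case|split=> //=; rewrite consr0].
have sl2 t : s <= t -> slice C2 t = slice C t.
  by move=> ts; apply/seteqP; split=> y /=; [case|split=> //=; rewrite consr0].
have f1 := @frustum_lower m C1 l s ls bC1 c1.
have f2 := @frustum_lower m C2 s r sr bC2 c2.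
rewrite sl1 ?(ltW ls)// sl1// in f1; rewrite sl2// sl2 ?(ltW sr)// in f2.
move: {f1 f2}(f1 nl ns) (f2 ns nr); rewrite vl vr.
set a := rootr m.+1 A; set b := rootr _ (vol _) => f1 f2.
have a0 : 0 <= a by exact: rootr_ge0.
have b0 : 0 <= b by exact: rootr_ge0.
have aE : a ^+ m.+1 = A by exact: rootrK.
have bE : b ^+ m.+1 = vol (slice C s) by exact: rootr_pow.
have ab : a < b by rewrite -(@ltr_pXn2r _ m.+1)// ?nnegrE// aE bE.
have term (x y : R) (i : 'I_m.+2) : a <= x -> a <= y -> A <= x ^+ (m.+1 - i) * y ^+ i.
  move=> ax ay; rewrite -aE -[in leLHS](subnK (ltnSE (ltn_ord i))) exprD.
  by apply: ler_pM; rewrite ?exprn_ge0// lerXn2r// nnegrE// (le_trans a0).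
have s1 : m.+2%:R * A <= \sum_(i < m.+2) b ^+ (m.+1 - i) * a ^+ i.
  rewrite mulr_natl -[m.+2 in leLHS]card_ord -sumr_const.
  by apply: ler_sum => i _; apply: term; rewrite // ltW.
have s2 : m.+2%:R * A < \sum_(i < m.+2) a ^+ (m.+1 - i) * b ^+ i.
  rewrite big_ord_recr/= subnn expr0 mul1r bE -natr1 mulrDl mul1r.
  apply: ler_ltD => //; rewrite mulr_natl -[m.+1 in leLHS]card_ord -sumr_const.
  by apply: ler_sum => i _; apply: (term a b (widen_ord (leqnSn m.+1) i)); rewrite // ltW.
have := @volume_split_ge R m.+1 C ord0 s.
rewrite -/C1 -/C2 (volE bC1) (volE bC2) (volE bC) -EFinD lee_fin => split_C.
have n0 : 0 < m.+2%:R :> R by rewrite ltr0n.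
have g1 : (s - l) * A <= vol C1.
  apply: le_trans f1; rewrite -mulrA; apply: ler_wpM2l; first by rewrite subr_ge0 ltW.
  by rewrite mulrC ler_pdivlMr// mulrC.
have g2 : (r - s) * A < vol C2.
  apply: lt_le_trans f2; rewrite -mulrA ltr_pM2l ?subr_gt0//.
  by rewrite mulrC ltr_pdivlMr// mulrC.
have : (r - l) * A < (r - l) * A.
  apply: lt_le_trans vC; apply: lt_le_trans split_C.
  have -> : (r - l) * A = (s - l) * A + (r - s) * A by ring.
  exact: ler_ltD.
by rewrite ltxx.
Qed.

Lemma ball_vol_gt0 m (A : set 'rV[R]_m.+1) p rho : bounded_set A -> 0 < rho ->
  (forall y, `|p - y| < rho -> A y) -> 0 < vol A.
Proof.
move=> bA rho0 pA.
pose h : 'rV[R]_m.+1 := const_mx (rho / 2).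
have : (volume (box (p - h) (p + h)) <= volume A)%E.
  apply: le_outer_measure => y yb; apply: pA; apply/norm_rV_ltP => // i.
  have := yb i; rewrite !mxE => /andP[h1 h2].
  by rewrite ltr_norml; apply/andP; split; lra.
rewrite volume_box => [|i]; last by rewrite !mxE; lra.
rewrite (volE bA) lee_fin; apply: lt_le_trans.
by apply: prodr_gt0 => i _; rewrite !mxE; lra.
Qed.

(** A convex set of positive volume has interior points near each of its points, so near a point
    of [T] outside [S] there is volume that [S] does not account for. *)
Lemma subset_of_same_volume m (S T : set 'rV[R]_m.+1) : closed S ->
  bounded_set T -> cvx T -> S `<=` T -> vol T <= vol S -> 0 < vol S -> T `<=` S.
Proof.
move=> cS bT cT ST vTS vS x Tx; apply: contrapT => Sx.
have [p [rho [rho0 pT]]] := cvx_vol_gt0_interior bT cT (lt_le_trans vS (le_vol bT ST)).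
have /open_rVP/(_ x Sx)[d d0 dS] : open (~` S) by exact: closed_openC.
have [eta [eta0 eta1]] : exists eta : R, 0 <= eta < 1 /\ (1 - eta) * (`|x - p| + rho) < d.
  have L0 : 0 < `|x - p| + rho by rewrite ltr_wpDl.
  exists (1 - Num.min 1 (d / 2 / (`|x - p| + rho))).
  have h : 0 < Num.min 1 (d / 2 / (`|x - p| + rho)).
    by rewrite lt_min ltr01 !divr_gt0.
  split; first by rewrite subr_ge0 ge_min lexx/= ltrBlDr ltrDl.
  rewrite subKr; apply: (@le_lt_trans _ _ (d / 2)); last by lra.
  by rewrite -ler_pdivlMr// ge_min lexx orbT.
pose q := p + eta *: (x - p).
have eta1' : 0 < 1 - eta by move/andP: eta0 => [_ h]; rewrite subr_gt0.
have : 0 < vol (T `\` S).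
  apply: (@ball_vol_gt0 _ _ q ((1 - eta) * rho)) => [||y qy].
  - by apply: sub_bounded bT => y [].
  - exact: mulr_gt0.
  split; first exact: (cvx_scale_interior cT pT eta0 Tx qy).
  apply: dS; rewrite (_ : x - y = (1 - eta) *: (x - p) + (q - y)); last first.
    by rewrite /q scalerBl scale1r; apply/rowP => i; rewrite !mxE; ring.
  apply: le_lt_trans (ler_normD _ _) _; apply: lt_trans eta1.
  by rewrite normrZ (ger0_norm (ltW eta1')) mulrDr ltrD2l.
have := vol_caratheodory bT (caratheodory_closed cS).
rewrite (_ : T `&` S = S); last by apply/setIidPr.
by move=> vTE h; move: vTS; rewrite vTE leNgt ltrDl h.
Qed.

(** The other half of Tonelli's theorem, for closed sets: apply [integral_slices_le_volume] to
    the complement in a box. *)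
Lemma volume_le_of_slices m (C : set 'rV[R]_m.+2) (l r A : R) : l < r ->
    closed C -> bounded_set C -> (forall x, C x -> l <= x ord0 ord0 <= r) ->
    (forall s, l <= s <= r -> vol (slice C s) <= A) ->
  vol C <= (r - l) * A.
Proof.
move=> lr clC bC Clr sA.
have /bounded_rVP[M M0 CM] := bC.
pose u : 'rV[R]_m.+1 := const_mx M.
pose B := box (consr l (- u)) (consr r u).
have bu : box (- u) u = box (tailr (consr l (- u))) (tailr (consr r u)).
  by rewrite !consrK.
have CB : C `<=` B.
  move=> x Cx; rewrite -(tailrK x); apply/box_consr; rewrite !consr0 !consrK.
  split; first exact: Clr.
  move=> i; rewrite !mxE -ler_norml; apply: le_trans (CM _ Cx).
  exact: ler_coord_norm.
have bB : bounded_set B.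
  apply/bounded_rVP; exists (`|l| + `|r| + M) => [|x].
    by apply: ltr_wpDl => //; rewrite addr_ge0.
  rewrite -(tailrK x) => /box_consr; rewrite !consr0 !consrK => -[lxr xu].
  have nl := ler_norm (- l); have nr := ler_norm r.
  have nr0 := normr_ge0 r; have nl0 := normr_ge0 l; rewrite normrN in nl.
  apply/norm_rV_leP => [|i]; first by rewrite !addr_ge0// ltW.
  case: (unliftP ord0 i) => [j|] ->; last first.
    by rewrite consr0 ler_norml; move/andP: lxr => [? ?]; apply/andP; split; lra.
  rewrite consrS; have := xu j; rewrite !mxE => /andP[? ?].
  by rewrite ler_norml; apply/andP; split; lra.
have u0 i : (- u) ord0 i <= u ord0 i by rewrite !mxE; lra.
have bub : bounded_set (box (- u) u).
  apply/bounded_rVP; exists M => // x xu; apply/norm_rV_leP; first exact: ltW.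
  by move=> i; have := xu i; rewrite !mxE -ler_norml.
pose W := vol (box (- u) u).
have vB : vol B = (r - l) * W.
  apply: EFin_inj; rewrite EFinM /W -!volE// /B volume_box => [|i]; last first.
    by case: (unliftP ord0 i) => [j|] ->; rewrite ?consr0 ?consrS ?u0 ?ltW.
  rewrite volume_box// -EFinM boxvolS !consr0 !consrK EFinM//.
have [WA|AW] := leP W A.
  apply: le_trans (le_vol bB CB) _; rewrite vB; apply: ler_wpM2l => //.
  by rewrite subr_ge0 ltW.
have bD : bounded_set (B `\` C) by apply: sub_bounded bB => x [].
have : (r - l) * (W - A) <= vol (B `\` C).
  rewrite -lee_fin -volE//.
  have -> : ((r - l) * (W - A))%:E =
      (\int[lebesgue_measure]_(s in `[l, r]) (W - A)%:E)%E.
    by rewrite integral_cst//= lebesgue_measure_itv/= lte_fin lr -EFinB -EFinM mulrC.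
  apply: integral_slices_le_volume => // s ls; split; first by rewrite lee_fin subr_ge0 ltW.
  have clS : closed (slice C s).
    exact: slice_closed.
  have := vol_caratheodory bub (caratheodory_closed clS).
  rewrite -/W => WE; apply: (@le_trans _ _ (volume (box (- u) u `\` slice C s))).
    rewrite volE; last by apply: sub_bounded bub => x [].
    rewrite lee_fin lerBlDr WE addrC; apply: lerD => //; apply: le_trans (sA s ls).
    by apply: le_vol; [exact: slice_bounded|move=> x []].
  apply: le_outer_measure => y [yu yC]; split=> //.
  by apply/box_consr; rewrite !consr0 !consrK.
have := vol_caratheodory bB (caratheodory_closed clC).
rewrite (_ : B `&` C = C); last by apply/setIidPr.
by rewrite vB => vE h; lra.
Qed.

Lemma interior_rVP n (S : set 'rV[R]_n) x :
  interior S x <-> exists2 d, 0 < d & forall y, `|x - y| < d -> S y.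
Proof.
split=> [/nbhs_ballP[d /= d0 dS]|[d d0 dS]].
  by exists d => // y xy; apply: dS; rewrite mx_norm_ball.
by apply/nbhs_ballP; exists d => // y; rewrite mx_norm_ball => /dS.
Qed.

(** Homothetic copies of ratio less than 1 lie in the interior. *)
Lemma cvx_boundary_null m (S : set 'rV[R]_m.+1) : bounded_set S -> cvx S ->
  vol (S `\` interior S) = 0.
Proof.
move=> bS cS; have bD : bounded_set (S `\` interior S) by apply: sub_bounded bS => x [].
apply/eqP; rewrite eq_le vol_ge0 andbT.
have [vS|vS] := ltP 0 (vol S); last by apply: le_trans vS; apply: le_vol => // x [].
have [p [rho [rho0 pS]]] := cvx_vol_gt0_interior bS cS vS.
have := vol_caratheodory bS (caratheodory_open (@open_interior _ S)).
rewrite (_ : S `&` interior S = interior S); last first.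
  by apply/setIidPr; exact: interior_subset.
suff : vol S <= vol (interior S) by lra.
have bI : bounded_set (interior S) by apply: sub_bounded bS; exact: interior_subset.
apply: (@le_of_scaled _ _ _ m.+1) => [|eta /andP[eta0 eta1]]; first exact: vol_ge0.
rewrite -(vol_affine (p - eta *: p))//; apply: le_vol => // _ [x Sx <-].
apply/interior_rVP; exists ((1 - eta) * rho) => [|y].
  by apply: mulr_gt0 => //; rewrite subr_gt0.
rewrite (_ : eta *: x + _ = p + eta *: (x - p)); last by rewrite scalerBr addrCA.
by apply: (cvx_scale_interior cS pS) => //; rewrite (ltW eta0).
Qed.

End slices.

(** This displays the defect in the arithmetic-geometric mean inequalities that prove
    [frustum_inequality], where [p], [q], [x], [y] are the square roots of [a], [b], [alpha],
    [beta]. The two end terms of the sum give the first square and the difference between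
    [a + b] and twice the geometric mean gives the second one; [e] collects the inner terms,
    paired by symmetry. *)
Lemma pow_sqrt_AM {R : realType} (M : nat) (p q x y : R) : 0 <= x -> 0 <= y ->
  exists2 e, 0 <= e &
  (p ^+ 2 + q ^+ 2) * (\sum_(i < M.+2) (x ^+ 2) ^+ (M.+1 - i) * (y ^+ 2) ^+ i) =
  p ^+ 2 * (x ^+ 2) ^+ M.+1 + q ^+ 2 * (y ^+ 2) ^+ M.+1 +
    2 * M.+1%:R * (p * q * (x ^+ M.+1 * y ^+ M.+1)) +
    (p * y ^+ M.+1 - q * x ^+ M.+1) ^+ 2 +
    M%:R * (x ^+ M.+1 * y ^+ M.+1) * (p - q) ^+ 2 + e.
Proof.
move=> x0 y0; set g := x ^+ M.+1 * y ^+ M.+1.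
pose f (i : 'I_M) := (x ^+ 2) ^+ (M.+1 - i.+1) * (y ^+ 2) ^+ i.+1.
have mid : M%:R * g <= \sum_(i < M) f i.
  have -> : \sum_(i < M) f i = \sum_(i < M) (f i + f (rev_ord i)) / 2.
    have rev : \sum_(i < M) f i = \sum_(i < M) f (rev_ord i).
      by rewrite (reindex_inj rev_ord_inj).
    by rewrite -mulr_suml big_split/= -rev; field.
  rewrite mulr_natl -[M in leLHS]card_ord -sumr_const; apply: ler_sum => i _.
  have iM : (i < M)%N := ltn_ord i.
  pose a := x ^+ (M.+1 - i.+1) * y ^+ i.+1; pose b := x ^+ i.+1 * y ^+ (M.+1 - i.+1).
  have gE : g = a * b.
    rewrite /g /a /b mulrACA -!exprD subnK ?ltnS ?(ltnW iM)//.
    by rewrite subnKC// ltnS ltnW.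
  have -> : f i = a ^+ 2 by rewrite /f /a [RHS]exprMn; congr (_ * _); exact: exprAC.
  have -> : f (rev_ord i) = b ^+ 2.
    rewrite /f /b/= [RHS]exprMn (_ : (M.+1 - (M - i.+1).+1 = i.+1)%N); last by lia.
    rewrite (_ : ((M - i.+1).+1 = M.+1 - i.+1)%N); last by lia.
    by congr (_ * _); exact: exprAC.
  have := sqr_ge0 (a - b); rewrite gE sqrrB; lra.
exists ((p ^+ 2 + q ^+ 2) * (\sum_(i < M) f i - M%:R * g)).
  by apply: mulr_ge0; [rewrite addr_ge0// sqr_ge0|rewrite subr_ge0].
rewrite big_ord_recl big_ord_recr/= subn0 /bump/= subnn !expr0 mul1r mulr1.
rewrite (eq_bigr f) => [|i _]; last by rewrite /f.
set s := \sum_(i < M) f i.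
rewrite /g -!(exprM _ 2) !(mulnC 2) !(exprM _ _ 2) -natr1; ring.
Qed.

(** In the case of equality both squares of [pow_sqrt_AM] vanish. There is an inner term as
    [0 < M], so the second square gives [a = b], and then the first one [P = Q]. *)
Lemma frustum_inequality {R : realType} (M : nat) (a b alpha beta P Q : R) :
    (0 < M)%N -> 0 < a -> 0 < b -> 0 <= alpha -> 0 <= beta ->
    alpha ^+ M.+1 = P -> beta ^+ M.+1 = Q ->
  let lhs := a * P + b * Q + 2 * M.+1%:R * Num.sqrt (a * P * (b * Q)) in
  let rhs := (a + b) * \sum_(i < M.+2) alpha ^+ (M.+1 - i) * beta ^+ i in
  lhs <= rhs /\ (rhs <= lhs -> 0 < rhs -> a = b /\ P = Q).
Proof.
move=> M0 a0 b0 al0 be0 <- <- {P Q}; set P := alpha ^+ M.+1; set Q := beta ^+ M.+1.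
have := @pow_sqrt_AM R M (Num.sqrt a) (Num.sqrt b) (Num.sqrt alpha) (Num.sqrt beta)
  (sqrtr_ge0 _) (sqrtr_ge0 _).
have sa0 : 0 < Num.sqrt a by rewrite sqrtr_gt0.
have sb0 : 0 < Num.sqrt b by rewrite sqrtr_gt0.
have x0 := sqrtr_ge0 alpha; have y0 := sqrtr_ge0 beta.
have xE := sqr_sqrtr al0; have yE := sqr_sqrtr be0.
have aE := sqr_sqrtr (ltW a0); have bE := sqr_sqrtr (ltW b0).
rewrite xE yE aE bE => -[e e0 H] lhs rhs.
move: xE yE aE bE sa0 sb0 x0 y0 H.
set sa := Num.sqrt a; set sb := Num.sqrt b; set x := Num.sqrt alpha; set y := Num.sqrt beta.
move=> xE yE aE bE sa0 sb0 x0 y0 H.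
set X := x ^+ M.+1 in H *; set Y := y ^+ M.+1 in H *.
have X0 : 0 <= X by exact: exprn_ge0.
have Y0 : 0 <= Y by exact: exprn_ge0.
have PE : P = X ^+ 2 by rewrite /P -xE /X -!exprM mulnC.
have QE : Q = Y ^+ 2 by rewrite /Q -yE /Y -!exprM mulnC.
have sE : Num.sqrt (a * P * (b * Q)) = sa * sb * (X * Y).
  have -> : a * P * (b * Q) = (sa * sb * (X * Y)) ^+ 2 by rewrite -aE -bE PE QE; ring.
  by rewrite sqrtr_sqr ger0_norm// !mulr_ge0// ltW.
have rE : rhs = lhs + ((sa * Y - sb * X) ^+ 2 + M%:R * (X * Y) * (sa - sb) ^+ 2 + e).
  by rewrite /rhs /lhs H sE -/P -/Q; ring.
have h1 := sqr_ge0 (sa * Y - sb * X).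
have h2 : 0 <= M%:R * (X * Y) * (sa - sb) ^+ 2 
  by apply: mulr_ge0; [apply: mulr_ge0; [exact: ler0n|exact: mulr_ge0]|exact: sqr_ge0].
split; first by rewrite rE; lra.
move=> rl r0.
have z1 : (sa * Y - sb * X) ^+ 2 = 0 by lra.
have z2 : M%:R * (X * Y) * (sa - sb) ^+ 2 = 0 by lra.
have e1 : sa * Y = sb * X by apply/eqP; rewrite -subr_eq0 -sqrf_eq0 z1.
have XY0 : X * Y != 0.
  apply/negP; rewrite mulf_eq0 => XY.
  have [X0' Y0'] : X = 0 /\ Y = 0.
    case/orP: XY => /eqP XY; split => //; apply/eqP.
      by move/eqP: e1; rewrite XY mulr0 mulf_eq0 (gt_eqF sa0).
    by move/eqP: e1; rewrite XY mulr0 eq_sym mulf_eq0 (gt_eqF sb0).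
  have : lhs = 0 by rewrite /lhs sE PE QE X0' Y0'; ring.
  by move=> l0; move: r0; rewrite ltNge; move: rl; rewrite l0 => ->.
have sab : sa = sb.
  apply/eqP; rewrite -subr_eq0 -sqrf_eq0; move/eqP: z2.
  by rewrite mulf_eq0 (negPf (mulf_neq0 _ XY0)) ?pnatr_eq0 -?lt0n.
split; first by rewrite -aE -bE sab.
by rewrite PE QE; congr (_ ^+ 2); apply: (mulfI (lt0r_neq0 sa0)); rewrite e1 sab.
Qed.

(** * Faces and cone volumes *)
Section reflection.
Context {R : realType} {m : nat}.
Notation V := 'rV[R]_m.+2.
Implicit Types x y u : V.

(** The reflection that exchanges the first coordinate vector and [u], if [u] has norm 1. If the
    two coincide then [w = 0], and the formula gives the identity. *)
Definition householder u x : V :=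
  let w := consr 1 0 - u in x - (2 * dot x w / dot w w) *: w.

Lemma dot_consr10 x : dot x (consr 1 0) = x ord0 ord0.
Proof.
rewrite /dot big_ord_recl consr0 mulr1 big1 ?addr0// => i _.
by rewrite consrS mxE mulr0.
Qed.

Lemma householderZ u c x : householder u (c *: x) = c *: householder u x.
Proof.
rewrite /householder; move: (_ - u) => w.
by rewrite scalerBr scalerA dotZl; congr (_ - _ *: _); ring.
Qed.

Lemma householderD u x y : householder u (x + y) = householder u x + householder u y.
Proof.
rewrite /householder; move: (_ - u) => w.
by rewrite addrACA -opprD -scalerDl dotDl; congr (_ - _ *: _); ring.
Qed.

Lemma householderN u x : householder u (- x) = - householder u x.
Proof. by rewrite -scaleN1r householderZ scaleN1r. Qed.

Lemma householderB u x y : householder u (x - y) = householder u x - householder u y.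
Proof. by rewrite householderD householderN. Qed.

Lemma householder_dot u x y : dot (householder u x) (householder u y) = dot x y.
Proof.
rewrite /householder; move: (_ - u) => w.
rewrite !(dotDl, dotDr, dotNl, dotNr, dotZl, dotZr) (dotC w y).
have [w0|w0] := eqVneq (dot w w) 0.
  by rewrite (dot_eq0 w0) !(dotC _ 0) !dot0l; ring.
by field.
Qed.

Lemma householderK u : involutive (householder u).
Proof.
move=> x; rewrite /householder; move: (_ - u) => w.
have [w0|w0] := eqVneq (dot w w) 0; first by rewrite (dot_eq0 w0) !scaler0 !subr0.
rewrite dotDl dotNl dotZl divfK// (_ : 2 * (_ - _) / _ = - (2 * dot x w / dot w w)).
  by rewrite scaleNr opprK subrK.
by field.
Qed.

Lemma householder_e0 u : unit_sphere u -> householder u (consr 1 0) = u.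
Proof.
rewrite /unit_sphere/= => u1; have uu : dot u u = 1 by rewrite -enorm_sqr u1 expr1n.
rewrite /householder; set w := _ - u.
have [w0|w0] := eqVneq (dot w w) 0.
  by rewrite (dot_eq0 w0) scaler0 subr0; apply/eqP; rewrite -subr_eq0 -/w (dot_eq0 w0).
have ee : dot (consr 1 0 : V) (consr 1 0) = 1 by rewrite dot_consr10 consr0.
have -> : 2 * dot (consr 1 0) w / dot w w = 1.
  have -> : 2 * dot (consr 1 0) w = dot w w.
    by rewrite /w !(dotDl, dotDr, dotNl, dotNr) ee uu (dotC u); ring.
  by rewrite divff.
by rewrite scale1r /w opprB addrC subrK.
Qed.

Lemma dot_householder u x : unit_sphere u -> dot (householder u x) u = x ord0 ord0.
Proof. by move=> u1; rewrite -{2}(householder_e0 u1) householder_dot dot_consr10. Qed.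

Lemma enorm_householder u x : enorm (householder u x) = enorm x.
Proof. by rewrite /enorm householder_dot. Qed.

Lemma norm_householder u x : `|householder u x| <= m.+2%:R * `|x|.
Proof. apply: le_trans (norm_le_enorm _) _; rewrite enorm_householder; exact: enorm_le_norm. Qed.

End reflection.

Section convex_sets.
Context {R : realType} {n : nat}.
Implicit Types A C : set 'rV[R]_n.

Lemma convex_setP A : @convex_set R 'rV[R]_n A <-> cvx A.
Proof.
split=> [cA x y t Ax Ay /andP[t0 t1]|cA x y t].
  have := cA x y (Itv01 t0 t1); rewrite !inE => /(_ Ax Ay).
  by [].
rewrite !inE => Ax Ay; apply: (cA x y t%:num) => //.
by apply/andP.
Qed.

Lemma convex_hull_sub A C : cvx C -> A `<=` C -> convex_hull A `<=` C.
Proof. by move=> cC AC; apply: smallest_sub => //; apply/convex_setP. Qed.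

Lemma convex_hull_mem A x : (forall C, cvx C -> A `<=` C -> C x) -> convex_hull A x.
Proof. by move=> h C [cC AC]; apply: h => //; apply/convex_setP. Qed.

End convex_sets.

Section support.
Context {R : realType} {n : nat}.
Implicit Types (K : set 'rV[R]_n) (x u : 'rV[R]_n).

Lemma support_fun_max K u : compact K -> K !=set0 ->
  (exists2 x, K x & dot x u = support_fun K u) /\
  (forall y, K y -> dot y u <= support_fun K u).
Proof.
move=> cK nK.
have [c cin cmax] := @EVT_max_rV R n (fun x => dot x u) K nK cK
  (continuous_subspaceT (@dot_continuous R n u)).
move: cin; rewrite inE => Kc.
have cE : dot c u = support_fun K u.
  apply/eqP; rewrite eq_le; apply/andP; split.
    apply: ub_le_sup; last by exists c; rewrite // dotC.
    by exists (dot c u) => _ [y Ky <-]; rewrite dotC; apply: cmax; rewrite inE.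
  apply: ge_sup; first by exists (dot u c), c.
  by move=> _ [y Ky <-]; rewrite dotC; apply: cmax; rewrite inE.
split; first by exists c.
by move=> y Ky; rewrite -cE; apply: cmax; rewrite inE.
Qed.

Lemma rV_norm_scale (u : 'rV[R]_n) (d : R) : 0 < d ->
  exists2 e, 0 < e & `|e *: u| < d.
Proof.
move=> d0; have L0 : 0 < `|u| + 1 by rewrite ltr_wpDl.
exists (d / (`|u| + 1)); first exact: divr_gt0.
rewrite normrZ gtr0_norm ?divr_gt0// mulrAC ltr_pdivrMr//.
by rewrite ltr_pM2l// ltrDl.
Qed.

Lemma support_fun_gt0 K u : compact K -> interior K 0 -> unit_sphere u ->
  0 < support_fun K u.
Proof.
move=> cK K0 u1.
have /interior_rVP[d d0 dK] := K0.
have [e e0 eu] := rV_norm_scale u d0.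
have nK : K !=set0 by exists 0; exact: interior_subset K0.
have [_ h] := support_fun_max u cK nK.
have := h (e *: u); rewrite dotZl -enorm_sqr (u1 : enorm u = 1) expr1n mulr1 => he.
by apply: lt_le_trans e0 _; apply: he; apply: dK; rewrite sub0r normrN.
Qed.

End support.

Section null_sets.
Context {R : realType} {T : Type}.

Lemma caratheodory_null (mu : {outer_measure set T -> \bar R}) (A : set T) :
  mu A = 0%E -> mu.-caratheodory A.
Proof.
move=> A0; apply: le_caratheodory_measurable => X.
have : (mu (X `&` A) <= 0)%E by rewrite -A0; apply: le_outer_measure => x [].
move=> XA; rewrite -[leRHS]add0e; apply: leeD => //.
by apply: le_outer_measure => x [].
Qed.

End null_sets.

Section face_slice.
Context {R : realType} {m : nat}.
Notation V := 'rV[R]_m.+2.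
Implicit Types (K : set V) (u x y : V).

Definition reflected K u : set V := [set x | K (householder u x)].

Lemma reflected_mem K u x : reflected K u (householder u x) <-> K x.
Proof. by rewrite /reflected/= householderK. Qed.

Lemma bounded_reflected K u : bounded_set K -> bounded_set (reflected K u).
Proof.
move=> /bounded_rVP[M M0 KM]; apply/bounded_rVP; exists (m.+2%:R * M).
  by apply: mulr_gt0 => //; rewrite ltr0n.
move=> x Kx; rewrite -(householderK u x); apply: le_trans (norm_householder _ _) _.
by apply: ler_wpM2l; [rewrite ler0n|exact: KM].
Qed.

Lemma closed_reflected K u : closed K -> closed (reflected K u).
Proof.
move=> cK; rewrite -openC; apply/open_rVP => x Kx.
have /open_rVP/(_ _ Kx)[d d0 dK] : open (~` K) by exact: closed_openC.
have n0 : 0 < m.+2%:R :> R by rewrite ltr0n.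
exists (d / m.+2%:R) => [|y xy]; first exact: divr_gt0.
apply: dK; rewrite -householderB; apply: le_lt_trans (norm_householder _ _) _.
by rewrite mulrC -ltr_pdivlMr.
Qed.

Lemma cvx_reflected K u : cvx K -> cvx (reflected K u).
Proof. by move=> cK x y t Kx Ky t01; rewrite /reflected/= householderD !householderZ; exact: cK. Qed.

(** Both sides are Hausdorff measures of full dimension, which isometries preserve. *)
Lemma volume_reflected K u : closed K -> bounded_set K ->
  volume (reflected K u) = volume K.
Proof.
move=> cK bK; transitivity (hausdorff m.+2 K).
  have KE : householder u @` reflected K u = K.
    apply/seteqP; split=> [_ [x Kx <-]//|x Kx].
    by exists (householder u x); [exact/reflected_mem|exact: householderK].
  rewrite -[in RHS]KE (@hausdorff_isometry_volume _ m.+1 _ _ (householder u))//.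
  - exact: householderK.
  - by move=> x y; rewrite -householderB enorm_householder.
  - exact: bounded_reflected.
  - by apply: caratheodory_closed; exact: closed_reflected.
have := @hausdorff_isometry_volume R m.+1 _ id id K.
by rewrite image_id => ->//; exact: caratheodory_closed.
Qed.

Definition lift_slice u (s : R) (y : 'rV[R]_m.+1) : V := householder u (consr s y).

Lemma lift_sliceK u s : cancel (lift_slice u s) (tailr \o householder u).
Proof. by move=> y; rewrite /lift_slice/= householderK consrK. Qed.

Lemma consrB (s : R) (x y : 'rV[R]_m.+1) : consr s x - consr s y = consr 0 (x - y).
Proof. by apply/rowP => i; rewrite !mxE; case: unliftP => [j|] _; rewrite ?mxE ?subrr. Qed.

Lemma lift_slice_isometry u s (x y : 'rV[R]_m.+1) :
  enorm (lift_slice u s x - lift_slice u s y) = enorm (x - y).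
Proof.
rewrite /lift_slice -householderB enorm_householder consrB /enorm /dot big_ord_recl.
by rewrite consr0 mul0r add0r; congr (Num.sqrt _); apply: eq_bigr => i _; rewrite !consrS.
Qed.

Lemma dot_lift_slice u s (y : 'rV[R]_m.+1) : unit_sphere u -> dot (lift_slice u s y) u = s.
Proof. by move=> u1; rewrite dot_householder// consr0. Qed.

Definition section K u s : set V := [set x | K x /\ dot x u = s].

Lemma section_slice K u s : unit_sphere u ->
  section K u s = lift_slice u s @` slice (reflected K u) s.
Proof.
move=> u1; apply/seteqP; split=> [x [Kx xs]|_ [y Ky <-]].
  have x0 : householder u x ord0 ord0 = s by rewrite -xs -(dot_householder _ u1) householderK.
  exists (tailr (householder u x)); rewrite /slice/= /lift_slice -x0 tailrK ?householderK//.
  exact/reflected_mem.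
by split; [exact: Ky|exact: dot_lift_slice].
Qed.

Lemma face_section K u : face K u = section K u (support_fun K u).
Proof. by []. Qed.

Lemma faceN_section K u : face K (- u) = section K u (- support_fun K (- u)).
Proof.
apply/seteqP; split=> x [Kx /= xs]; split=> //=; first by rewrite -xs dotNr opprK.
by rewrite dotNr xs opprK.
Qed.

Lemma hausdorff_section K u s : unit_sphere u -> closed K -> bounded_set K ->
  hausdorff m.+1 (section K u s) = (vol (slice (reflected K u) s))%:E.
Proof.
move=> u1 cK bK; have bS : bounded_set (slice (reflected K u) s).
  by apply: slice_bounded; exact: bounded_reflected.
rewrite section_slice// (hausdorff_isometry_volume (lift_sliceK u s) (lift_slice_isometry u s) bS).
  exact: volE.
by apply: caratheodory_closed; apply: slice_closed; exact: closed_reflected.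
Qed.

End face_slice.

Section cone_volume_face.
Context {R : realType} {m : nat}.
Variables (K : set 'rV[R]_m.+2) (u : 'rV[R]_m.+2).
Hypotheses (cK : compact K) (cvK : cvx K) (K0 : interior K 0) (u1 : unit_sphere u).

Let h := support_fun K u.
Let S := slice (reflected K u) h.

Let clK : closed K. Proof. by apply: compact_closed => //; exact: norm_hausdorff. Qed.
Let bK : bounded_set K. Proof. exact: compact_bounded. Qed.
Let hle y : K y -> dot y u <= h.
Proof.
have nK : K !=set0 by exists 0; exact: interior_subset K0.
exact: (support_fun_max u cK nK).2.
Qed.

Lemma outer_unit_normal_face x : face K u x -> outer_unit_normal K x u.
Proof. by move=> [Kx /= xu]; split=> // y Ky; rewrite xu; exact: hle. Qed.

Lemma face_boundary x : face K u x -> boundary K x.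
Proof.
move=> [Kx /= xu]; split; first exact: subset_closure.
move=> /interior_rVP[d d0 dK]; have [e e0 eu] := rV_norm_scale u d0.
have /dK/hle : `|x - (x + e *: u)| < d by rewrite opprD addNKr normrN.
rewrite dotDl dotZl -enorm_sqr (u1 : enorm u = 1) expr1n mulr1 xu -/h.
by rewrite gerDl leNgt e0.
Qed.

(** A normal at a relative interior point of the face is orthogonal to the face, hence a
    multiple of [u]; the origin, which is interior, decides on the sign. *)
Lemma relative_interior_normal y w : interior S y ->
  outer_unit_normal K (lift_slice u h y) w -> w = u.
Proof.
move=> /interior_rVP[d d0 dS] [w1 wn].
have tangent z : dot (consr 0 z) (householder u w) = 0.
  have [e e0 ez] := rV_norm_scale z d0.
  have lin t : lift_slice u h (y + t *: z) = lift_slice u h y + t *: householder u (consr 0 z).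
    rewrite /lift_slice -householderZ -householderD; congr (householder u _).
    by apply/rowP => i; rewrite !mxE; case: unliftP => [j|] _; rewrite ?mxE// mulr0 addr0.
  have dz : dot (consr 0 z) (householder u w) = dot (householder u (consr 0 z)) w.
    by rewrite -(householder_dot u) householderK.
  have h1 := wn _ (dS (y + e *: z) _); have h2 := wn _ (dS (y + (- e) *: z) _).
  rewrite -[householder u (consr h _)]/(lift_slice u h _) lin in h1.
  rewrite -[householder u (consr h _)]/(lift_slice u h _) lin in h2.
  move: h1 h2; rewrite dz; move: (lift_slice u h y) (householder u _) => q v.
  rewrite !dotDl !dotZl !opprD !addNKr scaleNr opprK normrN.
  move=> /(_ ez) h1 /(_ ez) h2; have ev : e * dot v w = 0 by lra.
  by apply/eqP; move/eqP: ev; rewrite mulf_eq0 (gt_eqF e0).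
have tw : tailr (householder u w) = 0.
  apply: dot_eq0; rewrite -[RHS](tangent (tailr (householder u w))) [in RHS]/dot big_ord_recl.
  by rewrite consr0 mul0r add0r /dot; apply: eq_bigr => i _; rewrite consrS tailrE.
set c := householder u w ord0 ord0.
have wE : w = c *: u.
  rewrite -[LHS](householderK u) -(tailrK (householder u w)) tw -/c.
  rewrite -[in RHS](householder_e0 u1) -householderZ; congr (householder u _).
  by apply/rowP => i; rewrite !mxE; case: unliftP => [j|] _; rewrite ?mxE ?mulr1 ?mulr0.
have := wn 0 (interior_subset K0); rewrite dot0l wE dotZr dot_lift_slice// => ch.
have c0 : 0 <= c by rewrite -(pmulr_lge0 _ (support_fun_gt0 cK K0 u1)).
move: w1; rewrite /unit_sphere/= wE enormZ (u1 : enorm u = 1) mulr1 (ger0_norm c0) => ->.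
by rewrite scale1r.
Qed.

Lemma gauss_preimage_sub_face : gauss_preimage K [set u] `<=` face K u.
Proof.
move=> x [[[clx _] [w [wn wu]]] /= gx].
have Kx : K x by move: clx; rewrite -(closure_id K).1.
have xn : outer_unit_normal K x u by rewrite -gx; apply: getPex; exists w.
split=> //=; apply/eqP; rewrite eq_le hle//=.
have nK : K !=set0 by exists 0; exact: interior_subset K0.
have [[z Kz zh] _] := support_fun_max u cK nK.
by rewrite -zh; exact: xn.2.
Qed.

Lemma lift_interior_gauss_preimage :
  lift_slice u h @` interior S `<=` gauss_preimage K [set u].
Proof.
move=> _ [y yS <-].
have Fx : face K u (lift_slice u h y).
  by rewrite face_section section_slice//; exists y => //; exact: interior_subset yS.
have un w := relative_interior_normal (w := w) yS.
split; last by apply: get_unique; [exact: outer_unit_normal_face|exact: un].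
split; first exact: face_boundary.
by exists u; split=> [|w /un ->//]; exact: outer_unit_normal_face.
Qed.

(** The points with several normals lie over the relative boundary of the face. *)
Lemma face_gauss_preimage_null :
  hausdorff m.+1 (face K u `\` gauss_preimage K [set u]) = 0%E.
Proof.
have cS : closed S by apply: slice_closed; exact: closed_reflected.
have bS : bounded_set S by apply: slice_bounded; exact: bounded_reflected.
have cvS : cvx S by apply: slice_cvx; exact: cvx_reflected.
have bD : bounded_set (S `\` interior S) by apply: sub_bounded bS => x [].
have D0 : hausdorff m.+1 (lift_slice u h @` (S `\` interior S)) = 0%E.
  rewrite (hausdorff_isometry_volume (lift_sliceK u h) (lift_slice_isometry u h) bD).
    by rewrite volE// cvx_boundary_null.
  apply: caratheodory_closed; rewrite setDE; apply: closedI => //.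
  by apply: open_closedC; exact: open_interior.
have : (hausdorff m.+1 (face K u `\` gauss_preimage K [set u]) <= 0)%E.
  rewrite -D0; apply: le_outer_measure => x [].
  rewrite face_section section_slice// => -[y yS <-] ny; exists y => //; split=> // iy.
  by apply: ny; apply: lift_interior_gauss_preimage; exists y.
move=> le0; apply/eqP; rewrite eq_le le0/=; exact: outer_measure_ge0.
Qed.

(** Up to a null set, the preimage of [u] under the Gauss map is the face, and the integrand is
    constant on it. *)
Lemma cone_volume_face :
  cone_volume K [set u] = ((m.+2%:R)^-1 * (h * vol S))%:E.
Proof.
set D := gauss_preimage K [set u].
have cF : closed (face K u) by apply: closedI => //; exact: closed_dot_eq.
have mD : (@hausdorff R m.+2 m.+1).-caratheodory D.
  have -> : D = face K u `\` (face K u `\` D).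
    rewrite setDD; symmetry; apply/setIidPr; exact: gauss_preimage_sub_face.
  apply: caratheodory_measurable_setD; first exact: hausdorff_caratheodory_closed.
  by apply: caratheodory_null; exact: face_gauss_preimage_null.
have HD : hausdorff m.+1 D = (vol S)%:E.
  rewrite -(hausdorff_section _ u1 clK bK) -face_section; apply/eqP; rewrite eq_le.
  apply/andP; split; first by apply: le_outer_measure; exact: gauss_preimage_sub_face.
  have -> : face K u = D `|` (face K u `\` D).
    by rewrite setDUK//; exact: gauss_preimage_sub_face.
  apply: le_trans (outer_measureU2 _ _ _) _.
  by rewrite [X in (_ + X)%E]face_gauss_preimage_null adde0.
rewrite /cone_volume -/D (eq_integral (fun=> h%:E)) => [|x]; last first.
  rewrite inE => Dx; have [_ /= xu] := gauss_preimage_sub_face Dx.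
  by case: Dx => _ /= ->; rewrite xu.
rewrite integral_cst// EFinM EFinM; congr (_ * (_ * _))%E.
exact: HD.
Qed.

End cone_volume_face.

(** * The inequality and its equality case *)
Section tight_prism.
Context {R : realType} {m : nat}.

(** The slice in the middle contains the half-sum of the extreme ones and has no more volume, so
    that equality holds in Brunn-Minkowski: the extreme slices are translates of each other by a
    vector [t]. By convexity each slice contains the translate of the slice at [r] by the
    proportional part of [t]; having no more volume, it is equal to it. *)
Lemma tight_slices (C : set 'rV[R]_m.+2) (l r A : R) : l < r ->
    closed C -> bounded_set C -> cvx C ->
    slice C l !=set0 -> slice C r !=set0 ->
    vol (slice C l) = A -> vol (slice C r) = A -> 0 < A -> vol C <= (r - l) * A ->
  exists2 t, slice C l = [set y + t | y in slice C r] &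
    forall s, l <= s <= r -> slice C s `<=` [set y + ((r - s) / (r - l)) *: t | y in slice C r].
Proof.
move=> lr clC bC cC nl nr vl vr A0 vC.
have rl : 0 < r - l by rewrite subr_gt0.
have ns s : l <= s <= r -> slice C s !=set0.
  move=> /andP[ls sr]; have [[y yl] [z zr]] := (nl, nr).
  have := @slice_comb _ _ C ((s - l) / (r - l)) ((r - s) / (r - l)) _ _ _ _ cC _ _ _ zr yl.
  rewrite (_ : (s - l) / (r - l) * r + _ = s); last by field; rewrite gt_eqF.
  move=> h; eexists; apply: h.
  - by apply: divr_ge0; rewrite subr_ge0// ltW.
  - by apply: divr_ge0; rewrite subr_ge0// ltW.
  - by field; rewrite gt_eqF.
have vs s : l <= s <= r -> vol (slice C s) <= A.
  move=> lsr; have [->|sl] := eqVneq s l; first by rewrite vl.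
  have [->|sr] := eqVneq s r; first by rewrite vr.
  apply: (@tight_slice_le R m C l s r) => //; last exact: ns.
  by move/andP: lsr => [h1 h2]; rewrite !lt_neqAle h1 h2 sr eq_sym sl.
pose mid := (l + r) / 2.
have midP : l <= mid <= r by rewrite /mid; apply/andP; split; lra.
have bs s : bounded_set (slice C s) by exact: slice_bounded.
have cs s : cvx (slice C s) by exact: slice_cvx.
have ks s : closed (slice C s) by exact: slice_closed.
pose X := [set 2 *: y + 0 | y in slice C mid].
have vX : vol X = 2 ^+ m.+1 * vol (slice C mid) by exact: vol_affine.
have bX : bounded_set X.
  have /bounded_rVP[M M0 hM] := bs mid; apply/bounded_rVP; exists (2 * M).
    exact: mulr_gt0.
  by move=> _ [y /hM yM <-]; rewrite addr0 normrZ ger0_norm// ler_pM2l.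
have [||||t St] := @brunn_minkowski_eq R m (slice C l) (slice C r) X
  (bs _) (bs _) bX (ks _) (ks _) (cs _) (cs _).
- move=> x y xl yr; exists (2^-1 *: x + 2^-1 *: y).
    rewrite (_ : mid = 2^-1 * l + 2^-1 * r); last by rewrite /mid; lra.
    by apply: slice_comb => //; lra.
  by rewrite scalerDr !scalerA divff ?pnatr_eq0// !scale1r addr0.
- by rewrite vl.
- by rewrite vl vr.
- by rewrite vX vl; apply: ler_wpM2l; [exact: exprn_ge0|exact: vs].
exists t => // s lsr; set k := _ / _.
apply: (@subset_of_same_volume R m) => //.
- rewrite (_ : [set _ | _ in _] = [set y | slice C r (y - k *: t)]); last first.
    apply/seteqP; split=> [_ [y yr <-]|y yr]; first by rewrite /= addrK.
    by exists (y - k *: t) => //; rewrite subrK.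
  rewrite -openC; apply/open_rVP => y ny.
  have /open_rVP/(_ _ ny)[d d0 dS] : open (~` slice C r) by exact: closed_openC.
  by exists d => // z yz; apply: dS; rewrite opprB addrA subrK.
- move=> _ [y yr <-]; have k0 : 0 <= k <= 1.
    move/andP: lsr => [ls sr]; apply/andP; split.
      by apply: divr_ge0; rewrite subr_ge0// ltW.
    by rewrite ler_pdivrMr// mul1r; lra.
  have ytl : slice C l (y + t) by rewrite St; exists y.
  have := @slice_comb _ _ C (1 - k) k _ _ _ _ cC _ _ _ yr ytl.
  rewrite (_ : _ * r + _ = s); last by rewrite /k; field; rewrite gt_eqF.
  rewrite scalerDr addrA -scalerDl subrK scale1r; apply.
  + by move/andP: k0 => [_ ?]; rewrite subr_ge0.
  + by case/andP: k0.
  + by [].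
- by rewrite vol_translate vr; exact: vs.
- by rewrite vol_translate vr.
Qed.

End tight_prism.

Section cone_volume_bound.
Context {R : realType} {m : nat}.
Variables (K : set 'rV[R]_m.+2) (u : 'rV[R]_m.+2).
Hypotheses (cK : compact K) (cvK : cvx K) (K0 : interior K 0) (u1 : unit_sphere u).

Let a := support_fun K u.
Let b := support_fun K (- u).
Let C := reflected K u.
Let P := vol (slice C a).
Let Q := vol (slice C (- b)).

Let clK : closed K. Proof. by apply: compact_closed => //; exact: norm_hausdorff. Qed.
Let bK : bounded_set K. Proof. exact: compact_bounded. Qed.
Let nK : K !=set0. Proof. by exists 0; exact: interior_subset K0. Qed.
Let uN1 : unit_sphere (- u). Proof. by rewrite /unit_sphere/= enormN. Qed.
Let a0 : 0 < a. Proof. exact: support_fun_gt0. Qed.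
Let b0 : 0 < b. Proof. exact: support_fun_gt0. Qed.
Let ba : - b < a. Proof. by rewrite (lt_trans _ a0)// oppr_lt0. Qed.
Let clC : closed C. Proof. exact: closed_reflected. Qed.
Let bC : bounded_set C. Proof. exact: bounded_reflected. Qed.
Let cvC : cvx C. Proof. exact: cvx_reflected. Qed.

Let width x : K x -> - b <= dot x u <= a.
Proof.
move=> Kx; rewrite (support_fun_max u cK nK).2// andbT.
by rewrite lerNl -dotNr (support_fun_max (- u) cK nK).2.
Qed.

Let na : slice C a !=set0.
Proof.
have [[x Kx xa] _] := support_fun_max u cK nK.
have : face K u x by [].
by rewrite face_section section_slice// => -[y ? _]; exists y.
Qed.

Let nb : slice C (- b) !=set0.
Proof.
have [[x Kx xb] _] := support_fun_max (- u) cK nK.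
have : face K (- u) x by [].
by rewrite faceN_section section_slice// => -[y ? _]; exists y.
Qed.

Let vC0 : 0 < vol C.
Proof.
have /interior_rVP[d d0 dK] := K0.
have n0 : 0 < m.+2%:R :> R by rewrite ltr0n.
apply: (@ball_vol_gt0 _ _ _ 0 (d / m.+2%:R)) => // [|y]; first exact: divr_gt0.
rewrite sub0r normrN => yd; apply: dK; rewrite sub0r normrN.
by apply: le_lt_trans (norm_householder _ _) _; rewrite mulrC -ltr_pdivlMr.
Qed.

Lemma cone_volume_faces :
  cone_volume K [set u] = ((m.+2%:R)^-1 * (a * P))%:E /\
  cone_volume K [set (- u)%R] = ((m.+2%:R)^-1 * (b * Q))%:E.
Proof.
split; first exact: cone_volume_face.
rewrite cone_volume_face//; congr (_ * (_ * _))%:E; apply: EFin_inj.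
rewrite -(hausdorff_section _ uN1 clK bK) -face_section faceN_section.
exact: hausdorff_section.
Qed.

Lemma cone_volume_lhs :
  (cone_volume K [set u] + cone_volume K [set (- u)%R] +
     (2 * (m.+2%:R - 1))%:E *
       sqrte (cone_volume K [set u] * cone_volume K [set (- u)%R]) =
  ((m.+2%:R)^-1 * (a * P + b * Q + 2 * m.+1%:R * Num.sqrt (a * P * (b * Q))))%:E)%E.
Proof.
have [-> ->] := cone_volume_faces.
set n := m.+2%:R; set p := a * P; set q := b * Q.
transitivity (n^-1 * p + n^-1 * q +
    2 * (n - 1) * Num.sqrt (n^-1 * p * (n^-1 * q)))%:E; first by [].
have [p0 q0] : 0 <= p /\ 0 <= q by split; apply: mulr_ge0; rewrite ?vol_ge0 ?ltW.
congr (_%:E); rewrite mulrACA sqrtrM; last by rewrite mulr_ge0 ?invr_ge0.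
by rewrite -expr2 sqrtr_sqr ger0_norm ?invr_ge0// /n -[m.+2%:R]natr1 addrK; ring.
Qed.

Let lhs := a * P + b * Q + 2 * m.+1%:R * Num.sqrt (a * P * (b * Q)).

Let core : (0 < m)%N ->
  lhs <= m.+2%:R * vol C /\
  (lhs = m.+2%:R * vol C -> [/\ a = b, P = Q & vol C = (a + b) * P]).
Proof.
move=> m0; have n0 : 0 < m.+2%:R :> R by rewrite ltr0n.
have := @frustum_inequality R m a b (rootr m.+1 P) (rootr m.+1 Q) P Q m0 a0 b0
  (rootr_ge0 _ _) (rootr_ge0 _ _) (rootr_pow _) (rootr_pow _).
cbv zeta; rewrite -/lhs; set rhs := (a + b) * _ => -[le eq].
have fr : rhs <= m.+2%:R * vol C.
  have := frustum_lower ba bC cvC nb na.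
  by rewrite opprK mulrAC ler_pdivrMr// [vol C * _]mulrC.
split; first exact: le_trans le fr.
move=> lE; have [||ab PQ] := eq; first by rewrite lE.
  by apply: lt_le_trans le; rewrite lE mulr_gt0.
split=> //; apply: (mulfI (lt0r_neq0 n0)); rewrite -lE /lhs -PQ -ab.
rewrite -expr2 sqrtr_sqr ger0_norm; last by rewrite mulr_ge0 ?vol_ge0// ltW.
by rewrite -[m.+2%:R]natr1; ring.
Qed.

Let faceNE : face K (- u) = lift_slice u (- b) @` slice C (- b).
Proof. by rewrite faceN_section section_slice. Qed.

Let faceE : face K u = lift_slice u a @` slice C a.
Proof. by rewrite face_section section_slice. Qed.

Let lift_shift s s' y t :
  lift_slice u s y + householder u (consr s' t) = lift_slice u (s + s') (y + t).
Proof.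
rewrite /lift_slice -householderD; congr (householder u _).
by apply/rowP => i; rewrite !mxE; case: unliftP => [j|] _; rewrite ?mxE.
Qed.

Let lift_comb k s s' y y' :
  k *: lift_slice u s y + (1 - k) *: lift_slice u s' y' =
  lift_slice u (k * s + (1 - k) * s') (k *: y + (1 - k) *: y').
Proof. by rewrite /lift_slice -!householderZ -householderD consr_comb. Qed.

Let slice_lift s y : slice C s y -> K (lift_slice u s y).
Proof. by []. Qed.

(** By [tight_slices], each point of [K] lies on a segment that joins a point of one face to its
    translate in the other one. *)
Lemma prism_of_tight : P = Q -> vol C = (a + b) * P ->
  (exists t, face K (- u) = [set x + t | x in face K u]) /\
  K = convex_hull (face K u `|` face K (- u)).
Proof.
move=> PQ vCE; have ab0 : 0 < a + b by rewrite addr_gt0.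
have P0 : 0 < P by move: vC0; rewrite vCE pmulr_rgt0.
have [|t tE tP] := @tight_slices R m C (- b) a P ba clC bC cvC nb na (esym PQ) erefl P0.
  by rewrite vCE opprK.
split.
  exists (householder u (consr (- b - a) t)); rewrite faceNE faceE tE.
  apply/seteqP; split=> [_ [_ [y Sy <-] <-]|_ [_ [y Sy <-] <-]].
    exists (lift_slice u a y); first by exists y.
    by rewrite lift_shift [a + _]addrC subrK.
  exists (y + t); first by exists y.
  by rewrite lift_shift [a + _]addrC subrK.
apply/seteqP; split=> [x Kx|]; last first.
  by apply: convex_hull_sub => // x [[]|[]].
have : section K u (dot x u) x by [].
rewrite section_slice// => -[y yS <-].
have [z Sz <-] := tP _ (width Kx) _ yS.
rewrite opprK; set s := dot x u; set k := (a - s) / (a + b).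
have /andP[bs sa] : - b <= s <= a := width Kx.
apply: convex_hull_mem => E cE FE.
have Ez : E (lift_slice u a z) by apply: FE; left; rewrite faceE; exists z.
have Ezt : E (lift_slice u (- b) (z + t)).
  by apply: FE; right; rewrite faceNE tE; exists (z + t) => //; exists z.
have k01 : 0 <= k <= 1.
  rewrite /k ler_pdivrMr// mul1r divr_ge0 ?subr_ge0// ?(ltW ab0)//=; lra.
have := cE _ _ k Ezt Ez k01; rewrite lift_comb.
rewrite (_ : k * - b + (1 - k) * a = s); last by rewrite /k; field; rewrite gt_eqF.
rewrite (_ : _ *: (z + t) + _ = z + k *: t)//.
by apply/rowP => i; rewrite !mxE; ring.
Qed.

(** The oblique prism [E] between the two faces is convex, so that it contains the hull [K];
    hence no slice of [K] is larger than the face. *)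
Lemma tight_of_prism t : face K (- u) = [set x + t | x in face K u] ->
    K = convex_hull (face K u `|` face K (- u)) ->
  P = Q /\ vol C <= (a + b) * P.
Proof.
move=> Ft KE; have ab0 : 0 < a + b by rewrite addr_gt0.
pose v := tailr (householder u t).
have tail_lift s y : tailr (householder u (lift_slice u s y)) = y by exact: lift_sliceK.
have tail_shift s y : tailr (householder u (lift_slice u s y + t)) = y + v.
  by rewrite -[in RHS](tail_lift s y) householderD; apply/rowP => i; rewrite !mxE.
have Sv : slice C (- b) = [set y + v | y in slice C a].
  apply/seteqP; split=> [y Sy|_ [z Sz <-]].
    have : face K (- u) (lift_slice u (- b) y) by rewrite faceNE; exists y.
    rewrite Ft => -[x]; rewrite faceE => -[z Sz <-] zy; exists z => //.
    by rewrite -(tail_shift a) zy tail_lift.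
  have : face K (- u) (lift_slice u a z + t).
    by rewrite Ft; exists (lift_slice u a z) => //; rewrite faceE; exists z.
  by rewrite faceNE => -[y Sy yE]; rewrite -(tail_shift a) -yE tail_lift.
clearbody v; split; first by rewrite /Q Sv vol_translate.
pose E := [set x | slice C a (tailr (householder u x) - ((a - dot x u) / (a + b)) *: v)].
have cE : cvx E.
  move=> x y k Ex Ey k01; rewrite /E/=.
  have := slice_cvx cvC Ex Ey k01; congr (slice C a _).
  rewrite householderD !householderZ dotDl !dotZl.
  move: (householder u x) (householder u y) => p q.
  apply/rowP => i; rewrite !mxE.
  by field; rewrite gt_eqF.
have KsubE : K `<=` E.
  rewrite KE; apply: convex_hull_sub => // x [].
    rewrite faceE => -[z Sz <-]; rewrite /E/= tail_lift dot_lift_slice//.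
    by rewrite subrr mul0r scale0r subr0.
  rewrite faceNE Sv => -[_ [z Sz <-] <-]; rewrite /E/= tail_lift dot_lift_slice//.
  by rewrite opprK divff ?gt_eqF// scale1r addrK.
rewrite -[b in a + b]opprK; apply: volume_le_of_slices => // [x Cx|s sab].
  by rewrite -(dot_householder _ u1); exact: width.
rewrite /P -(vol_translate (((a - s) / (a + b)) *: v) (slice C a)).
apply: le_vol.
  have /bounded_rVP[M M0 hM] := slice_bounded a bC; set w := _ *: v.
  apply/bounded_rVP; exists (M + `|w|) => [|_ [y /hM yM <-]]; first by rewrite ltr_pwDl.
  by apply: le_trans (ler_normD _ _) _; rewrite lerD2r.
move=> y /slice_lift/KsubE; rewrite /E/= tail_lift dot_lift_slice// => Ey.
by eexists; [exact: Ey|rewrite subrK].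
Qed.

Lemma cone_volume_inequality : (0 < m)%N ->
  ((m.+2%:R)^-1 * lhs <= vol C) /\
  ((m.+2%:R)^-1 * lhs = vol C <->
   [/\ exists t, face K (- u) = [set x + t | x in face K u],
     K = convex_hull (face K u `|` face K (- u)) & a = b]).
Proof.
move=> m0; have n0 : 0 < m.+2%:R :> R by rewrite ltr0n.
have [le eq] := core m0.
have le' : (m.+2%:R)^-1 * lhs <= vol C by rewrite ler_pdivrMl.
split=> //; split=> [E|[[t Ft] KE ab]].
  have [|ab PQ vE] := eq; first by rewrite -E mulVKf ?gt_eqF.
  by have [h1 h2] := prism_of_tight PQ vE.
have [PQ vle] := tight_of_prism Ft KE.
apply/eqP; rewrite eq_le le'/=; apply: le_trans vle _.
rewrite /lhs -PQ -ab -expr2 sqrtr_sqr ger0_norm; last by rewrite mulr_ge0 ?vol_ge0// ltW.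
rewrite le_eqVlt -[m.+2%:R]natr1; apply/orP; left; apply/eqP; field.
by rewrite nat1r natr1 pnatr_eq0.
Qed.

End cone_volume_bound.

Theorem lemma6p2 (R : realType) (n : nat) (K : set 'rV[R]_n)
    (n_ge3 : (3 <= n)%N) (K_body : convex_body K) (K_0 : interior K 0)
    (u : 'rV[R]_n) (u_unit : unit_sphere u) :
  let lhs : \bar R :=
    (cone_volume K [set u] + cone_volume K [set (- u)%R] +
     (2 * (n%:R - 1))%:E *
       sqrte (cone_volume K [set u] * cone_volume K [set (- u)%R]))%E in
  (lhs <= volume K)%E /\
  (lhs = volume K <->
    [/\ exists t : 'rV[R]_n, face K (- u) = [set x + t | x in face K u],
        K = convex_hull (face K u `|` face K (- u)) &
        support_fun K u = support_fun K (- u)]).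
Proof.
case: n => [//|[//|m]] in K n_ge3 K_body K_0 u u_unit *.
have [cK /convex_setP cvK _] := K_body; cbv zeta.
rewrite cone_volume_lhs// -(volume_reflected u (compact_closed (@norm_hausdorff _ _) cK) (compact_bounded cK)).
rewrite volE; last by apply: bounded_reflected; exact: compact_bounded.
have [le eq] := cone_volume_inequality cK cvK K_0 u_unit n_ge3.
rewrite lee_fin; split=> //; rewrite -eq; by split=> [E|->//]; exact: EFin_inj E.
Qed.
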